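(* Suppose that (QSA1)--(QSA5) hold, that $\{\Theta_t\}$ solves $\frac{d}{dt}\Theta_t=a_tf(\Theta_t,\xi_t)$ with $a_t=(1+t)^{-\rho}$, $\rho\in(1/2,1)$, and that the Polyak--Ruppert averages $$\Theta^{\rm PR}_T=\frac1{T-T_0}\int_{T_0}^T\Theta_t\,dt$$ are obtained using $T_0=(1-1/\kappa)T$ with $\kappa>1$ fixed. Then $$\Theta_t=\theta^*+a_t[\bar Y^*-\hat f^*_t]+o(a_t),$$ $$\Theta^{\rm PR}_T=\theta^*+a_T[c(\kappa,\rho)+o(1)]\bar Y^*+O(T^{-2\rho}),$$ with $c(\kappa,\rho)=\kappa\,[1-(1-1/\kappa)^{1-\rho}]/(1-\rho)$, $\bar Y^*=[A^*]^{-1}\bar\Upsilon(\theta^* )$ and $\hat f^*_t=\hat f(\theta^*,\Phi_t)$.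
   Context: Setup. Let $d,m,K\ge1$ be integers and $j=\sqrt{-1}$. The probing signal is $\xi_t=G_0(\xi^0_t)\in\mathbb R^m$, $\xi^0_t=(\cos(2\pi[\omega_1t+\phi_1]),\dots,\cos(2\pi[\omega_Kt+\phi_K]))^{\top}$, with distinct frequencies $\omega_i$, arbitrary phases $\phi_i$, and $G_0:\mathbb R^K\to\mathbb R^m$ analytic on $\mathbb C^K$. Put $\Phi_t=(\exp(2\pi j[\omega_it+\phi_i]))_{i=1}^K\in\Omega=\{z\in\mathbb C^K:|z_i|=1,\ 1\le i\le K\}$. With $G(z)=G_0(\tfrac12(z+z^{-1}))$ (entrywise inverse), $\xi_t=G(\Phi_t)$. Let $\pi$ be the uniform distribution on $\Omega$. The function $f:\mathbb R^d\times\mathbb R^m\to\mathbb R^d$ is given, $\{a_t\}$ is the gain process, and $\bar f(\theta)=\lim_{T\to\infty}\frac1T\int_0^Tf(\theta,\xi_t)\,dt=\int_\Omega f(\theta,G(z))\,\pi(dz)$. $O(\delta_t)$ denotes a function of $t$ bounded in norm by a constant times $\delta_t$. (QSA1) $\{a_t\}$ is non-negative, monotonically decreasing, $\lim_{t\to\infty}a_t=0$ and $\int_0^\infty a_r\,dr=\infty$. (QSA2) There is $L_f<\infty$ with $\|\bar f(\theta')-\bar f(\theta)\|\le L_f\|\theta'-\theta\|$ and $\|f(\theta',\xi)-f(\theta,\xi)\|+\|f(\theta,\xi')-f(\theta,\xi)\|\le L_f[\|\theta'-\theta\|+\|\xi'-\xi\|]$ for all $\theta,\theta'\in\mathbb R^d$,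 $\xi,\xi'\in\mathbb R^m$. (QSA3) The ODE $\frac{d}{dt}\vartheta_t=\bar f(\vartheta_t)$ is globally asymptotically stable with unique equilibrium $\theta^*$, and one of the following holds: (a) there is a Lipschitz continuous Lyapunov function $V:\mathbb R^d\to\mathbb R_+$, a constant $\delta_0>0$ and a compact set $S$ such that $\nabla V(\vartheta_t)\cdot\bar f(\vartheta_t)\le-\delta_0\|\vartheta_t\|$ whenever $\vartheta_t\notin S$; or (b) $\bar f_\infty(\theta)=\lim_{c\to\infty}\bar f(c\theta)/c$ exists for all $\theta$ as a continuous function, and the ODE $\frac{d}{dt}x_t=\bar f_\infty(x_t)$ is globally asymptotically stable. (QSA4) $\bar f$ is $C^1$, its Jacobian $\bar A(\theta)=\partial_\theta\bar f(\theta)$ is bounded and Lipschitz continuous, and $A^*=\bar A(\theta^* )$ is Hurwitz. (QSA5) For each initial condition $\Phi_0\in\Omega$ the time averages of the functions below exist and equal their $\pi$-averages, and for each $\theta$: (i) there is $\hat f(\theta,\cdot)$ with $\hat f(\theta,\Phi_{t_0})=\int_{t_0}^{t_1}[f(\theta,\xi_t)-\bar f(\theta)]\,dt+\hat f(\theta,\Phi_{t_1})$ for $0\le t_0\le t_1$ and $\int_\Omega\hat f(\theta,z)\,\pi(dz)=0$; $\hat f$ is $C^1$ on $\mathbb R^d\times\Omega$; and $\hat A=\partial_\theta\hat f$ satisfies $\int_\Omega\hat A(\theta,z)\,\pi(dz)=0$. (ii) With $\Upsilon(\theta,z)=-\hat A(\theta,z)f(\theta,G(z))$ and $\bar\Upsilon(\theta)=\lim_{T\to\infty}\frac1T\int_0^T\Upsilon(\theta,\Phi_t)\,dt=\int_\Omega\Upsilon(\theta,z)\,\pi(dz)$,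 there are $C^1$ functions $\hat{\hat f},\hat\Upsilon$ on $\mathbb R^d\times\Omega$ with $\hat{\hat f}(\theta,\Phi_{t_0})=\int_{t_0}^{t_1}\hat f(\theta,\Phi_t)\,dt+\hat{\hat f}(\theta,\Phi_{t_1})$ and $\hat\Upsilon(\theta,\Phi_{t_0})=\int_{t_0}^{t_1}[\Upsilon(\theta,\Phi_t)-\bar\Upsilon(\theta)]\,dt+\hat\Upsilon(\theta,\Phi_{t_1})$ for $0\le t_0\le t_1$, and $\int_\Omega\hat{\hat f}(\theta,z)\,\pi(dz)=\int_\Omega\hat\Upsilon(\theta,z)\,\pi(dz)=0$. Moreover $\hat f$ and $\hat\Upsilon$ are Lipschitz continuous in $\theta$. *)

(* Defs.v *)
From HB Require Import structures.
From mathcomp Require Import all_boot all_order all_algebra.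
From mathcomp Require Import complex.
From mathcomp Require Import all_classical all_reals all_analysis.

Set Implicit Arguments.
Unset Strict Implicit.
Unset Printing Implicit Defensive.

Import Order.TTheory GRing.Theory Num.Theory.
Import numFieldNormedType.Exports.

Local Open Scope classical_set_scope.
Local Open Scope ring_scope.
Local Open Scope complex_scope.

(* Vectors are rows.  In the library ['J F x] is the matrix such that
   ['d F x v = v *m 'J F x], i.e. the transpose of the usual Jacobian, so every
   "matrix times column vector" of the text is written "row times 'J".  The norm
   of 'rV[R]_n and 'M[R]_n is the maximum norm. *)

Definition mxint (R : realType) (p n : nat) (a b : R) (h : R -> 'M[R]_(p, n)) :
    'M[R]_(p, n) :=
  \matrix_(i, j) \int[lebesgue_measure]_(t in `[a, b]) h t i j.

Definition C1 (R : realType) (n p : nat) (F : 'rV[R]_n -> 'rV[R]_p) : Prop :=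
  (forall x, differentiable F x) /\ continuous (fun x => 'J F x).

Definition gradient (R : realType) (n : nat) (V : 'rV[R]_n -> R) (x : 'rV[R]_n) :
    'rV[R]_n :=
  \row_i 'D_(delta_mx 0 i) V x.

Definition dot (R : realType) (n : nat) (u v : 'rV[R]_n) : R :=
  \sum_i u 0 i * v 0 i.

Definition Hurwitz (R : realType) (n : nat) (A : 'M[R]_n) : Prop :=
  forall l : R[i],
    eigenvalue (map_mx (real_complex R) A) l -> complex.Re l < 0.

(* Solutions on [0, +oo[ of x' = F t x. *)
Definition ode_solution (R : realType) (n : nat) (F : R -> 'rV[R]_n -> 'rV[R]_n)
    (x : R -> 'rV[R]_n) : Prop :=
  {within `[0, +oo[, continuous x} /\
  forall t : R, 0 < t -> is_derive t (1 : R) x (F t (x t)).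

Definition globally_asymptotically_stable (R : realType) (n : nat)
    (F : 'rV[R]_n -> 'rV[R]_n) (xs : 'rV[R]_n) : Prop :=
  [/\ F xs = 0,
      forall eps : R, 0 < eps -> exists2 delta : R, 0 < delta &
        forall x : R -> 'rV[R]_n, ode_solution (fun=> F) x ->
          `|x 0 - xs| < delta -> forall t : R, 0 <= t -> `|x t - xs| < eps
    & forall x : R -> 'rV[R]_n, ode_solution (fun=> F) x ->
        x t @[t --> +oo] --> xs].

(* Sum of an absolutely convergent power series on a polydisc around z0; the
   multi-indices al are summed over the cubes {0, ..., N-1}^K. *)
Definition analytic_at (R : realType) (K : nat) (F : 'rV[R[i]]_K -> R[i])
    (z0 : 'rV[R[i]]_K) : Prop :=
  exists (c : ('I_K -> nat) -> R[i]) (r : R),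
    [/\ 0 < r,
        exists M : R, forall N : nat,
          \sum_(al : {ffun 'I_K -> 'I_N})
             `|c (fun k => al k)| * r%:C ^+ (\sum_k al k)%N <= M%:C
      & forall z : 'rV[R[i]]_K, (forall k, `|z 0 k - z0 0 k| < r%:C) ->
          (fun N : nat => \sum_(al : {ffun 'I_K -> 'I_N})
             c (fun k => al k) * \prod_k (z 0 k - z0 0 k) ^+ al k)
          @ \oo --> (F z : R[i]^o)].

Definition analytic_on_CK (R : realType) (K m : nat)
    (G0 : 'rV[R]_K -> 'rV[R]_m) : Prop :=
  exists F : 'rV[R[i]]_K -> 'rV[R[i]]_m,
    (forall j z0, analytic_at (fun z => F z 0 j) z0) /\
    (forall x, F (map_mx (real_complex R) x) = map_mx (real_complex R) (G0 x)).

Definition cis2pi (R : realType) (x : R) : R[i] :=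
  cos (2 * pi * x) +i* sin (2 * pi * x).

Definition Omega (R : realType) (K : nat) : set 'rV[R[i]]_K :=
  [set z | forall k, `|z 0 k| = 1].

Definition circle (R : realType) (K : nat) (x : 'I_K -> R) : 'rV[R[i]]_K :=
  \row_k cis2pi (x k).

Lemma measurable_tuple_cons (R : realType) (n : nat) :
  measurable_fun setT
    (fun p : measurableTypeR R * n.-tuple (measurableTypeR R) =>
       [the n.+1.-tuple _ of p.1 :: p.2]).
Proof. by apply: measurable_cons; [exact: measurable_fst|exact: measurable_snd]. Qed.

(* Product of K copies of the uniform distribution on [0, 1]. *)
Fixpoint uniform_cube (R : realType) (K : nat) :
    probability (K.-tuple (measurableTypeR R)) R :=
  if K is n.+1 then
    distribution (uniform_prob (@ltr01 R) \x uniform_cube R n)%E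
      (mfun_Sub (mem_set (measurable_tuple_cons (n := n))))
  else dirac [tuple].

(* Integration against the uniform distribution pi on Omega, which is the image
   of uniform_cube under (x_k) |-> (exp (2 pi j x_k)). *)
Definition Omega_mean (R : realType) (K p n : nat)
    (h : 'rV[R[i]]_K -> 'M[R]_(p, n)) : 'M[R]_(p, n) :=
  \matrix_(i, j) \int[uniform_cube R K]_x h (circle (tnth x)) i j.

(* C^1 on R^d x Omega, in the angular coordinates of Omega. *)
Definition C1_Omega (R : realType) (d K p : nat)
    (h : 'rV[R]_d -> 'rV[R[i]]_K -> 'rV[R]_p) : Prop :=
  C1 (fun x : 'rV[R]_(d + K) => h (lsubmx x) (circle (rsubmx x 0))).

Definition xi (R : realType) (K m : nat) (G0 : 'rV[R]_K -> 'rV[R]_m)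
    (omega phi : 'I_K -> R) (t : R) : 'rV[R]_m :=
  G0 (\row_k cos (2 * pi * (omega k * t + phi k))).

Definition Phi (R : realType) (K : nat) (omega phi : 'I_K -> R) (t : R) :
    'rV[R[i]]_K :=
  circle (fun k => omega k * t + phi k).

(* The process Phi_t started from Phi_0 = z. *)
Definition Phi_from (R : realType) (K : nat) (omega : 'I_K -> R)
    (z : 'rV[R[i]]_K) (t : R) : 'rV[R[i]]_K :=
  \row_k (cis2pi (omega k * t) * z 0 k).

(* (z + z^-1) / 2 is real for z in Omega, the only place where G is used; Re is
   then the mere identification of a real complex number with a real. *)
Definition G (R : realType) (K m : nat) (G0 : 'rV[R]_K -> 'rV[R]_m)
    (z : 'rV[R[i]]_K) : 'rV[R]_m :=
  G0 (\row_k complex.Re (2^-1 * (z 0 k + (z 0 k)^-1))).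

Definition fbar (R : realType) (d m K : nat)
    (f : 'rV[R]_d -> 'rV[R]_m -> 'rV[R]_d) (G0 : 'rV[R]_K -> 'rV[R]_m)
    (theta : 'rV[R]_d) : 'rV[R]_d :=
  Omega_mean (fun z => f theta (G G0 z)).

Definition Ahat (R : realType) (d K : nat)
    (fhat : 'rV[R]_d -> 'rV[R[i]]_K -> 'rV[R]_d)
    (theta : 'rV[R]_d) (z : 'rV[R[i]]_K) : 'M[R]_d :=
  'J (fun th => fhat th z) theta.

Definition Upsilon (R : realType) (d m K : nat)
    (f : 'rV[R]_d -> 'rV[R]_m -> 'rV[R]_d) (G0 : 'rV[R]_K -> 'rV[R]_m)
    (fhat : 'rV[R]_d -> 'rV[R[i]]_K -> 'rV[R]_d)
    (theta : 'rV[R]_d) (z : 'rV[R[i]]_K) : 'rV[R]_d :=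
  - (f theta (G G0 z) *m Ahat fhat theta z).

Definition Upsilonbar (R : realType) (d m K : nat)
    (f : 'rV[R]_d -> 'rV[R]_m -> 'rV[R]_d) (G0 : 'rV[R]_K -> 'rV[R]_m)
    (fhat : 'rV[R]_d -> 'rV[R[i]]_K -> 'rV[R]_d) (theta : 'rV[R]_d) : 'rV[R]_d :=
  Omega_mean (Upsilon f G0 fhat theta).

Definition QSA1 (R : realType) (a : R -> R) : Prop :=
  [/\ forall t, 0 <= t -> 0 <= a t,
      forall s t, 0 <= s -> s <= t -> a t <= a s,
      a t @[t --> +oo] --> (0 : R)
    & (\int[lebesgue_measure]_(t in `[0%R, +oo[) (a t)%:E = +oo)%E].

Definition QSA2 (R : realType) (d m K : nat)
    (f : 'rV[R]_d -> 'rV[R]_m -> 'rV[R]_d) (G0 : 'rV[R]_K -> 'rV[R]_m) : Prop :=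
  exists Lf : R,
    (forall th th', `|fbar f G0 th' - fbar f G0 th| <= Lf * `|th' - th|) /\
    (forall th th' x x',
       `|f th' x - f th x| + `|f th x' - f th x| <=
       Lf * (`|th' - th| + `|x' - x|)).

(* V is only required to be differentiable where its gradient is used. *)
Definition QSA3a (R : realType) (d : nat) (F : 'rV[R]_d -> 'rV[R]_d) : Prop :=
  exists (V : 'rV[R]_d -> R) (L delta0 : R) (S : set 'rV[R]_d),
    [/\ forall th, 0 <= V th,
        forall th th', `|V th' - V th| <= L * `|th' - th|,
        0 < delta0,
        compact S
      & forall x : R -> 'rV[R]_d, ode_solution (fun=> F) x ->
          forall t, 0 <= t -> ~ S (x t) ->
            differentiable V (x t) /\
            dot (gradient V (x t)) (F (x t)) <= - delta0 * `|x t|].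

Definition QSA3b (R : realType) (d : nat) (F : 'rV[R]_d -> 'rV[R]_d) : Prop :=
  exists Finf : 'rV[R]_d -> 'rV[R]_d,
    [/\ forall th, c^-1 *: F (c *: th) @[c --> +oo] --> Finf th,
        continuous Finf
      & globally_asymptotically_stable Finf 0].

Definition QSA3 (R : realType) (d : nat) (F : 'rV[R]_d -> 'rV[R]_d)
    (thetas : 'rV[R]_d) : Prop :=
  [/\ globally_asymptotically_stable F thetas,
      forall th, F th = 0 -> th = thetas
    & QSA3a F \/ QSA3b F].

Definition QSA4 (R : realType) (d : nat) (F : 'rV[R]_d -> 'rV[R]_d)
    (thetas : 'rV[R]_d) : Prop :=
  [/\ C1 F,
      exists B : R, forall th, `|'J F th| <= B,
      exists L : R, forall th th', `|'J F th' - 'J F th| <= L * `|th' - th|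
    & Hurwitz ('J F thetas)].

(* From every initial condition, the time average of h exists and is its
   pi-average. *)
Definition ergodic (R : realType) (K p n : nat) (omega : 'I_K -> R)
    (h : 'rV[R[i]]_K -> 'M[R]_(p, n)) : Prop :=
  forall z, Omega z ->
    T^-1 *: mxint 0 T (fun t => h (Phi_from omega z t)) @[T --> +oo]
      --> Omega_mean h.

(* hhat solves Poisson's equation with forcing function h. *)
Definition poisson (R : realType) (K n : nat) (omega : 'I_K -> R)
    (h hhat : 'rV[R[i]]_K -> 'rV[R]_n) : Prop :=
  forall z, Omega z -> forall t0 t1 : R, 0 <= t0 -> t0 <= t1 ->
    hhat (Phi_from omega z t0) =
    mxint t0 t1 (fun t => h (Phi_from omega z t)) + hhat (Phi_from omega z t1).

Definition lipschitz_in_theta (R : realType) (d K p : nat)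
    (h : 'rV[R]_d -> 'rV[R[i]]_K -> 'rV[R]_p) : Prop :=
  exists L : R, forall th th' z, Omega z -> `|h th' z - h th z| <= L * `|th' - th|.

Record QSA5 (R : realType) (d m K : nat) (omega : 'I_K -> R)
    (f : 'rV[R]_d -> 'rV[R]_m -> 'rV[R]_d) (G0 : 'rV[R]_K -> 'rV[R]_m)
    (fhat fhathat Upsilonhat : 'rV[R]_d -> 'rV[R[i]]_K -> 'rV[R]_d) : Prop :=
  { QSA5_ergodic : forall th,
      [/\ ergodic omega (fun z => f th (G G0 z)),
          ergodic omega (fhat th),
          ergodic omega (Ahat fhat th)
        & ergodic omega (Upsilon f G0 fhat th)] /\
      ergodic omega (fhathat th) /\ ergodic omega (Upsilonhat th);
    QSA5_fhat : forall th,
      poisson omega (fun z => f th (G G0 z) - fbar f G0 th) (fhat th);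
    QSA5_fhat_mean : forall th, Omega_mean (fhat th) = 0;
    QSA5_fhat_C1 : C1_Omega fhat;
    QSA5_Ahat_mean : forall th, Omega_mean (Ahat fhat th) = 0;
    QSA5_fhathat_C1 : C1_Omega fhathat;
    QSA5_Upsilonhat_C1 : C1_Omega Upsilonhat;
    QSA5_fhathat : forall th, poisson omega (fhat th) (fhathat th);
    QSA5_Upsilonhat : forall th,
      poisson omega (fun z => Upsilon f G0 fhat th z - Upsilonbar f G0 fhat th)
        (Upsilonhat th);
    QSA5_fhathat_mean : forall th, Omega_mean (fhathat th) = 0;
    QSA5_Upsilonhat_mean : forall th, Omega_mean (Upsilonhat th) = 0;
    QSA5_fhat_lip : lipschitz_in_theta fhat;
    QSA5_Upsilonhat_lip : lipschitz_in_theta Upsilonhat }.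

(* The inverse of A* applied to Upsilonbar, in row convention. *)
Definition Ybar (R : realType) (d m K : nat)
    (f : 'rV[R]_d -> 'rV[R]_m -> 'rV[R]_d) (G0 : 'rV[R]_K -> 'rV[R]_m)
    (fhat : 'rV[R]_d -> 'rV[R[i]]_K -> 'rV[R]_d) (thetas : 'rV[R]_d) : 'rV[R]_d :=
  Upsilonbar f G0 fhat thetas *m invmx ('J (fbar f G0) thetas).

Definition ThetaPR (R : realType) (d : nat) (Theta : R -> 'rV[R]_d)
    (kappa T : R) : 'rV[R]_d :=
  let T0 := (1 - kappa^-1) * T in
  (T - T0)^-1 *: mxint T0 T Theta.

Definition cPR (R : realType) (kappa rho : R) : R :=
  kappa * (1 - (1 - kappa^-1) `^ (1 - rho)) / (1 - rho).

(* The Landau notations f =o_ F g need F in packed form. *)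
Definition at_pinfty (R : realType) : filter_on R :=
  FilterType (pinfty_nbhs R) (@filter_filter _ _ _).

(* Main.v *)
Require Import Defs.
From HB Require Import structures.
From mathcomp Require Import all_boot all_order all_algebra.
From mathcomp Require Import complex.
From mathcomp Require Import all_classical all_reals all_analysis.
From mathcomp Require Import ring lra.

Import Order.TTheory GRing.Theory Num.Theory.
Import numFieldNormedType.Exports.

Local Open Scope classical_set_scope.
Local Open Scope ring_scope.

(** The heart of the matter is a symmetry.  The signal is a function of cosines,
    so along the orbit of the phases through the point (1, ..., 1) the field is an
    even function of time.  A solution [fhat] of Poisson's equation is therefore,
    along this orbit, an odd function of time plus a constant.  Since the phases
    recur, averages over suitable long intervals feel the reversal of time, and
    ergodicity identifies them with means over the torus: the constant is the mean
    of [fhat], which is zero.  Hence [fhat], its derivative [Ahat] and [Upsilon]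
    are odd along the orbit, and by the same averaging argument the mean of
    [Upsilon] is zero ([Upsilonbar0]).  So [Ybar] vanishes, and the theorem says
    that [Theta t = thetas - a t *: fhat thetas (Phi omega phi t)] up to [o(a)]
    and that the Polyak-Ruppert average is [thetas] up to [O(T `^ (- 2 * rho))].

    Convergence.  Adding [a *: fhat] to [Theta] gives a variable [Y] whose
    derivative is [a] times the mean field up to [O(a ^+ 2)].  In the time scale [clock],
    whose derivative is the gain, [Y] follows the mean flow over windows of fixed
    length ([tracking]).  Either of [QSA3a] and [QSA3b] makes large initial
    conditions shrink by a factor within a fixed time ([QSA3a_returns],
    [QSA3b_returns]), which bounds [Y] ([Y_bounded]); global asymptotic stability
    is uniform over bounded sets of initial conditions ([uniform_attraction]), and
    [Y], hence [Theta], converges ([trajectory_converges]).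

    Rate.  The solutions [fhathat] and [Upsilonhat] of the further Poisson
    equations give a second change of variables, to [Z], which removes the
    oscillations of order [a ^+ 2].  No constant of this order is left, because the
    mean of [Upsilon] is zero, so that the derivative of [Z] is [a *: (Z *m A)] up
    to [a * O(Z ^+ 2 + a ^+ 2)], with [A] the Jacobian at the equilibrium.  A
    quadratic Lyapunov form for [A] ([hurwitz_lyapunov]), together with the slow
    variation of the gain, gives [Z = O(a ^+ 2)], and the error of the expansion
    of [Theta] is itself [O(a ^+ 2)] ([trajectory_expansion], [qsa_expansion]).

    Averages.  In the average of this expansion the error contributes
    [O(T `^ (- 2 * rho))], and so does the oscillating term, which is integrated by
    parts with the help of [fhathat] ([averaged_expansion]). *)

Set Implicit Arguments.
Unset Strict Implicit.
Unset Printing Implicit Defensive.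

(** * Matrix norms, paths and Gronwall's inequality *)

Section MaxNorm.
Variable R : realType.

Lemma norm_coord_le (p n : nat) (A : 'M[R]_(p, n)) i j : `|A i j| <= `|A|.
Proof.
rewrite [leRHS]/Num.Def.normr /= mx_normrE.
exact: (@le_bigmax _ _ _ _ (fun k : 'I_p * 'I_n => `|A k.1 k.2|) (i, j)).
Qed.

Lemma norm_coord_lub (p n : nat) (A : 'M[R]_(p, n)) (c : R) :
  0 <= c -> (forall i j, `|A i j| <= c) -> `|A| <= c.
Proof.
move=> c0 h; rewrite [leLHS]/Num.Def.normr /= mx_normrE.
by apply: bigmax_le => // -[i j] _; exact: h.
Qed.

Lemma norm_mulmx_le (p n q : nat) (A : 'M[R]_(p, n)) (B : 'M[R]_(n, q)) :
  `|A *m B| <= n%:R * `|A| * `|B|.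
Proof.
apply: norm_coord_lub => [|i j]; first by rewrite !mulr_ge0.
rewrite mxE (le_trans (ler_norm_sum _ _ _))//.
rewrite -mulrA mulr_natl -[n in _ *+ n]card_ord -sumr_const.
by apply: ler_sum => k _; rewrite normrM ler_pM// norm_coord_le.
Qed.

Lemma dotC n (u v : 'rV[R]_n) : dot u v = dot v u.
Proof. by apply: eq_bigr => i _; rewrite mulrC. Qed.

Lemma dotDr n (u v w : 'rV[R]_n) : dot u (v + w) = dot u v + dot u w.
Proof. by rewrite -big_split; apply: eq_bigr => i _; rewrite mxE mulrDr. Qed.

Lemma dotZr n c (u v : 'rV[R]_n) : dot u (c *: v) = c * dot u v.
Proof. by rewrite mulr_sumr; apply: eq_bigr => i _; rewrite mxE mulrCA. Qed.

Lemma dot_ge0 n (u : 'rV[R]_n) : 0 <= dot u u.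
Proof. by apply: sumr_ge0 => i _; rewrite -expr2 sqr_ge0. Qed.

Lemma dot_le n (u v : 'rV[R]_n) : `|dot u v| <= n%:R * (`|u| * `|v|).
Proof.
rewrite (le_trans (ler_norm_sum _ _ _))//.
rewrite mulr_natl -[n in _ *+ n]card_ord -sumr_const.
by apply: ler_sum => k _; rewrite normrM ler_pM// norm_coord_le.
Qed.

Lemma sqr_norm_le_dot n (u : 'rV[R]_n) : `|u| ^+ 2 <= dot u u.
Proof.
rewrite -[leRHS]sqr_sqrtr ?dot_ge0// ler_sqr ?nnegrE ?sqrtr_ge0//.
apply: norm_coord_lub => [|i j]; rewrite ?sqrtr_ge0// (ord1 i).
rewrite -sqrtr_sqr ler_sqrt; last by rewrite dot_ge0.
rewrite /dot (bigD1 j)//= -expr2 lerDl.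
by apply: sumr_ge0 => k _; rewrite -expr2 sqr_ge0.
Qed.

End MaxNorm.

Section Derivatives.
Variable R : realType.

Lemma near_dist_le (V : normedModType R) (x : V) (e : R) : 0 < e ->
  \forall y \near x, `|x - y| <= e.
Proof. by move=> e0; exact: ((cvgrPdist_le _ _).1 (@cvg_id _ (nbhs x)) e e0). Qed.

Lemma near_dist_ex (V : normedModType R) (x : V) (P : V -> Prop) :
  (\forall y \near x, P y) -> exists2 r : R, 0 < r & forall y, `|x - y| <= r -> P y.
Proof.
move=> /nbhs_normP[r /= r0 hr]; exists (r / 2); first by rewrite divr_gt0.
move=> y hy; apply: hr; rewrite /= (le_lt_trans hy)// ltr_pdivrMr// ltr_pMr//.
by rewrite ltr1n.
Qed.

Lemma lipschitz_continuous (V W : normedModType R) (F : V -> W) (L : R) :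
  (forall x y, `|F x - F y| <= L * `|x - y|) -> continuous F.
Proof.
move=> FL x; apply/cvgrPdist_le => e e0.
have L1 : 0 < `|L| + 1 by rewrite ltr_wpDl.
have e1 : 0 < e / (`|L| + 1) by rewrite divr_gt0.
apply: filterS (near_dist_le x e1) => y.
rewrite ler_pdivlMr// => h; apply: le_trans (FL x y) _; apply: le_trans h.
by rewrite mulrC ler_wpM2l// (le_trans (ler_norm L))// lerDl.
Qed.

Lemma is_derive_row n (x : R -> 'rV[R]_n) (v : 'rV[R]_n) (t : R) :
  is_derive t (1 : R) x v <-> forall i, is_derive t (1 : R) (fun s => x s 0 i) (v 0 i).
Proof.
split=> [[dx xv] i|h].
  have dxi : derivable (fun s => x s 0 i) t 1 by exact: (derivable_mxP x t 1).1.
  split=> //; move: xv; rewrite derive_mx// => /matrixP/(_ 0 i).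
  by rewrite mxE.
have dx : derivable x t 1.
  by apply/derivable_mxP => i j; rewrite (ord1 i); have [] := h j.
split=> //; rewrite derive_mx//; apply/matrixP => i j; rewrite mxE (ord1 i).
by have [] := h j.
Qed.

Lemma is_derive_continuous n (x : R -> 'rV[R]_n) (v : 'rV[R]_n) (t : R) :
  is_derive t (1 : R) x v -> {for t, continuous x}.
Proof. by case=> dx _; apply/differentiable_continuous/derivable1_diffP. Qed.

Lemma is_derive_continuous1 (x : R -> R) (v : R) (t : R) :
  is_derive t (1 : R) x v -> {for t, continuous x}.
Proof. by case=> dx _; apply/differentiable_continuous/derivable1_diffP. Qed.

Lemma continuous_row n (T : topologicalType) (x : T -> 'rV[R]_n) (t : T) :
  {for t, continuous x} <-> forall i, {for t, continuous (fun s => x s 0 i)}.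
Proof.
split=> [h i|h].
  exact: (@continuous_comp _ _ _ x (fun M : 'rV[R]_n => M 0 i) t h
    (@coord_continuous _ _ _ _ _ _)).
apply/cvgrPdist_le => e e0.
have : \forall s \near t, forall i, `|x t 0 i - x s 0 i| <= e.
  by apply: filter_forall => i; exact: ((cvgrPdist_le _ _).1 (h i)).
apply: filterS => s hs.
apply: norm_coord_lub => [|i j]; first exact: ltW.
by rewrite !mxE (ord1 i).
Qed.

Lemma is_derive_add (V : normedModType R) (x y : R -> V) (v w : V) (t : R) :
  is_derive t (1 : R) x v -> is_derive t (1 : R) y w ->
  is_derive t (1 : R) (fun s => x s + y s) (v + w).
Proof. by move=> ? ?; exact: is_deriveD. Qed.

Lemma is_derive_const (V : normedModType R) (c : V) (t : R) :
  is_derive t (1 : R) (fun=> c) 0.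
Proof. exact: is_derive_cst. Qed.

Lemma is_derive_opp (V : normedModType R) (x : R -> V) (v : V) (t : R) :
  is_derive t (1 : R) x v -> is_derive t (1 : R) (fun s => - x s) (- v).
Proof. by move=> ?; exact: is_deriveN. Qed.

Lemma is_derive_sub (V : normedModType R) (x y : R -> V) (v w : V) (t : R) :
  is_derive t (1 : R) x v -> is_derive t (1 : R) y w ->
  is_derive t (1 : R) (fun s => x s - y s) (v - w).
Proof. by move=> ? ?; apply: is_derive_add => //; exact: is_derive_opp. Qed.

Lemma is_derive_mul (x y : R -> R) (v w t : R) :
  is_derive t (1 : R) x v -> is_derive t (1 : R) y w ->
  is_derive t (1 : R) (fun s => x s * y s) (v * y t + x t * w).
Proof.
move=> dx dy; apply: (is_derive_eq (is_deriveM dx dy)).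
by rewrite addrC; congr (_ + _); rewrite /GRing.scale/= mulrC.
Qed.

Lemma is_derive_cmul (k : R) (x : R -> R) (v t : R) :
  is_derive t (1 : R) x v -> is_derive t (1 : R) (fun s => k * x s) (k * v).
Proof. by move=> ?; exact: (@is_deriveZ _ _ _ x k). Qed.

Lemma is_derive_scale n (c : R -> R) (x : R -> 'rV[R]_n) (c' t : R) (v : 'rV[R]_n) :
  is_derive t (1 : R) c c' -> is_derive t (1 : R) x v ->
  is_derive t (1 : R) (fun s => c s *: x s) (c' *: x t + c t *: v).
Proof.
move=> dc /is_derive_row dx; apply/is_derive_row => i.
have -> : (fun s => (c s *: x s) 0 i) = (fun s => c s * x s 0 i).
  by apply/funext => s; rewrite mxE.
by rewrite !mxE; exact: is_derive_mul.
Qed.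

Lemma is_derive_mulmx n p (x : R -> 'rV[R]_n) (v : 'rV[R]_n) (M : 'M[R]_(n, p)) (t : R) :
  is_derive t (1 : R) x v -> is_derive t (1 : R) (fun s => x s *m M) (v *m M).
Proof.
move=> /is_derive_row dx; apply/is_derive_row => i.
have -> : (fun s => (x s *m M) 0 i) = \sum_j (fun s => M j i * x s 0 j).
  by apply/funext => s; rewrite mxE fct_sumE; apply: eq_bigr => j _; rewrite mulrC.
have h j := is_derive_cmul (M j i) (dx j).
apply: (is_derive_eq (is_derive_sum h)).
by rewrite mxE; apply: eq_bigr => j _; rewrite mulrC.
Qed.

Lemma is_derive_unique (V : normedModType R) (x : R -> V) (v w : V) (t : R) :
  is_derive t (1 : R) x v -> is_derive t (1 : R) x w -> v = w.
Proof. by move=> [_ <-] [_ <-]. Qed.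

Lemma le_derive_le (u du : R -> R) (a b : R) : a <= b ->
  (forall t, a <= t <= b -> {for t, continuous u}) ->
  (forall t, a < t < b -> is_derive t (1 : R) u (du t)) ->
  (forall t, a < t < b -> du t <= 0) -> u b <= u a.
Proof.
move=> ab cu hu du0; move: ab; rewrite le_eqVlt => /predU1P[->//|ab].
have h1 t : t \in `]a, b[ -> is_derive t (1 : R) u (du t).
  by rewrite in_itv/= => /hu.
have h2 : {within `[a, b], continuous u}.
  by apply: continuous_in_subspaceT => t; rewrite inE/= in_itv/=; exact: cu.
have [c cab e] := MVT ab h1 h2.
have /du0 duc : a < c < b by move: cab; rewrite in_itv.
by rewrite -subr_le0 e mulr_le0_ge0// subr_ge0 ltW.
Qed.

(** The maximum norm is not differentiable, so the mean value inequality is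
    proved coordinate by coordinate, comparing [x i] and [- x i] with [g]. *)
Lemma norm_derive_le n (x v : R -> 'rV[R]_n) (g dg : R -> R) (a b : R) :
  a <= b ->
  (forall t, a <= t <= b -> {for t, continuous x}) ->
  (forall t, a <= t <= b -> {for t, continuous g}) ->
  (forall t, a < t < b -> is_derive t (1 : R) x (v t)) ->
  (forall t, a < t < b -> is_derive t (1 : R) g (dg t)) ->
  (forall t, a < t < b -> `|v t| <= dg t) ->
  `|x b - x a| <= g b - g a.
Proof.
move=> ab cx cg dx dgg le_v.
have cxi t i : a <= t <= b -> {for t, continuous (fun s => x s 0 i)}.
  by move=> /cx/continuous_row.
have dxi t i : a < t < b -> is_derive t (1 : R) (fun s => x s 0 i) (v t 0 i).
  by move=> /dx/is_derive_row.
have gab : 0 <= g b - g a.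
  rewrite subr_ge0 -lerN2.
  apply: (@le_derive_le (fun t => - g t) (fun t => - dg t)) => // t tab.
  - by apply: continuousN; exact: cg.
  - by have := dgg t tab; move=> ?; exact: is_deriveN.
  - by rewrite oppr_le0 (le_trans _ (le_v t tab)).
apply: norm_coord_lub => // k i; rewrite (ord1 k) !mxE ler_norml; apply/andP; split.
- suff : - x b 0 i - g b <= - x a 0 i - g a by lra.
  apply: (@le_derive_le (fun t => - x t 0 i - g t) (fun t => - v t 0 i - dg t)) => // t tab.
  + by apply: continuousB; [apply: continuousN; exact: cxi|exact: cg].
  + by have := dgg t tab; have := dxi t i tab; move=> ? ?; exact: is_deriveB.
  + have := norm_coord_le (v t) 0 i; have := le_v t tab; have := ler_norm (- v t 0 i).
    by rewrite normrN; lra.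
- suff : x b 0 i - g b <= x a 0 i - g a by lra.
  apply: (@le_derive_le (fun t => x t 0 i - g t) (fun t => v t 0 i - dg t)) => // t tab.
  + by apply: continuousB; [exact: cxi|exact: cg].
  + by have := dgg t tab; have := dxi t i tab; move=> ? ?; exact: is_deriveB.
  + by have := norm_coord_le (v t) 0 i; have := le_v t tab; have := ler_norm (v t 0 i); lra.
Qed.

Lemma is_derive_dot n (x y vx vy : R -> 'rV[R]_n) (t : R) :
  is_derive t (1 : R) x (vx t) -> is_derive t (1 : R) y (vy t) ->
  is_derive t (1 : R) (fun s => dot (x s) (y s)) (dot (vx t) (y t) + dot (x t) (vy t)).
Proof.
move=> /is_derive_row dx /is_derive_row dy.
have -> : (fun s => dot (x s) (y s)) =
    \sum_i ((fun s => x s 0 i) * (fun s => y s 0 i)).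
  by apply/funext => s; rewrite fct_sumE.
have h i := is_deriveM (dx i) (dy i).
apply: (is_derive_eq (is_derive_sum h)).
rewrite /dot -big_split/=; apply: eq_bigr => i _.
by rewrite addrC; congr (_ + _); rewrite /GRing.scale/= mulrC.
Qed.

Lemma continuous_dot n (T : topologicalType) (x y : T -> 'rV[R]_n) (t : T) :
  {for t, continuous x} -> {for t, continuous y} ->
  {for t, continuous (fun s => dot (x s) (y s))}.
Proof.
move=> /continuous_row cx /continuous_row cy; rewrite /dot.
apply: cvg_big => [|i _]; first exact: add_continuous.
exact: continuousM.
Qed.

Lemma continuous_mulmx n p (T : topologicalType) (v : T -> 'rV[R]_n)
    (M : T -> 'M[R]_(n, p)) (t : T) :
  {for t, continuous v} -> {for t, continuous M} ->
  {for t, continuous (fun s => v s *m M s)}.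
Proof.
move=> /continuous_row cv cM; apply/continuous_row => i.
have -> : (fun s => (v s *m M s) 0 i) = (fun s => \sum_j v s 0 j * M s j i).
  by apply/funext => s; rewrite mxE.
apply: cvg_big => [|j _]; first exact: add_continuous.
apply: cvgM; first exact: cv.
exact: (@continuous_comp _ _ _ M (fun A : 'M[R]_(n, p) => A j i) t cM
  (@coord_continuous _ _ _ _ _ _)).
Qed.

(** The factor [expR (- k * tau)] turns the differential inequality into
    monotonicity. The clock [tau], whose derivative is [a], covers a rate of
    growth that varies in time like the gain. *)
Lemma gronwall (u du tau a : R -> R) (k t0 t1 : R) : t0 <= t1 ->
  (forall t, t0 <= t <= t1 -> {for t, continuous u}) ->
  (forall t, t0 <= t <= t1 -> {for t, continuous tau}) ->
  (forall t, t0 < t < t1 -> is_derive t (1 : R) u (du t)) ->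
  (forall t, t0 < t < t1 -> is_derive t (1 : R) tau (a t)) ->
  (forall t, t0 < t < t1 -> du t <= k * a t * u t) ->
  u t1 <= u t0 * expR (k * (tau t1 - tau t0)).
Proof.
move=> t01 cu ctau dU dtau le_du.
suff : u t1 * expR (- (k * tau t1)) <= u t0 * expR (- (k * tau t0)).
  rewrite -(ler_pM2r (expR_gt0 (k * tau t1))) -!mulrA -!expRD addNr expR0 mulr1.
  by move/le_trans; apply; rewrite mulrBr addrC.
pose E t := expR (- (k * tau t)).
apply: (@le_derive_le (fun t => u t * E t)
  (fun t => u t * (E t * (- (k * a t))) + E t * du t)) => // t tab.
- apply: continuousM; first exact: cu.
  apply: (@continuous_comp _ _ _ (fun t => - (k * tau t)) expR); last exact: continuous_expR.
  by apply: continuousN; apply: continuousM; [exact: cvg_cst|exact: ctau].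
- have := dU t tab; have := dtau t tab; move=> ? ?.
  have dE : is_derive t (1 : R) E (E t * (- (k * a t))).
    have dl : is_derive t (1 : R) (fun s => - (k * tau s)) (- (k * a t)).
      by apply: is_derive_opp; exact: is_derive_cmul.
    exact: (@is_derive1_comp R expR (fun s => - (k * tau s)) t _ _ (is_derive_expR _) dl).
  apply: (is_derive_eq (is_derive_mul (dU t tab) dE)).
  by rewrite addrC [E t * du t]mulrC.
- have := le_du t tab; have : 0 < E t by exact: expR_gt0.
  move=> E0 h; have -> : u t * (E t * - (k * a t)) + E t * du t = E t * (du t - k * a t * u t).
    by ring.
  by rewrite pmulr_rle0// subr_le0.
Qed.

(** Gronwall's inequality is applied to the squared Euclidean norm plus [eta
    ^+ 2]: the norm is then differentiable and the added constant absorbs the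
    forcing term. Going back to the maximum norm costs the factors [n]. *)
Lemma gronwall_vec n (x v : R -> 'rV[R]_n) (tau a : R -> R) (L eta t0 t1 : R) :
  t0 <= t1 -> 0 <= L -> 0 <= eta ->
  (forall t, t0 <= t <= t1 -> {for t, continuous x}) ->
  (forall t, t0 <= t <= t1 -> {for t, continuous tau}) ->
  (forall t, t0 < t < t1 -> is_derive t (1 : R) x (v t)) ->
  (forall t, t0 < t < t1 -> is_derive t (1 : R) tau (a t)) ->
  (forall t, t0 < t < t1 -> 0 <= a t) ->
  (forall t, t0 < t < t1 -> `|v t| <= a t * (L * `|x t| + eta)) ->
  `|x t1| <= n.+1%:R * (`|x t0| + eta) * expR (n%:R * (2 * L + 1) * (tau t1 - tau t0)).
Proof.
move=> t01 L0 eta0 cx ctau dx dtau age0 le_v.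
pose w t := dot (x t) (x t) + eta ^+ 2.
have wt1 : w t1 <= w t0 * expR (n%:R * (2 * L + 1) * (tau t1 - tau t0)).
  apply: (@gronwall w (fun t => dot (v t) (x t) + dot (x t) (v t) + 0) tau a) => // t tab.
  - by apply: continuousD; [apply: continuous_dot; exact: cx|exact: cvg_cst].
  - have -> : w = (fun s => dot (x s) (x s)) + cst (eta ^+ 2) by [].
    have := is_derive_dot (dx t tab) (dx t tab) => ?.
    exact: is_deriveD.
  - rewrite addr0 (dotC (v t)).
    have h1 := dot_le (x t) (v t).
    have h2 := sqr_norm_le_dot (x t).
    have h3 := le_v t tab; have a0 := age0 t tab.
    have n0 : 0 <= n%:R :> R by [].
    have h4 : `|x t| * `|v t| <= a t * (L * `|x t| ^+ 2 + `|x t| * eta).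
      apply: le_trans (_ : `|x t| * (a t * (L * `|x t| + eta)) <= _).
        by rewrite ler_wpM2l.
      by rewrite le_eqVlt; apply/orP; left; apply/eqP; ring.
    have h5 : L * `|x t| ^+ 2 + `|x t| * eta <= (L + 2^-1) * w t.
      rewrite /w; have : 0 <= (`|x t| - eta) ^+ 2 by exact: sqr_ge0.
      have : L * `|x t| ^+ 2 <= L * (dot (x t) (x t) + eta ^+ 2).
        by rewrite ler_wpM2l// (le_trans h2)// lerDl sqr_ge0.
      nra.
    have h6 : `|x t| * `|v t| <= a t * ((L + 2^-1) * w t).
      by apply: le_trans h4 _; rewrite ler_wpM2l.
    have h7 : n%:R * (`|x t| * `|v t|) <= n%:R * (a t * ((L + 2^-1) * w t)).
      by rewrite ler_wpM2l.
    have -> : n%:R * (2 * L + 1) * a t * w t = 2 * (n%:R * (a t * ((L + 2^-1) * w t))).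
      by field.
    by have := ler_norm (dot (x t) (v t)); lra.
have E0 : 1 <= expR (n%:R * (2 * L + 1) * (tau t1 - tau t0)).
  rewrite -expR0 ler_expR mulr_ge0//.
    by rewrite mulr_ge0// addr_ge0// mulr_ge0.
  rewrite subr_ge0 -lerN2.
  apply: (@le_derive_le (fun t => - tau t) (fun t => - a t)) => // s sab.
  - by apply: continuousN; exact: ctau.
  - by have := dtau s sab => ?; exact: is_deriveN.
  - by rewrite oppr_le0 age0.
move: E0 wt1; set E := expR _ => E1 wt1.
have c0 : 0 <= n.+1%:R * (`|x t0| + eta) * E.
  by rewrite !mulr_ge0// ?addr_ge0// (le_trans _ E1).
rewrite -ler_sqr ?nnegrE//.
have : `|x t1| ^+ 2 <= w t1.
  by rewrite (le_trans (sqr_norm_le_dot _))// lerDl sqr_ge0.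
move=> /le_trans; apply; apply: le_trans wt1 _.
have x0 := normr_ge0 (x t0).
have h1 : w t0 <= n.+1%:R * (`|x t0| + eta) ^+ 2.
  rewrite /w; have := dot_le (x t0) (x t0); have := ler_norm (dot (x t0) (x t0)).
  rewrite -natr1; have : 0 <= n%:R :> R by [].
  move: (n%:R) => N N0 h1 h2.
  have h3 : 0 <= `|x t0| * eta by rewrite mulr_ge0.
  have h4 : 0 <= N * (`|x t0| * eta) by rewrite mulr_ge0.
  have h5 : 0 <= N * eta ^+ 2 by rewrite mulr_ge0 ?sqr_ge0.
  have h6 : 0 <= `|x t0| ^+ 2 by rewrite sqr_ge0.
  have h7 : 0 <= N * `|x t0| ^+ 2 by rewrite mulr_ge0.
  lra.
rewrite -mulrA exprMn [(_ * E)^+2]exprMn.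
have n1 : 1 <= n.+1%:R :> R by rewrite ler1n.
have h2 : n.+1%:R * (`|x t0| + eta) ^+ 2 <= n.+1%:R ^+ 2 * (`|x t0| + eta) ^+ 2.
  by rewrite ler_wpM2r ?sqr_ge0// expr2 ler_peMl.
rewrite mulrA; apply: ler_pM => //.
- by rewrite /w addr_ge0 ?dot_ge0 ?sqr_ge0.
- by rewrite (le_trans _ E1).
- exact: le_trans h1 h2.
- by rewrite expr2 ler_peMl// (le_trans _ E1).
Qed.

End Derivatives.

(** * Primitives of continuous paths *)

Section Primitive.
Variable R : realType.

Lemma is_derive_eq_gt (V : normedModType R) (f g : R -> V) (df : V) (c t : R) :
  c < t -> (forall s, c < s -> f s = g s) ->
  is_derive t (1 : R) f df -> is_derive t (1 : R) g df.
Proof.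
move=> ct fg; apply: near_eq_is_derive; near=> s; apply: fg.
by near: s; exact: lt_nbhsr.
Unshelve. all: by end_near. Qed.

Lemma max0_continuous : continuous (fun s : R => Num.max s 0).
Proof.
by move=> s; apply: (@continuous_max _ _ id (fun=> 0)); [exact: cvg_id|exact: cvg_cst].
Qed.

(** The fundamental theorem of calculus is two-sided only at interior points,
    so the integral starts at [-1]; freezing it for negative times keeps the
    primitive continuous on the whole line. *)
Lemma primitive (h : R -> R) : continuous h ->
  exists P : R -> R, [/\ P 0 = 0, continuous P,
    forall t : R, 0 < t -> is_derive t (1 : R) P (h t) &
    forall a b : R, 0 <= a -> a <= b ->
      \int[lebesgue_measure]_(t in `[a, b]) h t = P b - P a].
Proof.
move=> ch.
pose Q (t : R) := \int[lebesgue_measure]_(s in `[(-1 : R), t]) h s.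
have dQ (t : R) : -1 < t -> is_derive t (1 : R) Q (h t).
  move=> t1.
  have ih : lebesgue_measure.-integrable `[(-1 : R), t + 1] (EFin \o h).
    apply: continuous_compact_integrable; first exact: segment_compact.
    exact: continuous_subspaceT.
  have tt : t < t + 1 by rewrite ltrDl.
  have [dd <-] := continuous_FTC1_closed tt ih t1 (ch t).
  by rewrite derive1E; exact: derivableP.
have cQ (t : R) : -1 < t -> {for t, continuous Q} by move=> /dQ/is_derive_continuous1.
pose P (t : R) := Q (Num.max t 0) - Q 0.
have cP : continuous P.
  move=> t; apply: cvgB; last exact: cvg_cst.
  apply: (continuous_comp (@max0_continuous t)); apply: cQ.
  by rewrite (lt_le_trans (ltrN10 R))// le_max lexx orbT.
have dP (t : R) : 0 < t -> is_derive t (1 : R) P (h t).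
  move=> t0.
  apply: (@is_derive_eq_gt _ (fun t => Q t - Q 0) _ _ 0) => //.
    by move=> s s0; rewrite /P max_l// ltW.
  rewrite -[h t]subr0; apply: is_derive_sub; first by apply: dQ; rewrite (lt_trans (ltrN10 R)).
exists P; split => //.
  by rewrite /P max_r// subrr.
move=> a b a0; rewrite le_eqVlt => /predU1P[<-|ab].
  by rewrite subrr set_itv1 Rintegral_set1.
rewrite /Rintegral (@continuous_FTC2 _ h P a b ab).
- by rewrite -EFinB.
- exact: continuous_subspaceT.
- split => [t||].
  + rewrite in_itv/= => /andP[at_ _].
    by have [] := dP t (le_lt_trans a0 at_).
  + apply: cvg_at_right_filter; exact: cP.
  + apply: cvg_at_left_filter; exact: cP.
- move=> t; rewrite in_itv/= => /andP[at_ _].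
  by have [_] := dP t (le_lt_trans a0 at_); rewrite -derive1E.
Qed.

Lemma mxint_primitive n (h : R -> 'rV[R]_n) : continuous h ->
  exists P : R -> 'rV[R]_n, [/\ P 0 = 0, continuous P,
    forall t : R, 0 < t -> is_derive t (1 : R) P (h t) &
    forall a b : R, 0 <= a -> a <= b -> mxint a b h = P b - P a].
Proof.
move=> ch.
have chi i : continuous (fun t => h t 0 i).
  by move=> t; have /continuous_row/(_ i) := ch t.
pose p i := sval (cid (primitive (chi i))).
have pP i := svalP (cid (primitive (chi i))).
exists (fun t => \row_i p i t); split.
- by apply/rowP => i; rewrite !mxE; have [] := pP i.
- move=> t; apply/continuous_row => i.
  have -> : (fun s => (\row_i p i s) 0 i) = p i by apply/funext => s; rewrite mxE.
  by have [_ + _ _] := pP i; apply.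
- move=> t t0; apply/is_derive_row => i.
  have -> : (fun s => (\row_i p i s) 0 i) = p i by apply/funext => s; rewrite mxE.
  by have [_ _ + _] := pP i; apply.
- move=> a b a0 ab; apply/rowP => i; rewrite !mxE.
  by have [_ _ _ +] := pP i; apply.
Qed.

End Primitive.

(** * Global solutions of Lipschitz equations *)

Section Picard.
Variable R : realType.

Lemma pow2_small (d e : R) : 0 < e -> exists k, d / 2 ^+ k < e.
Proof.
move=> e0; have := archi_boundP (divr_ge0 (normr_ge0 d) (ltW e0)).
set N := Num.bound _ => h; exists N.
rewrite ltr_pdivrMr ?exprn_gt0// (le_lt_trans (ler_norm d))//.
rewrite mulrC -ltr_pdivrMr//; apply: lt_trans h _.
by rewrite -natrX ltr_nat ltn_expl.
Qed.

Lemma geometric_limit n (u : nat -> 'rV[R]_n) (c : R) :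
  (forall k, `|u k.+1 - u k| <= c / 2 ^+ k) ->
  exists l, forall k, `|l - u k| <= 2 * c / 2 ^+ k.
Proof.
move=> du.
have c0 : 0 <= c by have := du 0%N; rewrite expr0 divr1; exact: le_trans.
have hu k j : `|u (k + j)%N - u k| <= 2 * c / 2 ^+ k * (1 - 2^-1 ^+ j).
  elim: j => [|j IH]; first by rewrite addn0 subrr normr0 expr0 subrr mulr0.
  rewrite addnS -(subrKA (u (k + j)%N)) (le_trans (ler_normD _ _))//.
  rewrite (le_trans (lerD (du _) IH))// exprD exprS !exprVn.
  rewrite le_eqVlt; apply/orP; left; apply/eqP.
  by field; rewrite !expf_neq0.
have hu' k j : `|u (k + j)%N - u k| <= 2 * c / 2 ^+ k.
  apply: le_trans (hu k j) _; apply: ler_piMr.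
    by rewrite divr_ge0 ?mulr_ge0 ?exprn_ge0.
  by rewrite gerBl exprn_ge0.
have small (e : R) : 0 < e -> exists k, 2 * c / 2 ^+ k < e := @pow2_small _ _.
have : cvg (u @ \oo).
  apply/cauchy_cvgP/cauchy_exP => e e0; have [k hk] := small e e0.
  exists (u k); exists k => // m /= km; rewrite -ball_normE/= distrC.
  by apply: le_lt_trans hk; rewrite -(subnKC km).
move=> /cvg_ex[l ul]; exists l => k; apply/ler_addgt0Pr => e e0.
have [m _ hm] := (cvgrPdist_le _ _).1 ul e e0.
have := hm (k + m)%N (leq_addl _ _) => /= h.
rewrite -(subrKA (u (k + m)%N)) (le_trans (ler_normD _ _))// addrC lerD//.
Qed.

Variables (n : nat) (F : 'rV[R]_n -> 'rV[R]_n) (L : R).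
Hypothesis L0 : 0 < L.
Hypothesis FL : forall x y, `|F x - F y| <= L * `|x - y|.

Let cF : continuous F.
Proof. exact: lipschitz_continuous FL. Qed.

Let step (x0 : 'rV[R]_n) (y : R -> 'rV[R]_n) (cy : continuous y) :
  exists z : R -> 'rV[R]_n, [/\ z 0 = x0, continuous z &
    forall t : R, 0 < t -> is_derive t (1 : R) z (F (y t))].
Proof.
have cFy : continuous (F \o y).
  by move=> t; apply: continuous_comp; [exact: cy|exact: cF].
have [P [P0 cP dP _]] := mxint_primitive cFy.
exists (fun t => x0 + P t); split.
- by rewrite P0 addr0.
- by move=> t; apply: cvgD; [exact: cvg_cst|exact: cP].
- move=> t t0; rewrite -[F _]add0r; apply: is_derive_add; exact: dP.
Qed.

(** With the weight [expR (2 * L * t)] a Picard step is a contraction of ratio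
    1/2 on the whole half-line, so the solution is global at once. *)
Let E (c t : R) := c * expR (2 * L * t).

Let dE c (t : R) : is_derive t (1 : R) (E (c / 2)) (L * E c t).
Proof.
have d1 : is_derive t (1 : R) (fun s => 2 * L * s) (2 * L * 1).
  by apply: is_derive_cmul; exact: is_derive_id.
have d2 := is_derive_cmul (c / 2)
  (@is_derive1_comp R expR (fun s => 2 * L * s) t _ _ (is_derive_expR _) d1).
by apply: (is_derive_eq d2); rewrite /E; field.
Qed.

Let step_contract (y y' z z' : R -> 'rV[R]_n) (c : R) : 0 <= c ->
  continuous z -> continuous z' -> z 0 = z' 0 ->
  (forall t : R, 0 < t -> is_derive t (1 : R) z (F (y t))) ->
  (forall t : R, 0 < t -> is_derive t (1 : R) z' (F (y' t))) ->
  (forall t : R, 0 <= t -> `|y t - y' t| <= E c t) ->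
  forall t : R, 0 <= t -> `|z t - z' t| <= E (c / 2) t.
Proof.
move=> c0 cz cz' z0 dz dz' yy' t t0.
have := @norm_derive_le R n (fun s => z s - z' s) (fun s => F (y s) - F (y' s))
  (E (c / 2)) (fun s => L * E c s) 0 t t0.
rewrite z0 subrr subr0 => H; apply: le_trans (H _ _ _ _ _) _.
- by move=> s _; apply: cvgB; [exact: cz|exact: cz'].
- by move=> s _; exact: is_derive_continuous1 (dE c s).
- by move=> s /andP[s0 _]; apply: is_derive_sub; [exact: dz|exact: dz'].
- by [].
- move=> s /andP[s0 _]; rewrite (le_trans (FL _ _))// ler_wpM2l ?(ltW L0)//.
  by apply: yy'; exact: ltW.
- by rewrite gerBl /E mulr_ge0 ?divr_ge0 ?expR_ge0.
Qed.

(** The iterates converge on the half-line only, hence they are evaluated at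
    [Num.max t 0]. Their limit is merely continuous a priori; it coincides
    with its own Picard step, which is differentiable. *)
Theorem picard (x0 : 'rV[R]_n) : exists x : R -> 'rV[R]_n,
  [/\ x 0 = x0, continuous x &
    forall t : R, 0 < t -> is_derive t (1 : R) x (F (x t))].
Proof.
pose st (y : {y : R -> 'rV[R]_n | continuous y}) :
    {y : R -> 'rV[R]_n | continuous y} :=
  let h := cid (step x0 (svalP y)) in
  exist _ (sval h) (let: And3 _ c _ := svalP h in c).
have st0 y : sval (st y) 0 = x0 by rewrite /st/=; case: cid => z [].
have dst y (t : R) : 0 < t -> is_derive t (1 : R) (sval (st y)) (F (sval y t)).
  by rewrite /st/=; case: cid => z [] + + + /=; move=> _ _; apply.
have cc : continuous (fun _ : R => x0) by move=> t; exact: cvg_cst.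
pose X k := iter k st (exist _ _ cc).
have X0 k : sval (X k) 0 = x0 by case: k => // k; exact: st0.
pose C := `|F x0| / (2 * L).
have C0 : 0 <= C by rewrite divr_ge0 ?mulr_ge0 ?(ltW L0).
have X1 (t : R) : 0 <= t -> `|sval (X 1%N) t - sval (X 0%N) t| <= E C t.
  move=> t0.
  have := @norm_derive_le R n (sval (X 1%N)) (fun=> F x0)
    (fun s => `|F x0| * s) (fun=> `|F x0| * 1) 0 t t0.
  rewrite X0 mulr0 subr0 => H; apply: le_trans (H _ _ _ _ _) _.
  - by move=> s _; exact: (svalP (X 1%N)).
  - by move=> s _; apply: cvgM; [exact: cvg_cst|exact: cvg_id].
  - by move=> s /andP[s0 _]; exact: dst (X 0%N) s s0.
  - by move=> s _; rewrite mulr1.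
  - rewrite /E /C -[leRHS]mulrA ler_wpM2l//.
    have := expR_ge1Dx (2 * L * t); rewrite [_^-1 * _]mulrC ler_pdivlMr ?mulr_gt0//.
    by rewrite mulrC; lra.
have XS k (t : R) : 0 <= t ->
    `|sval (X k.+1) t - sval (X k) t| <= E (C / 2 ^+ k) t.
  elim: k t => [|k IH] t t0; first by rewrite expr0 divr1; exact: X1.
  rewrite exprS invfM [_^-1 * _]mulrC mulrA.
  apply: (@step_contract (sval (X k.+1)) (sval (X k))) => //.
  - by rewrite divr_ge0 ?exprn_ge0.
  - exact: (svalP (X k.+2)).
  - exact: (svalP (X k.+1)).
  - by rewrite !X0.
have lim (t : R) : exists l, forall k,
    `|l - sval (X k) (Num.max t 0)| <= 2 * (E C (Num.max t 0)) / 2 ^+ k.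
  apply: geometric_limit => k.
  rewrite (le_trans (XS k (Num.max t 0) _)) ?le_max ?lexx ?orbT//.
  by rewrite /E mulrAC.
pose x t := sval (cid (lim t)).
have xX t k : `|x t - sval (X k) (Num.max t 0)| <= 2 * (E C (Num.max t 0)) / 2 ^+ k.
  exact: (svalP (cid (lim t))).
have small (d e : R) : 0 < e -> exists k, 2 * d / 2 ^+ k < e := @pow2_small _ _.
have cmax := @max0_continuous R.
have cx : continuous x.
  move=> t; apply/(@cvgrPdist_le _ _ _ (nbhs t)) => e e0.
  have e3 : 0 < e / 3 by rewrite divr_gt0.
  have [k hk] := small (E C (Num.max t 0 + 1)) _ e3.
  have mon (s : R) : s <= Num.max t 0 + 1 -> 2 * E C s / 2 ^+ k <= e / 3.
    move=> hs; rewrite (le_trans _ (ltW hk))// ler_pM2r ?invr_gt0 ?exprn_gt0//.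
    by rewrite ler_pM2l// /E ler_wpM2l// ler_expR ler_pM2l ?mulr_gt0.
  have cXk : continuous (fun s : R => sval (X k) (Num.max s 0)).
    by move=> s; apply: (continuous_comp (cmax s)); exact: (svalP (X k)).
  near=> s.
  have -> : x t - x s = (x t - sval (X k) (Num.max t 0)) +
      (sval (X k) (Num.max t 0) - sval (X k) (Num.max s 0)) -
      (x s - sval (X k) (Num.max s 0)).
    by rewrite opprB !addrA subrK subrK.
  rewrite (le_trans (ler_normB _ _))// [leRHS](_ : _ = e / 3 + e / 3 + e / 3); last by field.
  apply: lerD.
    rewrite (le_trans (ler_normD _ _))// lerD//.
      by rewrite (le_trans (xX t k))// mon// lerDl.
    near: s; exact: ((cvgrPdist_le _ _).1 (cXk t)).
  rewrite (le_trans (xX s k))// mon//.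
  have : `|Num.max t 0 - Num.max s 0| <= 1.
    by near: s; exact: ((cvgrPdist_le _ _).1 (cmax t)).
  by rewrite ler_norml => /andP[h _]; lra.
have [y [y0 cy dy]] := step x0 cx.
have yx (t : R) : 0 <= t -> y t = x t.
  move=> t0; apply/eqP; rewrite -subr_eq0 -normr_le0; apply/ler_addgt0Pr => e e0.
  rewrite add0r; have [k hk] := small (E C t) _ e0.
  have h1 : `|y t - sval (X k.+1) t| <= E (2 * C / 2 ^+ k / 2) t.
    apply: (@step_contract x (sval (X k))) => //.
    - by apply: divr_ge0; [exact: mulr_ge0|exact: exprn_ge0].
    - exact: (svalP (X k.+1)).
    - by rewrite y0 X0.
    - move=> s s0; have := xX s k; rewrite max_l// => /le_trans; apply.
      by rewrite /E mulrA mulrAC.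
  have h2 := xX t k.+1; rewrite max_l// in h2.
  have -> : y t - x t = (y t - sval (X k.+1) t) - (x t - sval (X k.+1) t).
    by rewrite opprB addrA subrK.
  rewrite (le_trans (ler_normB _ _))//; apply: le_trans (ltW hk).
  apply: le_trans (lerD h1 h2) _; rewrite /E exprS invfM.
  by rewrite le_eqVlt; apply/orP; left; apply/eqP; field; rewrite expf_neq0.
exists y; split => // t t0; rewrite yx ?(ltW t0)//; exact: dy.
Unshelve. all: by end_near. Qed.

End Picard.

(** * Stability of the mean flow *)

Section Trajectories.
Variable R : realType.

Lemma is_derive_diff_comp (V W : normedModType R) (H : V -> W) (x : R -> V) (v : V) (t : R) :
  is_derive t (1 : R) x v -> differentiable H (x t) ->
  is_derive t (1 : R) (fun s => H (x s)) ('d H (x t) v).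
Proof.
move=> [dx <-] dH; have dx' : differentiable x t by exact/derivable1_diffP.
have dHx : differentiable (H \o x) t by exact: differentiable_comp.
split; first exact/derivable1_diffP.
by rewrite deriveE// diff_comp//= deriveE.
Qed.

Lemma is_derive_diff_comp_at (V W : normedModType R) (H : V -> W) (x : R -> V) (p v : V) (t : R) :
  x t = p -> is_derive t (1 : R) x v -> differentiable H p ->
  is_derive t (1 : R) (fun s => H (x s)) ('d H p v).
Proof. by move=> <-; exact: is_derive_diff_comp. Qed.

Lemma is_derive_time_comp (V : normedModType R) (x : R -> V) (g : R -> R) (v : V) (b t : R) :
  is_derive (g t) (1 : R) x v -> is_derive t (1 : R) g b ->
  is_derive t (1 : R) (fun s => x (g s)) (b *: v).
Proof.
move=> [dx xv] dg; have dx' : differentiable x (g t) by exact/derivable1_diffP.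
apply: (is_derive_eq (is_derive_diff_comp dg dx')).
by rewrite -xv deriveE// -linearZ/=; congr ('d _ _ _); rewrite /GRing.scale/= mulr1.
Qed.

(** Extending a solution by its initial value to negative times trades
    continuity within the half-line for continuity on the line. *)
Lemma ode_solution_extend n (F : R -> 'rV[R]_n -> 'rV[R]_n) (x : R -> 'rV[R]_n) :
  ode_solution F x -> exists y : R -> 'rV[R]_n,
  [/\ continuous y, forall t : R, 0 < t -> is_derive t (1 : R) y (F t (y t)) &
      forall t : R, 0 <= t -> y t = x t].
Proof.
move=> [cx dx]; exists (fun t => x (Num.max t 0)).
have yx (t : R) : 0 <= t -> x (Num.max t 0) = x t by move=> t0; rewrite max_l.
split => //.
- move=> t.
  have cxt : x @ within `[0, +oo[ (nbhs (Num.max t 0)) --> x (Num.max t 0).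
    move/subspace_continuousP : cx; apply.
    by rewrite /= in_itv/= andbT le_max lexx orbT.
  apply: cvg_trans cxt.
  move=> A hA; have h := @max0_continuous R t _ hA.
  apply: (@filterS _ (nbhs t) _ _ _ _ h) => s /=; apply.
  by rewrite /= in_itv/= andbT le_max lexx orbT.
- move=> t t0; rewrite yx ?(ltW t0)//.
  apply: (@is_derive_eq_gt _ _ x _ _ 0) => //; last exact: dx.
  by move=> s s0; rewrite yx// ltW.
Qed.

Definition trajectory n (F : 'rV[R]_n -> 'rV[R]_n) (x : R -> 'rV[R]_n) :=
  continuous x /\ forall t : R, 0 < t -> is_derive t (1 : R) x (F (x t)).

Lemma trajectory_ode n (F : 'rV[R]_n -> 'rV[R]_n) (x : R -> 'rV[R]_n) :
  trajectory F x -> ode_solution (fun=> F) x.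
Proof. by move=> [cx dx]; split => //; exact: continuous_subspaceT. Qed.

Lemma trajectory_shift n (F : 'rV[R]_n -> 'rV[R]_n) (x : R -> 'rV[R]_n) (s : R) :
  0 <= s -> trajectory F x -> trajectory F (fun t => x (s + t)).
Proof.
move=> s0 [cx dx]; split.
  move=> t; have cs : {for t, continuous (fun t : R => s + t)}.
    by apply: cvgD; [exact: cvg_cst|exact: cvg_id].
  by apply: (continuous_comp cs); exact: cx.
move=> t t0; rewrite -[F _]scale1r; apply: is_derive_time_comp.
  by apply: dx; rewrite ltr_wpDl.
by apply: (is_derive_eq (is_derive_add (is_derive_const s t) (is_derive_id t 1))); rewrite add0r.
Qed.

Lemma trajectory_perturb n (F G : 'rV[R]_n -> 'rV[R]_n) (L eta T : R) (x y : R -> 'rV[R]_n) :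
  0 <= L -> 0 <= eta -> (forall p q, `|F p - F q| <= L * `|p - q|) ->
  trajectory F x -> trajectory G y ->
  (forall t : R, 0 < t < T -> `|F (y t) - G (y t)| <= eta) ->
  forall t : R, 0 <= t <= T ->
  `|x t - y t| <= n.+1%:R * (`|x 0 - y 0| + eta) * expR (n%:R * (2 * L + 1) * t).
Proof.
move=> L0 eta0 FL [cx dx] [cy dy] FG t /andP[t0 tT].
have := @gronwall_vec R n (fun s => x s - y s) (fun s => F (x s) - G (y s))
  id (fun=> 1) L eta 0 t t0 L0 eta0.
rewrite subr0; apply.
- by move=> s _; apply: cvgB; [exact: cx|exact: cy].
- by move=> s _; exact: cvg_id.
- by move=> s /andP[s0 _]; apply: is_derive_sub; [exact: dx|exact: dy].
- by [].
- move=> s /andP[s0 st]; rewrite mul1r -(subrKA (F (y s))) (le_trans (ler_normD _ _))// lerD//.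
  by apply: FG; rewrite s0 (lt_le_trans st).
Qed.

Lemma trajectory_close n (F : 'rV[R]_n -> 'rV[R]_n) (L : R) (x y : R -> 'rV[R]_n) :
  0 <= L -> (forall p q, `|F p - F q| <= L * `|p - q|) ->
  trajectory F x -> trajectory F y -> forall t : R, 0 <= t ->
  `|x t - y t| <= n.+1%:R * `|x 0 - y 0| * expR (n%:R * (2 * L + 1) * t).
Proof.
move=> L0 FL hx hy t t0.
have := @trajectory_perturb n F F L 0 t x y L0 (lexx 0) FL hx hy _ t.
by rewrite addr0; apply => [s _|]; rewrite ?subrr ?normr0// t0 lexx.
Qed.

Lemma closed_ball_compact n (r : R) : compact [set p : 'rV[R]_n | `|p| <= r].
Proof.
apply: bounded_closed_compact.
  by exists r; split; [exact: num_real|move=> M rM p /= /le_trans; apply; exact: ltW].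
have -> : [set p : 'rV[R]_n | `|p| <= r] = (fun p => `|p|) @^-1` [set z : R | z <= r] by [].
apply: closed_comp; last exact: closed_le.
by move=> p _; exact: norm_continuous.
Qed.

Lemma cvg_pinfty_dist n (x : R -> 'rV[R]_n) (l : 'rV[R]_n) (e : R) : 0 < e ->
  x t @[t --> +oo] --> l -> exists2 M : R, 0 <= M & forall t, M <= t -> `|x t - l| < e.
Proof.
move=> e0 xl; have [M [_ hM]] := (cvgrPdist_lt _ _).1 xl e e0.
exists (Num.max (M + 1) 0); first by rewrite le_max lexx orbT.
move=> t; rewrite ge_max => /andP[Mt _]; rewrite distrC; apply: hM.
by apply: lt_le_trans Mt; rewrite ltrDl.
Qed.

(** Solutions depend continuously on their initial condition, so a solution
    that enters the ball provided by stability takes along all those that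
    start nearby; finitely many such neighbourhoods cover the closed ball of
    radius [r]. *)
Lemma uniform_attraction n (F : 'rV[R]_n -> 'rV[R]_n) (L : R) (xs : 'rV[R]_n) :
  0 < L -> (forall p q, `|F p - F q| <= L * `|p - q|) ->
  globally_asymptotically_stable F xs ->
  forall r e : R, 0 < e -> exists2 T : R, 0 <= T &
  forall x, trajectory F x -> `|x 0| <= r -> forall t : R, T <= t -> `|x t - xs| < e.
Proof.
move=> L0 FL [_ stab attr] r e e0.
have [del del0 hdel] := stab e e0.
have /compact_near_coveringP/near_covering_withinP hK := @closed_ball_compact n r.
pose P (T : R) (p : 'rV[R]_n) := forall x, trajectory F x -> x 0 = p ->
  forall t : R, T <= t -> `|x t - xs| < e.
have K T0 : \forall T \near (+oo : set_system R), T0 <= T.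
  by exists T0; split; [exact: num_real|move=> T /ltW].
have : \forall T \near (+oo : set_system R), [set p : 'rV[R]_n | `|p| <= r] `<=` P T.
  apply: (hK _ _ P) => p /= pr.
  have [x [x0 cx dx]] := picard L0 FL p.
  have tx : trajectory F x by [].
  have d2 : 0 < del / 2 by rewrite divr_gt0.
  have [T0 T00 hT0] := cvg_pinfty_dist d2 (attr x (trajectory_ode tx)).
  pose C := n.+1%:R * expR (n%:R * (2 * L + 1) * T0).
  have C0 : 0 < C by rewrite mulr_gt0 ?expR_gt0.
  have hp : \forall q \near p, `|p - q| <= del / 2 / C.
    by apply: near_dist_le; rewrite divr_gt0.
  exists ([set q | `|p - q| <= del / 2 / C], [set T | T0 <= T]).
    by split => //=; exact: K.
  move=> [q S]/= [hq hT] _.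
  move=> y ty y0 t Tt.
  have ty' := trajectory_shift T00 ty.
  have : `|y (T0 + 0) - xs| < del.
    rewrite addr0 -(subrKA (x T0)) (le_lt_trans (ler_normD _ _))// (splitr del).
    apply: ler_ltD; last exact: hT0.
    apply: le_trans (trajectory_close (ltW L0) FL ty tx T00) _.
    by rewrite y0 x0 distrC mulrAC mulrC -ler_pdivlMr.
  move=> /(hdel _ (trajectory_ode ty') ); move=> /(_ (t - T0)).
  rewrite [T0 + _]addrC subrK; apply.
  by rewrite subr_ge0 (le_trans hT).
move=> [M [_ hM]]; exists (Num.max (M + 1) 0); first by rewrite le_max lexx orbT.
move=> x tx xr t; rewrite ge_max => /andP[Mt t0].
apply: (hM (M + 1) _ (x 0) xr x tx) => //.
by rewrite ltrDl.
Qed.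

(** Far from the origin the flow divides the norm by four within a fixed time.
    Both [QSA3a] and [QSA3b] imply this property, and it persists under small
    relative perturbations of the flow, which is what bounds the perturbed
    trajectory. *)
Definition returns n (F : 'rV[R]_n -> 'rV[R]_n) := exists T c0 : R,
  [/\ 0 < T, 0 < c0 & forall x, trajectory F x -> c0 <= `|x 0| ->
    exists2 s : R, 0 <= s <= T & `|x s| <= `|x 0| / 4].

(** Without a return before the time [T], the function [V] would decrease
    along the solution at a rate proportional to [|x 0|], and thus by more
    than its initial value, which grows at most linearly in [|x 0|]. *)
Lemma QSA3a_returns n (F : 'rV[R]_n -> 'rV[R]_n) : QSA3a F -> returns F.
Proof.
move=> [V [L [delta0 [S [V0 VL d0 cS hV]]]]].
have [r0 hr0] : exists r0 : R, forall p, S p -> `|p| <= r0.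
  have [M [_ hM]] := compact_bounded cS.
  by exists (M + 1) => p Sp; apply: (hM (M + 1)); rewrite ?ltrDl.
(* Over this length of time V decreases by |x 0| (V 0 + |L| + 1), more than the
   bound V 0 + |L| |x 0| of its initial value. *)
pose T := 4 * (V 0 + `|L| + 1) / delta0.
have T0 : 0 < T by rewrite divr_gt0// mulr_gt0// ltr_wpDl// addr_ge0.
exists T, (4 * `|r0| + 1); split; [exact: T0| |].
  by have := normr_ge0 r0; lra.
move=> x tx hx; apply: contrapT => nex.
have big (s : R) : 0 <= s <= T -> `|x 0| / 4 < `|x s|.
  by move=> sT; rewrite ltNge; apply/negP => h; apply: nex; exists s.
have [cx dx] := tx.
have cV : continuous V.
  by apply: (@lipschitz_continuous _ _ _ _ L) => p q.
have nS (s : R) : 0 <= s <= T -> ~ S (x s).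
  move=> sT /hr0 h; have := big s sT; have := ler_norm r0; lra.
have := @le_derive_le R (fun s => V (x s) + delta0 * (`|x 0| / 4) * s)
  (fun s => 'd V (x s) (F (x s)) + delta0 * (`|x 0| / 4) * 1) 0 T (ltW T0).
rewrite mulr0 addr0 => H.
have {}H : V (x T) + delta0 * (`|x 0| / 4) * T <= V (x 0).
  apply: H.
  - move=> s _; apply: cvgD; last by apply: cvgM; [exact: cvg_cst|exact: cvg_id].
    by apply: (continuous_comp (cx s)); exact: cV.
  - move=> s /andP[s0 sT]; have sT' : 0 <= s <= T by rewrite !ltW.
    have [dV _] := hV x (trajectory_ode tx) s (ltW s0) (nS s sT').
    apply: is_derive_add; exact: (is_derive_diff_comp (dx s s0) dV).
  - move=> s /andP[s0 sT]; have sT' : 0 <= s <= T by rewrite !ltW.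
    have [dV] := hV x (trajectory_ode tx) s (ltW s0) (nS s sT').
    have -> : dot (gradient V (x s)) (F (x s)) = 'd V (x s) (F (x s)).
      rewrite [in RHS](row_sum_delta (F (x s))) linear_sum/= /dot.
      apply: eq_bigr => i _; rewrite mxE linearZ/= deriveE//.
      by rewrite mulrC.
    have := big s sT'; rewrite mulr1 => h1 h2.
    have : delta0 * (`|x 0| / 4) <= delta0 * `|x s| by rewrite ler_pM2l// ltW.
    by rewrite mulNr in h2; lra.
have h1 := V0 (x T).
have h2 : V (x 0) <= V 0 + `|L| * `|x 0|.
  have := VL 0 (x 0); rewrite subr0 => h; have := ler_norm (V (x 0) - V 0).
  have : L * `|x 0| <= `|L| * `|x 0| by rewrite ler_wpM2r// ler_norm.
  by move: h; lra.
have h3 : delta0 * (`|x 0| / 4) * T = `|x 0| * (V 0 + `|L| + 1).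
  by rewrite /T; field; rewrite gt_eqF.
have h4 : V 0 <= V 0 * `|x 0|.
  by rewrite ler_peMr// (le_trans _ hx)// lerDr mulr_ge0.
have h5 : 0 < `|x 0| by rewrite (lt_le_trans _ hx)// ltr_wpDl// mulr_ge0.
by nra.
Qed.

(** The trajectory divided by [c = |x 0|] solves the equation with the field
    [F (c *: p) / c]. For large [c] this field is close to [Finf] on compact
    sets, because all these fields have the same Lipschitz constant. The flow
    of [Finf] maps the unit sphere into the ball of radius 1/8 at a fixed
    time, and Gronwall's inequality adds at most another 1/8. *)
Lemma QSA3b_returns n (F : 'rV[R]_n -> 'rV[R]_n) (L : R) : 0 < L ->
  (forall p q, `|F p - F q| <= L * `|p - q|) -> QSA3b F -> returns F.
Proof.
move=> L0 FL [Finf [limF _ gas]].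
pose Fc (c : R) p := c^-1 *: F (c *: p).
have FcL (c : R) : 0 < c -> forall p q, `|Fc c p - Fc c q| <= L * `|p - q|.
  move=> c0 p q; rewrite /Fc -scalerBr normrZ normfV gtr0_norm//.
  rewrite mulrC ler_pdivrMr// (le_trans (FL _ _))// -scalerBr normrZ gtr0_norm//.
  by rewrite mulrCA mulrC.
have FiL p q : `|Finf p - Finf q| <= L * `|p - q|.
  have : \forall c \near (+oo : set_system R), `|Fc c p - Fc c q| <= L * `|p - q|.
    by exists 0; split; [exact: num_real|move=> c c0; exact: FcL].
  have h : (fun c => `|Fc c p - Fc c q|) @ +oo --> `|Finf p - Finf q|.
    by apply: cvg_norm; apply: cvgB; exact: limF.
  exact: cvgr_to_le h.
have [T T0 hT] := @uniform_attraction n Finf L 0 L0 FiL gas 1 8^-1 (ltac:(by [])).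
pose E := expR (n%:R * (2 * L + 1) * T).
have E0 : 0 < E by exact: expR_gt0.
have E1 (t : R) : t <= T -> expR (n%:R * (2 * L + 1) * t) <= E.
  by move=> tT; rewrite ler_expR ler_wpM2l// mulr_ge0// addr_ge0// mulr_ge0// ltW.
pose eta := (8 * (n.+1%:R * E))^-1.
have eta0 : 0 < eta by rewrite invr_gt0 !mulr_gt0.
have Finf0 : Finf 0 = 0 by case: gas.
have unif : \forall c \near (+oo : set_system R),
    [set p : 'rV[R]_n | `|p| <= n.+1%:R * E] `<=` (fun p => `|Fc c p - Finf p| <= eta).
  have /compact_near_coveringP/near_covering_withinP hK := @closed_ball_compact n (n.+1%:R * E).
  apply: (hK _ _ (fun c p => `|Fc c p - Finf p| <= eta)) => p _.
  have e3 : 0 < eta / 3 by rewrite divr_gt0.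
  have h1 := (cvgrPdist_le _ _).1 (limF p) _ e3.
  have h2 : \forall c \near (+oo : set_system R), 0 < c.
    by exists 0; split; [exact: num_real|].
  have h3 : \forall q \near p, `|p - q| <= eta / 3 / L.
    by apply: near_dist_le; rewrite divr_gt0.
  pose A : set R := [set c : R | `|Finf p - Fc c p| <= eta / 3 /\ 0 < c].
  have hA : \forall c \near (+oo : set_system R), A c.
    by near=> c; split; near: c; [exact: h1|exact: h2].
  exists ([set q | `|p - q| <= eta / 3 / L], A); first by split.
  move=> [q c]/= [hq [hc c0]] _.
  have hLq : L * `|p - q| <= eta / 3 by rewrite mulrC -ler_pdivlMr.
  have -> : Fc c q - Finf q = (Fc c q - Fc c p) + (Fc c p - Finf p) + (Finf p - Finf q).
    by rewrite !subrKA.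
  rewrite (le_trans (ler_normD _ _))// [leRHS](_ : _ = eta / 3 + eta / 3 + eta / 3); last by field.
  rewrite lerD ?(le_trans (FiL _ _))//.
  rewrite (le_trans (ler_normD _ _))// lerD//; last by rewrite distrC.
  by rewrite (le_trans (FcL c c0 q p))// distrC.
have [M [_ hM]] := unif.
pose c0 := Num.max (M + 1) 1.
have c01 : 0 < c0 by rewrite lt_max ltr01 orbT.
exists (T + 1), c0; split => //; first by rewrite ltr_wpDl.
move=> x [cx dx] hx; exists T; first by rewrite T0 lerDl ler01.
pose c := `|x 0|.
have cp : 0 < c by exact: lt_le_trans hx.
pose y t := c^-1 *: x t.
have ty : trajectory (Fc c) y.
  split; first by move=> t; apply: cvgZ; [exact: cvg_cst|exact: cx].
  move=> t t0; rewrite /Fc /y scalerA divff ?gt_eqF// scale1r.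
  have := is_derive_scale (is_derive_const c^-1 t) (dx t t0).
  by rewrite scale0r add0r.
have y0 : `|y 0| = 1.
  by rewrite /y normrZ normfV gtr0_norm// -/c mulVf// gt_eqF.
have [z [z0 cz dz]] := picard L0 FiL (y 0).
have tz : trajectory Finf z by [].
have zle (t : R) : 0 <= t <= T -> `|z t| <= n.+1%:R * E.
  move=> /andP[t0 tT].
  have t00 : trajectory Finf (fun=> 0).
    by split; [move=> s; exact: cvg_cst|move=> s _; rewrite Finf0; exact: is_derive_const].
  have := trajectory_close (ltW L0) FiL tz t00 t0.
  by rewrite !subr0 z0 y0 mulr1 => /le_trans; apply; rewrite ler_wpM2l// E1.
have yz : `|y T - z T| <= 8^-1.
  have cM : M < c by rewrite (lt_le_trans _ hx)// lt_max ltrDl ltr01.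
  have h := @trajectory_perturb n (Fc c) Finf L eta T y z (ltW L0) (ltW eta0) (FcL c cp) ty tz.
  apply: le_trans (h _ T _) _.
  - by move=> t /andP[t0 tT]; apply: (hM c cM); apply: zle; rewrite !ltW.
  - by rewrite T0 lexx.
  - rewrite z0 subrr normr0 add0r -/E /eta le_eqVlt; apply/orP; left; apply/eqP.
    by field; rewrite gt_eqF//= ?pnatr_eq0.
have zT : `|z T| <= 8^-1.
  by have := hT z tz _ T (lexx T); rewrite z0 y0 subr0 => /(_ (lexx 1))/ltW.
have : `|y T| <= 4^-1.
  rewrite -(subrK (z T) (y T)) (le_trans (ler_normD _ _))//.
  by apply: le_trans (lerD yz zT) _; lra.
rewrite /y normrZ normfV (gtr0_norm cp) mulrC ler_pdivrMr//.
by rewrite mulrC.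
Unshelve. all: by end_near. Qed.

End Trajectories.

(** * A quadratic Lyapunov form for a Hurwitz matrix *)

Section Hurwitz.
Variable R : realType.
Local Notation Rc := (@complex.Re R).
Local Notation Ic := (@complex.Im R).

Lemma complex_ReM (x y : R[i]%C) : Rc (x * y) = Rc x * Rc y - Ic x * Ic y.
Proof. by case: x; case: y. Qed.

Lemma complex_ImM (x y : R[i]%C) : Ic (x * y) = Rc x * Ic y + Ic x * Rc y.
Proof. by case: x; case: y. Qed.

(** Schur's theorem gives a lower triangular matrix, and conjugating it by
    [diag (e ^- i)] multiplies its entry [(i, j)] by [e ^+ (i - j)]: for small
    [e] the off-diagonal part becomes negligible while the eigenvalues stay on
    the diagonal. *)
Lemma triangular_scaling n (A : 'M[R[i]%C]_n) (mu : R) :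
  (forall l, eigenvalue A l -> Rc l <= - mu) -> forall del : R, 0 < del ->
  exists Q B : 'M[R[i]%C]_n, [/\ Q \in unitmx, A *m Q = Q *m B,
    forall i, Rc (B i i) <= - mu &
    forall i j, i != j -> `|Rc (B i j)| <= del /\ `|Ic (B i j)| <= del].
Proof.
move=> hA del del0.
have [n0|n0] := posnP n.
  exists 1%:M, A; split; first exact: unitmx1.
  - by rewrite mulmx1 mul1mx.
  - by move=> i; have := ltn_ord i; rewrite [X in (_ < X)%N]n0.
  - by move=> i; have := ltn_ord i; rewrite [X in (_ < X)%N]n0.
have [P /unitarymx_unit Pu] := Schur A n0.
rewrite /similar_to conjumx//; set T := P *m A *m invmx P => Ttrig.
have TP : P *m A = T *m P by rewrite /T mulmxKV.
have eigT i : eigenvalue T (T i i).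
  rewrite eigenvalue_root_char char_poly_trig// (bigD1 i)//= rootM.
  by rewrite root_XsubC eqxx.
have diagT i : Rc (T i i) <= - mu.
  apply: hA; have /eigenvalueP[v vT v0] := eigT i.
  apply/eigenvalueP; exists (v *m P).
    by rewrite -mulmxA TP mulmxA vT scalemxAl.
  apply: contra v0 => /eqP vP; apply/eqP.
  by rewrite -[v](mulmxK Pu) vP mul0mx.
have [tau tau0 htau] : exists2 tau : R, 0 < tau &
    forall i j, `|Rc (T i j)| <= tau /\ `|Ic (T i j)| <= tau.
  exists (1 + \sum_i \sum_j (`|Rc (T i j)| + `|Ic (T i j)|)).
    by rewrite ltr_pwDl// sumr_ge0// => i _; rewrite sumr_ge0// => j _; rewrite addr_ge0.
  move=> i j; have : `|Rc (T i j)| + `|Ic (T i j)| <=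
      \sum_i \sum_j (`|Rc (T i j)| + `|Ic (T i j)|).
    rewrite (bigD1 i)//= (bigD1 j)//= -addrA lerDl addr_ge0//.
      by rewrite sumr_ge0// => k _; rewrite addr_ge0.
    by rewrite sumr_ge0// => k _; rewrite sumr_ge0// => l _; rewrite addr_ge0.
  by have := normr_ge0 (Rc (T i j)); have := normr_ge0 (Ic (T i j)); lra.
pose e : R := Num.min 1 (del / tau).
have e0 : 0 < e by rewrite lt_min ltr01 divr_gt0.
have e1 : e <= 1 by rewrite ge_min lexx.
have edel : tau * e <= del.
  by rewrite mulrC -ler_pdivlMr// /e ge_min lexx orbT.
pose c (x : R) : R[i]%C := real_complex R x.
have cM x y : c (x * y) = c x * c y by rewrite /c rmorphM.
pose D : 'M[R[i]%C]_n := diag_mx (\row_i c (e ^- i)).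
pose D' : 'M[R[i]%C]_n := diag_mx (\row_i c (e ^+ i)).
have DD' : D *m D' = 1%:M.
  rewrite mulmx_diag; apply/matrixP => i j; rewrite !mxE -cM mulVf//.
  by rewrite expf_neq0// gt_eqF.
pose B := D' *m T *m D.
have D'D : D' *m D = 1%:M by exact: mulmx1C.
have BE i j : B i j = c (e ^+ i * e ^- j) * T i j.
  rewrite /B mul_mx_diag mul_diag_mx !mxE.
  by rewrite cM [RHS]mulrAC.
exists (invmx P *m D), B; split.
- rewrite unitmx_mul unitmx_inv Pu/=.
  by case: (mulmx1_unit DD').
- rewrite /B !mulmxA -[invmx P *m D *m D']mulmxA DD' mulmx1.
  by rewrite mulVmx// mul1mx.
- by move=> i; rewrite BE mulfV ?expf_neq0 ?gt_eqF// mul1r.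
move=> i j ij; rewrite BE.
have [ltij|leji] := ltnP i j.
  have /is_trig_mxP -> // := Ttrig.
  by rewrite mulr0 /= normr0 ltW.
have ltji : (j < i)%N by rewrite ltn_neqAle leji andbT eq_sym.
have -> : e ^+ i * e ^- j = e ^+ (i - j).
  by rewrite -{1}(subnK leji) exprD mulfK// expf_neq0// gt_eqF.
have eij : 0 <= e ^+ (i - j) <= e.
  rewrite exprn_ge0 ?(ltW e0)//= -[leRHS]expr1 ler_wiXn2l ?(ltW e0)//.
  by rewrite subn_gt0.
have [h1 h2] := htau i j; case/andP: eij => eij0 eij.
have key (y : R) : `|y| <= tau -> `|e ^+ (i - j) * y| <= del.
  move=> hy; rewrite normrM ger0_norm// (le_trans _ edel)// mulrC.
  by apply: ler_pM => //.
rewrite complex_ReM complex_ImM /c /= !mul0r subr0 addr0.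
by split; exact: key.
Qed.

(** In the coordinates of [triangular_scaling] the real part of the quadratic
    form of [A] is dominated by its diagonal. The matrix [N] lists the real
    and imaginary parts of these complex coordinates, so the Lyapunov form is
    the squared Euclidean norm of [x *m N], and its right inverse [N']
    recovers [x]. *)
Lemma hurwitz_lyapunov n (A : 'M[R]_n) : Hurwitz A ->
  exists (N : 'M[R]_(n, n + n)) (N' : 'M[R]_(n + n, n)) (mu : R),
  [/\ N *m N' = 1%:M, 0 < mu &
      forall x : 'rV[R]_n, dot (x *m A *m N) (x *m N) <= - mu * dot (x *m N) (x *m N)].
Proof.
move=> hA; pose Ac := map_mx (real_complex R) A.
have [mu mu0 hmu] : exists2 mu : R, 0 < mu & forall l, eigenvalue Ac l -> Rc l <= - mu.
  have [rs hrs] := closed_field_poly_normal (char_poly Ac).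
  have eig l : eigenvalue Ac l = (l \in rs).
    rewrite eigenvalue_root_char hrs rootZ ?root_prod_XsubC//.
    by rewrite lead_coef_eq0 -size_poly_eq0 size_char_poly.
  have : forall l, l \in rs -> Rc l < 0 by move=> l; rewrite -eig; exact: hA.
  move=> neg; suff [mu mu0 h] : exists2 mu : R, 0 < mu & forall l, l \in rs -> Rc l <= - mu.
    by exists mu => // l; rewrite eig; exact: h.
  elim: rs neg {hrs eig} => [|r rs IH] neg; first by exists 1.
  have [|mu mu0 hmu] := IH; first by move=> l lrs; apply: neg; rewrite inE lrs orbT.
  exists (Num.min mu (- Rc r)).
    by rewrite lt_min mu0 oppr_gt0 neg// mem_head.
  move=> l; rewrite inE lerNr => /predU1P[->|/hmu].
    by rewrite ge_min lexx orbT.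
  by move=> h; rewrite ge_min; apply/orP; left; lra.
(* The off-diagonal entries then use up at most half of the rate mu. *)
pose del : R := mu / (4 * n.+1%:R).
have del0 : 0 < del by rewrite divr_gt0 ?mulr_gt0.
have [Q [B [Qu AQ Bd Bo]]] := triangular_scaling hmu del0.
pose S := invmx Q.
exists (row_mx (map_mx Rc Q) (map_mx Ic Q)), (col_mx (map_mx Rc S) (- map_mx Ic S)), (mu / 2).
have ReMul p q r (X : 'M[R[i]%C]_(p, q)) (Y : 'M[R[i]%C]_(q, r)) :
    map_mx Rc (X *m Y) = map_mx Rc X *m map_mx Rc Y - map_mx Ic X *m map_mx Ic Y.
  apply/matrixP => i j; rewrite !mxE raddf_sum/= -sumrB.
  by apply: eq_bigr => k _; rewrite !mxE complex_ReM.
have ImMul p q r (X : 'M[R[i]%C]_(p, q)) (Y : 'M[R[i]%C]_(q, r)) :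
    map_mx Ic (X *m Y) = map_mx Rc X *m map_mx Ic Y + map_mx Ic X *m map_mx Rc Y.
  apply/matrixP => i j; rewrite !mxE raddf_sum/= -big_split.
  by apply: eq_bigr => k _; rewrite !mxE complex_ImM.
split; [|by rewrite divr_gt0|].
  rewrite mul_row_col mulmxN -ReMul /S mulmxV//.
  by apply/matrixP => i j; rewrite !mxE; case: eqP.
move=> x; pose z := map_mx (real_complex R) x *m Q.
have xRe (X : 'M[R[i]%C]_n) : x *m map_mx Rc X = map_mx Rc (map_mx (real_complex R) x *m X).
  rewrite ReMul; set a := map_mx Ic (map_mx _ x).
  have -> : a = 0 by apply/matrixP => i j; rewrite !mxE.
  rewrite mul0mx subr0; congr (_ *m _); by apply/matrixP => i j; rewrite !mxE.
have xIm (X : 'M[R[i]%C]_n) : x *m map_mx Ic X = map_mx Ic (map_mx (real_complex R) x *m X).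
  rewrite ImMul; set a := map_mx Ic (map_mx _ x).
  have -> : a = 0 by apply/matrixP => i j; rewrite !mxE.
  rewrite mul0mx addr0; congr (_ *m _); by apply/matrixP => i j; rewrite !mxE.
have dotrow (a b a' b' : 'rV[R]_n) : dot (row_mx a b) (row_mx a' b') = dot a a' + dot b b'.
  rewrite /dot big_split_ord/=; congr (_ + _); apply: eq_bigr => i _.
    by rewrite !row_mxEl.
  by rewrite !row_mxEr.
have ARe : A *m map_mx Rc Q = map_mx Rc (Ac *m Q).
  rewrite ReMul; set a := map_mx Ic Ac.
  have -> : a = 0 by apply/matrixP => i j; rewrite !mxE.
  rewrite mul0mx subr0; congr (_ *m _); by apply/matrixP => i j; rewrite !mxE.
have AIm : A *m map_mx Ic Q = map_mx Ic (Ac *m Q).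
  rewrite ImMul; set a := map_mx Ic Ac.
  have -> : a = 0 by apply/matrixP => i j; rewrite !mxE.
  rewrite mul0mx addr0; congr (_ *m _); by apply/matrixP => i j; rewrite !mxE.
rewrite !mul_mx_row !dotrow -!mulmxA ARe AIm !xRe !xIm AQ !mulmxA -/z.
clearbody z.
pose u j := Rc (z 0 j); pose v j := Ic (z 0 j).
pose W := \sum_j (u j ^+ 2 + v j ^+ 2).
have -> : dot (map_mx Rc z) (map_mx Rc z) + dot (map_mx Ic z) (map_mx Ic z) = W.
  by rewrite /dot -big_split; apply: eq_bigr => j _; rewrite !mxE -!expr2.
have n1 : n%:R * del <= mu / 4.
  rewrite /del mulrA ler_pdivrMr ?mulr_gt0// -[mu / 4 * _]mulrA mulrC.
  by rewrite mulKf// ler_pM2l// ler_nat.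
have -> : dot (map_mx Rc (z *m B)) (map_mx Rc z) + dot (map_mx Ic (z *m B)) (map_mx Ic z) =
    \sum_j \sum_i ((u i * Rc (B i j) - v i * Ic (B i j)) * u j +
                   (u i * Ic (B i j) + v i * Rc (B i j)) * v j).
  rewrite /dot -big_split; apply: eq_bigr => j _.
  rewrite !mxE !raddf_sum/= !mulr_suml -big_split.
  by apply: eq_bigr => i _; rewrite complex_ReM complex_ImM.
pose w j := u j ^+ 2 + v j ^+ 2.
have w0 j : 0 <= w j by rewrite addr_ge0 ?sqr_ge0.
have bound i j : (u i * Rc (B i j) - v i * Ic (B i j)) * u j +
   (u i * Ic (B i j) + v i * Rc (B i j)) * v j <=
   (i == j)%:R * (- mu * w j) + del * (w i + w j).
  have [->|ij] := eqVneq i j.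
    rewrite mul1r; have := Bd j; have := w0 j; move: (Rc _) (Ic _) => p q wj hp.
    have h1 : p * w j <= - mu * w j by rewrite ler_wpM2r.
    have h2 : 0 <= del * (w j + w j) by apply: mulr_ge0 (ltW del0) (addr_ge0 wj wj).
    by move: h1 h2; rewrite /w => h1 h2; lra.
  rewrite mul0r add0r; have [] := Bo i j ij.
  rewrite !ler_norml => /andP[p1 p2] /andP[q1 q2].
  move: p1 p2 q1 q2; rewrite /w; move: (Rc (B i j)) (Ic (B i j)) (u i) (u j) (v i) (v j).
  move=> p q a b c d p1 p2 q1 q2.
  have E1 : p * (a * b + c * d) <= del * ((a ^+ 2 + c ^+ 2 + (b ^+ 2 + d ^+ 2)) / 2).
    have : 0 <= (del - p) * ((a + b) ^+ 2 + (c + d) ^+ 2).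
      by rewrite mulr_ge0 ?subr_ge0 ?addr_ge0 ?sqr_ge0.
    have : 0 <= (del + p) * ((a - b) ^+ 2 + (c - d) ^+ 2).
      by rewrite mulr_ge0//; [lra|rewrite addr_ge0 ?sqr_ge0].
    by lra.
  have E2 : q * (a * d - c * b) <= del * ((a ^+ 2 + c ^+ 2 + (b ^+ 2 + d ^+ 2)) / 2).
    have : 0 <= (del - q) * ((a + d) ^+ 2 + (c - b) ^+ 2).
      by rewrite mulr_ge0 ?subr_ge0 ?addr_ge0 ?sqr_ge0.
    have : 0 <= (del + q) * ((a - d) ^+ 2 + (c + b) ^+ 2).
      by rewrite mulr_ge0//; [lra|rewrite addr_ge0 ?sqr_ge0].
    by lra.
  by lra.
apply: le_trans (ler_sum _ (fun j _ => ler_sum _ (fun i _ => bound i j))) _.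
have W0 : 0 <= W by apply: sumr_ge0 => j _; exact: w0.
have -> : \sum_j \sum_i ((i == j)%:R * (- mu * w j) + del * (w i + w j)) =
    - mu * W + del * (2 * n%:R * W).
  transitivity (\sum_j (- mu * w j + del * (W + n%:R * w j))).
    apply: eq_bigr => j _; rewrite big_split/= (bigD1 j)//= eqxx mul1r big1 ?addr0.
      by rewrite -mulr_sumr big_split/= sumr_const card_ord mulr_natl.
    by move=> i /negbTE ->; rewrite mul0r.
  rewrite big_split/= -mulr_sumr -/W -mulr_sumr big_split/= sumr_const card_ord.
  by rewrite -mulr_sumr -/W -[W *+ n]mulr_natl; congr (_ + _); ring.
have : n%:R * del * W <= mu / 4 * W by rewrite ler_wpM2r.
by lra.
Qed.

End Hurwitz.

(** * Continuity of analytic maps *)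

Section Analytic.
Variable R : realType.
Local Notation "x %:C" := (real_complex R x) : ring_scope.

Lemma norm_real_complex (x : R) : `|x%:C| = `|x|%:C :> R[i]%C.
Proof. by rewrite normc_def /= expr0n /= addr0 sqrtr_sqr. Qed.

Lemma real_complex_le (x y : R) : (x%:C <= y%:C :> R[i]%C) = (x <= y).
Proof. by rewrite lecR. Qed.

(** A nonconstant monomial vanishes at the centre of the polydisc and is
    bounded, where all the variables are at most [del], by the fraction [del /
    r] of its majorant. Comparison with the centre is enough, since every
    point is the centre of an expansion. *)
Lemma analytic_term_le K (al : 'I_K -> nat) (w : 'I_K -> R[i]%C) (del r : R) :
  0 < r -> 0 <= del -> del <= r -> (forall k, `|w k| <= del%:C) ->
  `|\prod_k w k ^+ al k - \prod_k (0 : R[i]%C) ^+ al k| <=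
    (del / r)%:C * r%:C ^+ (\sum_k al k)%N.
Proof.
move=> r0 del0 delr hw.
have rn0 : r != 0 by rewrite gt_eqF.
have [s0|s0] := posnP (\sum_k al k)%N.
  have al0 k : al k = 0%N.
    by apply/eqP; rewrite -leqn0 -s0 (bigD1 k)//= leq_addr.
  rewrite s0 expr0 mulr1.
  have one (v : 'I_K -> R[i]%C) : \prod_k v k ^+ al k = 1.
    by rewrite big1// => k _; rewrite al0 expr0.
  by rewrite !one subrr normr0 -[0]/(0%:C) real_complex_le divr_ge0 ?(ltW r0).
have -> : \prod_k (0 : R[i]%C) ^+ al k = 0.
  have [k k0] : exists k, (0 < al k)%N.
    apply: contrapT => h; move: s0; rewrite big1// => k _.
    by apply/eqP; rewrite -leqn0 leqNgt; apply/negP => hk; apply: h; exists k.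
  by rewrite (bigD1 k)//= expr0n eqn0Ngt k0 mul0r.
rewrite subr0 normr_prod.
apply: (@le_trans _ _ (\prod_k del%:C ^+ al k)).
  by apply: ler_prod => k _; rewrite normr_ge0 normrX lerXn2r// ?nnegrE// -[0]/(0%:C) real_complex_le.
rewrite prodrXr -!rmorphXn -rmorphM real_complex_le.
case: (\sum_k al k)%N s0 => // s _.
rewrite !exprS mulrA divfK// ler_wpM2l// lerXn2r// nnegrE ltW//.
Qed.

Lemma analytic_continuous (K m : nat) (G0 : 'rV[R]_K -> 'rV[R]_m) :
  analytic_on_CK G0 -> continuous G0.
Proof.
move=> [F [anF FG]] x; apply/continuous_row => j.
have [c [r [r0 [M hM] hF]]] := anF j (map_mx (real_complex R) x).
pose S N (z : 'rV[R[i]%C]_K) : R[i]%C := \sum_(al : {ffun 'I_K -> 'I_N})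
   c (fun k => al k) * \prod_k (z 0 k - map_mx (real_complex R) x 0 k) ^+ al k.
have M0 : 0 <= M.
  rewrite -real_complex_le; apply: le_trans (hM 0%N).
  by apply: sumr_ge0 => al _; rewrite mulr_ge0// exprn_ge0// -[0]/(0%:C) real_complex_le ltW.
have key (y : 'rV[R]_K) : `|x - y| < r -> `|G0 x 0 j - G0 y 0 j| <= M * (`|x - y| / r).
  move=> hxy; apply/ler_addgt0Pr => e e0.
  have coord k : `|map_mx (real_complex R) y 0 k - map_mx (real_complex R) x 0 k|
      <= `|x - y|%:C.
    rewrite !mxE -rmorphB norm_real_complex real_complex_le distrC.
    by have := norm_coord_le (x - y) 0 k; rewrite !mxE.
  have SN N : `|S N (map_mx (real_complex R) x) - S N (map_mx (real_complex R) y)|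
      <= (M * (`|x - y| / r))%:C.
    rewrite /S -sumrB (le_trans (ler_norm_sum _ _ _))//.
    rewrite [M * _]mulrC rmorphM; apply: le_trans (ler_wpM2l _ (hM N)); last first.
      by rewrite -[0]/(0%:C) real_complex_le divr_ge0// ltW.
    rewrite mulr_sumr; apply: ler_sum => al _.
    rewrite -mulrBr normrM mulrCA ler_wpM2l// distrC.
    have -> : \prod_k (map_mx (real_complex R) x 0 k - map_mx (real_complex R) x 0 k) ^+ al k
       = \prod_k (0 : R[i]%C) ^+ al k by apply: eq_bigr => k _; rewrite subrr.
    exact: analytic_term_le r0 (normr_ge0 _) (ltW hxy) coord.
  have e2 : 0 < (e / 2)%:C :> R[i]%C by rewrite -[0]/(0%:C) ltcR divr_gt0.
  have cx : S^~ (map_mx (real_complex R) x) @ \oo --> (F (map_mx (real_complex R) x) 0 j : R[i]%C^o).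
    apply: hF => k; rewrite subrr normr0 -[0]/(0%:C) ltcR//.
  have cy : S^~ (map_mx (real_complex R) y) @ \oo --> (F (map_mx (real_complex R) y) 0 j : R[i]%C^o).
    by apply: hF => k; apply: le_lt_trans (coord k) _; rewrite ltcR.
  have hx := (@cvgrPdist_lt _ (R[i]%C^o) nat \oo _ _ _).1 cx _ e2.
  have hy := (@cvgrPdist_lt _ (R[i]%C^o) nat \oo _ _ _).1 cy _ e2.
  have [N _ hN] := filterI (hx _) (hy _).
  have [h1 h2] := hN N (leqnn N).
  rewrite -real_complex_le -norm_real_complex rmorphB.
  have FE z : (G0 z 0 j)%:C = F (map_mx (real_complex R) z) 0 j by rewrite FG mxE.
  rewrite /= !FE.
  set fx := F _ _ _; set fy := F _ _ _.
  have -> : fx - fy = (fx - S N (map_mx (real_complex R) x)) +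
     (S N (map_mx (real_complex R) x) - S N (map_mx (real_complex R) y)) -
     (fy - S N (map_mx (real_complex R) y)).
    by rewrite opprB !addrA subrK subrK.
  apply: le_trans (ler_normB _ _) _.
  apply: le_trans (lerD (ler_normD _ _) (ltW h2)) _.
  apply: le_trans (lerD (lerD (ltW h1) (SN N)) (lexx _)) _.
  rewrite -!rmorphD real_complex_le; lra.
apply/(@cvgrPdist_le _ _ _ (nbhs x)) => e e0.
have e1 : 0 < Num.min (r / 2) (e * r / (M + 1)).
  by rewrite lt_min !divr_gt0 ?mulr_gt0// ltr_wpDl.
apply: filterS (near_dist_le x e1) => y; rewrite le_min => /andP[h1 h2].
apply: le_trans (key y _) _; first by rewrite (le_lt_trans h1)// ltr_pdivrMr// ltr_pMr// ltr1n.
rewrite mulrA ler_pdivrMr//; move: h2; rewrite ler_pdivlMr ?ltr_wpDl// => h2.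
by have := normr_ge0 (x - y); lra.
Qed.

End Analytic.

(** * Quasi-periodic motion on the torus *)

Section Torus.
Variable R : realType.

Lemma cis2piD (x y : R) : cis2pi (x + y) = cis2pi x * cis2pi y.
Proof.
by rewrite /cis2pi mulrDr cosD sinD; congr (_ +i* _)%C; rewrite addrC [X in X + _]mulrC.
Qed.

Lemma cis2pi_int (n : int) : cis2pi (n%:~R : R) = 1.
Proof.
have E0 : cis2pi (0 : R) = 1 by rewrite /cis2pi mulr0 cos0 sin0.
have pos (k : nat) : cis2pi (k%:R : R) = 1.
  elim: k => [//|k IH]; rewrite -natr1 cis2piD IH mul1r /cis2pi mulr1 mulr_natl.
  by rewrite cos2pi sin2pi.
case: n => k; first exact: pos.
have : cis2pi ((Negz k)%:~R + k.+1%:R : R) = 1.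
  by rewrite NegzE mulrNz pmulrn addNr E0.
by rewrite cis2piD pos mulr1.
Qed.

Lemma norm_cis2pi (x : R) : `|cis2pi x| = 1.
Proof. by rewrite normc_def /= cos2Dsin2 sqrtr1. Qed.

Lemma circle_Omega K (x : 'I_K -> R) : Omega (circle x).
Proof. by move=> k; rewrite mxE norm_cis2pi. Qed.

Lemma eq_circle K (x y : 'I_K -> R) : x =1 y -> circle x = circle y.
Proof. by move=> h; apply/rowP => k; rewrite !mxE h. Qed.

Lemma circle_int K (x : 'I_K -> R) (n : 'I_K -> int) :
  circle (fun k => x k + (n k)%:~R) = circle x.
Proof. by apply/rowP => k; rewrite !mxE cis2piD cis2pi_int mulr1. Qed.

Lemma Phi_from_circle K (omega x : 'I_K -> R) (t : R) :
  Phi_from omega (circle x) t = circle (fun k => x k + omega k * t).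
Proof. by apply/rowP => k; rewrite !mxE cis2piD mulrC. Qed.

Lemma G_circle K m (G0 : 'rV[R]_K -> 'rV[R]_m) (x : 'I_K -> R) :
  G G0 (circle x) = G0 (\row_k cos (2 * pi * x k)).
Proof.
rewrite /G; congr G0; apply/rowP => k; rewrite !mxE /cis2pi /=.
by rewrite cos2Dsin2 !divr1 addr0; field.
Qed.

Definition periodic_row K p (u : 'rV[R]_K -> 'rV[R]_p) :=
  forall x (n : 'I_K -> int), u (x + \row_k (n k)%:~R) = u x.

Lemma periodic_circle K p (w : 'rV[R[i]%C]_K -> 'rV[R]_p) :
  periodic_row (fun x : 'rV[R]_K => w (circle (x 0))).
Proof.
move=> x n /=; congr w; rewrite -(circle_int (x 0) n).
by apply: eq_circle => k; rewrite !mxE.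
Qed.

Lemma frac_cube K (x : 'rV[R]_K) : exists n : 'I_K -> int,
  `|x + \row_k (n k)%:~R| <= 1.
Proof.
exists (fun k => - Num.floor (x 0 k)).
apply: norm_coord_lub => // i k; rewrite (ord1 i) !mxE mulrNz.
have := floor_itv (x 0 k); rewrite intrD1 => /andP[h1 h2].
by rewrite ler_norml; apply/andP; split; lra.
Qed.

Lemma periodic_bounded K p (u : 'rV[R]_K -> 'rV[R]_p) :
  continuous u -> periodic_row u -> exists B : R, forall x, `|u x| <= B.
Proof.
move=> cu pu.
have cK := @closed_ball_compact R K 1.
have [|M [_ hM]] := @compact_bounded _ _ (u @` [set x | `|x| <= 1]).
  by apply: continuous_compact => //; exact: continuous_subspaceT.
exists (M + 1) => x; have [n hn] := frac_cube x.
rewrite -(pu x n); apply: (hM (M + 1)); first by rewrite ltrDl.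
by exists (x + \row_k (n k)%:~R).
Qed.

Lemma periodic_uniform K p (u : 'rV[R]_K -> 'rV[R]_p) :
  continuous u -> periodic_row u -> forall e : R, 0 < e ->
  exists2 del : R, 0 < del & forall x y, `|y| <= del -> `|u (x + y) - u x| <= e.
Proof.
move=> cu pu e e0.
have /compact_near_coveringP/near_covering_withinP hK := @closed_ball_compact R K 1.
have : \forall y \near (0 : 'rV[R]_K), [set x : 'rV[R]_K | `|x| <= 1] `<=` (fun x => `|u (x + y) - u x| <= e).
  apply: (hK _ (nbhs (0 : 'rV[R]_K)) (fun y x => `|u (x + y) - u x| <= e) _) => x _.
  have e2 : 0 < e / 2 by rewrite divr_gt0.
  have [r r0 hr] := near_dist_ex ((cvgrPdist_le _ _).1 (cu x) _ e2).
  have r3 : 0 < r / 3 by rewrite divr_gt0.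
  pose A : set 'rV[R]_K := [set x' | `|x - x'| <= r / 3].
  pose B : set 'rV[R]_K := [set y | `|0 - y| <= r / 3].
  have hA : nbhs x A := near_dist_le (x : 'rV[R]_K) r3.
  have hB : nbhs (0 : 'rV[R]_K) B := near_dist_le (0 : 'rV[R]_K) r3.
  exists (A, B) => //.
  move=> [x' y]/= [hx hy] _; rewrite /A/= in hx; rewrite /B/= sub0r normrN in hy.
  have h1 : `|u x - u x'| <= e / 2.
    by apply: hr; lra.
  have h2 : `|u x - u (x' + y)| <= e / 2.
    apply: hr; rewrite opprD addrA (le_trans (ler_normB _ _))//.
    by rewrite (le_trans (lerD hx hy))//; lra.
  rewrite -(subrKA (u x)) (le_trans (ler_normD _ _))// (splitr e) lerD//.
  by rewrite distrC.
move=> /near_dist_ex[r r0 hr]; exists r => // x y hy; have [n hn] := frac_cube x.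
rewrite -(pu x n) -(pu (x + y) n) addrAC; apply: hr => //=.
by rewrite sub0r normrN.
Qed.

(** Dirichlet's pigeonhole argument: among [q.+1 ^ K + 1] multiples of a time
    step of length at least [N], two have their images in the same one of the
    [q.+1 ^ K] cells of the torus, and their difference is an almost-period. *)
Lemma recurrence K (omega : 'rV[R]_K) (eta N : R) : 0 < eta ->
  exists2 T : R, N <= T & exists n : 'I_K -> int,
    `|T *: omega + \row_k (n k)%:~R| <= eta.
Proof.
move=> eta0.
have [q hq] : exists q : nat, eta^-1 < q.+1%:R.
  exists (Num.bound eta^-1); apply: lt_le_trans (archi_boundP _) _.
    by rewrite invr_ge0 ltW.
  by rewrite ler_nat.
have q0 : 0 < q.+1%:R :> R by [].
pose s := Num.max N 1.
have s0 : 0 < s by rewrite lt_max ltr01 orbT.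
pose y (i : nat) k : R := omega 0 k * (s * i%:R).
pose fr i k : R := y i k - (Num.floor (y i k))%:~R.
have fr01 i k : 0 <= fr i k < 1.
  have := floor_itv (y i k); rewrite intrD1 /fr => /andP[h1 h2].
  by apply/andP; split; lra.
pose cell (i : 'I_(q.+1 ^ K).+1) : {ffun 'I_K -> 'I_q.+1} :=
  [ffun k => inord `|Num.floor (q.+1%:R * fr i k)|%N].
have flr i k : exists2 c : nat, (c < q.+1)%N & Num.floor (q.+1%:R * fr i k) = c%:Z.
  have /andP[h1 h2] := fr01 i k.
  have h3 : 0 <= q.+1%:R * fr i k by rewrite mulr_ge0.
  have : (0 <= Num.floor (q.+1%:R * fr i k))%R by rewrite floor_ge0.
  have h4 : q.+1%:R * fr i k < q.+1%:R by rewrite gtr_pMr.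
  have := floor_itv (q.+1%:R * fr i k) => /andP[h5 _].
  move: (le_lt_trans h5 h4); case: (Num.floor _) => // c hc _.
  by exists c => //; rewrite -(ltr_nat R).
have /injectivePn[i [j ij cij]] : ~~ injectiveb cell.
  apply/negP => /injectiveP /leq_card.
  by rewrite card_ffun !card_ord ltnn.
wlog ltij : i j ij cij / (i < j)%N.
  move=> H; have [h|h|h] := ltngtP i j; [exact: (H i j)| |].
    by apply: (H j i) => //; rewrite eq_sym.
  by move: ij; rewrite -val_eqE /= h eqxx.
exists (s * (j - i)%:R).
  have : 1 <= (j - i)%:R :> R by rewrite ler1n subn_gt0.
  move=> h; have : s <= s * (j - i)%:R by rewrite ler_peMr// ltW.
  by apply: le_trans; rewrite le_max lexx.
exists (fun k => Num.floor (y i k) - Num.floor (y j k)).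
apply: norm_coord_lub => [|a k]; first exact: ltW.
rewrite (ord1 a) !mxE.
have -> : s * (j - i)%:R * omega 0 k + (Num.floor (y i k) - Num.floor (y j k))%:~R
   = fr j k - fr i k.
  by rewrite /fr /y natrB ?(ltnW ltij)// rmorphB /=; ring.
have [ci ci1 hi] := flr i k; have [cj cj1 hj] := flr j k.
have cc : ci = cj.
  move/ffunP : cij => /(_ k); rewrite !ffunE hi hj !absz_nat.
  by move/(congr1 val); rewrite /= !inordK.
have := floor_itv (q.+1%:R * fr i k); have := floor_itv (q.+1%:R * fr j k).
rewrite hi hj cc !intrD1 => /andP[h1 h2] /andP[h3 h4].
have : `|q.+1%:R * (fr j k - fr i k)| <= 1.
  by rewrite mulrBr ler_norml; apply/andP; split; lra.
rewrite normrM ger0_norm// => h; rewrite -(ler_pM2l q0) (le_trans h)//.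
by rewrite -ler_pdivrMr// div1r ltW.
Qed.

(** If [T] is an almost-period of [v], then [v (T - s) = 2 *: kap - v (s - T)]
    is close to [2 *: kap - v s], so that pairing [s] with [T - s] shows that
    the average of [v] over [[0, T]] is close to [kap]. Almost-periods are
    unbounded and the average has a limit. *)
Lemma mean_symmetric n (v : R -> 'rV[R]_n) (kap m : 'rV[R]_n) : continuous v ->
  (forall t, v (- t) = 2 *: kap - v t) ->
  (forall e N : R, 0 < e -> exists2 T, N <= T & forall t, `|v (t - T) - v t| <= e) ->
  T^-1 *: mxint 0 T v @[T --> +oo] --> m -> m = kap.
Proof.
move=> cv vsym vap vm.
apply/eqP; rewrite -subr_eq0 -normr_le0; apply/ler_addgt0Pr => e e0; rewrite add0r.
have e2 : 0 < e / 2 by rewrite divr_gt0.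
have [M M0 hM] := cvg_pinfty_dist e2 vm.
have [T MT hT] := vap (e / 2) (M + 1) e2.
have T0 : 0 < T by rewrite (lt_le_trans _ MT)// ltr_wpDl.
have {}hM := hM T (le_trans _ MT); have {}hM : `|T^-1 *: mxint 0 T v - m| < e / 2.
  by apply: hM; rewrite lerDl.
have [P [P0 cP dP PE]] := mxint_primitive cv.
rewrite PE ?(ltW T0)// P0 subr0 in hM.
have := @norm_derive_le R n (fun s => P s - P (T - s) - (2 * s) *: kap)
  (fun s => v s + v (T - s) - 2 *: kap) (fun s => (e / 2) * s) (fun=> e / 2 * 1) 0 T (ltW T0).
have ct s : {for s, continuous (fun s : R => T - s)}.
  by apply: cvgB; [exact: cvg_cst|exact: cvg_id].
move=> H.
have {}H : `|P T - P (T - T) - (2 * T) *: kap - (P 0 - P (T - 0) - (2 * 0) *: kap)|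
   <= e / 2 * T - e / 2 * 0.
  apply: H.
  - move=> s _; apply: cvgB; last first.
      by apply: cvgZr_tmp; apply: cvgM; [exact: cvg_cst|exact: cvg_id].
    by apply: cvgB; [exact: cP|apply: (continuous_comp (ct s)); exact: cP].
  - by move=> s _; apply: cvgM; [exact: cvg_cst|exact: cvg_id].
  - move=> s /andP[s0 sT]; apply: is_derive_sub.
      rewrite -[v (T - s)]opprK; apply: is_derive_sub; first exact: dP.
      rewrite -scaleN1r; apply: is_derive_time_comp; first by apply: dP; rewrite subr_gt0.
      apply: (is_derive_eq (is_derive_sub (is_derive_const T s) (is_derive_id s 1))).
      by rewrite sub0r.
    have d1 : is_derive s (1 : R) (fun s => 2 * s) (2 * 1).
      by apply: is_derive_cmul; exact: is_derive_id.
    apply: (is_derive_eq (is_derive_scale d1 (is_derive_const kap s))).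
    by rewrite scaler0 addr0 mulr1.
  - move=> s /andP[s0 sT].
    have -> : T - s = - (s - T) by rewrite opprB.
    rewrite vsym mulr1 addrA addrAC addrK distrC.
    exact: hT.
move: H; rewrite subrr P0 !subr0 !mulr0 scale0r subr0 sub0r opprK subr0 => H.
have E : P T + P T - (2 * T) *: kap = 2 *: (P T - T *: kap).
  by rewrite scalerBr scalerA scaler_nat mulr2n -mulr2n.
have {}H : `|P T - T *: kap| <= e / 2 * T.
  rewrite addrAC in H.
  have : `|2 *: (P T - T *: kap)| <= e / 2 * T by rewrite -E; move: H; rewrite addrAC.
  rewrite normrZ ger0_norm// => h; apply: le_trans h; rewrite ler_peMl//.
  by rewrite ler1n.
have {}H : `|T^-1 *: P T - kap| <= e / 2.
  have -> : T^-1 *: P T - kap = T^-1 *: (P T - T *: kap).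
    by rewrite scalerBr scalerA mulVf ?scale1r// gt_eqF.
  by rewrite normrZ normfV gtr0_norm// mulrC ler_pdivrMr.
rewrite -(subrKA (T^-1 *: P T)) (le_trans (ler_normD _ _))// (splitr e) lerD//.
by rewrite distrC ltW.
Qed.

End Torus.

(** * Poisson's equation and the symmetry of the signal *)

Section Poisson.
Variable R : realType.

Lemma is_derive_row_mx (p q : nat) (x : R -> 'rV[R]_p) (y : R -> 'rV[R]_q) v w (t : R) :
  is_derive t (1 : R) x v -> is_derive t (1 : R) y w ->
  is_derive t (1 : R) (fun s => row_mx (x s) (y s)) (row_mx v w).
Proof.
move=> /is_derive_row dx /is_derive_row dy; apply/is_derive_row => i.
case: (split_ordP i) => k ->.
  have -> : (fun s => row_mx (x s) (y s) 0 (lshift q k)) = (fun s => x s 0 k).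
    by apply/funext => s; rewrite row_mxEl.
  by rewrite row_mxEl.
have -> : (fun s => row_mx (x s) (y s) 0 (rshift p k)) = (fun s => y s 0 k).
  by apply/funext => s; rewrite row_mxEr.
by rewrite row_mxEr.
Qed.

Lemma is_derive_line n (x v : 'rV[R]_n) (t : R) :
  is_derive t (1 : R) (fun s => x + s *: v) v.
Proof.
have d1 := is_derive_scale (is_derive_id t (1 : R)) (is_derive_const v t).
apply: (is_derive_eq (is_derive_add (is_derive_const x t) d1)).
by rewrite add0r scaler0 addr0 scale1r.
Qed.

Lemma diff_lipschitz_le n p (F : 'rV[R]_n -> 'rV[R]_p) (L : R) (x v : 'rV[R]_n) :
  (forall y, `|F y - F x| <= L * `|y - x|) -> differentiable F x ->
  `|'d F x v| <= L * `|v|.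
Proof.
move=> FL dF; rewrite -deriveE//.
have [/cvg_ex[l hl] _] := derivableP (diff_derivable (v := v) dF).
have -> : 'D_v F x = l by exact: cvg_lim hl.
have hl' := cvg_norm hl.
apply: (cvgr_to_le (hl' _)); near=> h => /=.
have h0 : h != 0 by near: h; exact: nbhs_dnbhs_neq.
rewrite normrZ normfV mulrC ler_pdivrMr ?normr_gt0//.
by rewrite (le_trans (FL _))// addrK normrZ mulrCA mulrC.
Unshelve. all: by end_near. Qed.

Variables (d K : nat) (omega : 'I_K -> R).
Let om : 'rV[R]_K := \row_k omega k.

Section OneFunction.
Variable p : nat.
Variable hh : 'rV[R]_d -> 'rV[R[i]%C]_K -> 'rV[R]_p.
Hypothesis hhC1 : C1_Omega hh.

(** [hh] in the coordinates in which its regularity is assumed. *)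
Let H (y : 'rV[R]_(d + K)) := hh (lsubmx y) (circle (rsubmx y 0)).

Lemma angular_row th (x : 'rV[R]_K) : H (row_mx th x) = hh th (circle (x 0)).
Proof. by rewrite /H row_mxKl row_mxKr. Qed.

Lemma angular_differentiable y : differentiable H y.
Proof. by case: hhC1. Qed.

Lemma angular_continuous : continuous H.
Proof. by move=> y; exact/differentiable_continuous/angular_differentiable. Qed.

Lemma row_mx_continuous_r (th : 'rV[R]_d) : continuous (fun x : 'rV[R]_K => row_mx th x).
Proof.
apply: (@lipschitz_continuous _ _ _ _ 1) => x y; rewrite mul1r.
rewrite opp_row_mx add_row_mx subrr; apply: norm_coord_lub => // i j; rewrite (ord1 i).
case: (split_ordP j) => k ->; first by rewrite row_mxEl mxE normr0.
by rewrite row_mxEr norm_coord_le.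
Qed.

Lemma circle_section_continuous th : continuous (fun x : 'rV[R]_K => hh th (circle (x 0))).
Proof.
have -> : (fun x : 'rV[R]_K => hh th (circle (x 0))) = H \o (fun x => row_mx th x).
  by apply/funext => x /=; rewrite angular_row.
by move=> x; apply: continuous_comp; [exact: row_mx_continuous_r|exact: angular_continuous].
Qed.

Lemma theta_differentiable (x : 'rV[R]_K) th : differentiable (fun th => hh th (circle (x 0))) th.
Proof.
have -> : (fun th => hh th (circle (x 0))) = H \o (fun th => row_mx th x).
  by apply/funext => t /=; rewrite angular_row.
apply: differentiable_comp; last exact: angular_differentiable.
have -> : (fun th : 'rV[R]_d => row_mx th x) =
   (fun th => mulmxr (row_mx 1%:M (0 : 'M[R]_(d, K))) th) + cst (row_mx 0 x).
  apply/funext => t; rewrite /GRing.add/= /mulmxr.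
  rewrite -[RHS]/(_ + _) mul_mx_row mulmx1 mulmx0 add_row_mx add0r.
  by rewrite addr0.
apply: differentiableD; last exact: differentiable_cst.
apply: linear_differentiable.
apply: (@lipschitz_continuous _ _ _ _ (d%:R * `|row_mx 1%:M (0 : 'M[R]_(d, K))|)) => a b.
by rewrite -linearB (le_trans (norm_mulmx_le _ _))// mulrAC.
Qed.

Lemma diff_theta (x : 'rV[R]_K) th v :
  'd H (row_mx th x) (row_mx v 0) = v *m 'J (fun th => hh th (circle (x 0))) th.
Proof.
rewrite -deriveEjacobian; last exact: theta_differentiable.
rewrite deriveE; last exact: theta_differentiable.
have th0 : th + 0 *: v = th by rewrite scale0r addr0.
have d1 : is_derive (0 : R) (1 : R) (fun s => hh (th + s *: v) (circle (x 0)))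
    ('d (fun th => hh th (circle (x 0))) th v).
  apply: (is_derive_diff_comp_at (x := fun s => th + s *: v) th0 (is_derive_line th v 0)).
  exact: theta_differentiable.
have d2 : is_derive (0 : R) (1 : R) (fun s => H (row_mx (th + s *: v) x))
    ('d H (row_mx th x) (row_mx v 0)).
  apply: (is_derive_diff_comp_at (x := fun s => row_mx (th + s *: v) x) _
    (is_derive_row_mx (is_derive_line th v 0) (is_derive_const x _))).
    by rewrite th0.
  exact: angular_differentiable.
apply: is_derive_unique d2 _.
have -> : (fun s => H (row_mx (th + s *: v) x)) = (fun s => hh (th + s *: v) (circle (x 0))).
  by apply/funext => s; rewrite angular_row.
exact: d1.
Qed.

Lemma jacobian_theta_continuous th (v : 'rV[R]_K -> 'rV[R]_d) : continuous v ->
  continuous (fun x : 'rV[R]_K => v x *m 'J (fun th => hh th (circle (x 0))) th).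
Proof.
move=> cv.
have -> : (fun x : 'rV[R]_K => v x *m 'J (fun th => hh th (circle (x 0))) th) =
   (fun x => row_mx (v x) 0 *m 'J H (row_mx th x)).
  by apply/funext => x; rewrite -diff_theta mul_rV_lin1.
have [_ cJ] := hhC1; move=> x.
apply: (@continuous_mulmx R (d + K) p _ (fun x => row_mx (v x) 0) (fun x => 'J H (row_mx th x)) x).
  apply: (@continuous_comp _ _ _ v (fun w => row_mx w 0)); first exact: cv.
  apply: (@lipschitz_continuous _ _ _ _ 1) => a b; rewrite mul1r.
  rewrite opp_row_mx add_row_mx subrr; apply: norm_coord_lub => // i j; rewrite (ord1 i).
  case: (split_ordP j) => k ->; last by rewrite row_mxEr mxE normr0.
  by rewrite row_mxEl norm_coord_le.
exact: (@continuous_comp _ _ _ (fun x => row_mx th x) (fun y => 'J H y) x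
  (@row_mx_continuous_r th x) (cJ _)).
Qed.

Lemma lipschitz_jacobian_le (L : R) :
  (forall th th' z, Omega z -> `|hh th' z - hh th z| <= L * `|th' - th|) ->
  forall th (x : 'I_K -> R) (v : 'rV[R]_d), `|v *m 'J (fun th => hh th (circle x)) th| <= L * `|v|.
Proof.
move=> hL th x v.
have xE : circle x = circle ((\row_k x k) 0) by apply: eq_circle => k; rewrite mxE.
rewrite xE -deriveEjacobian; last exact: theta_differentiable.
rewrite deriveE; last exact: theta_differentiable.
apply: diff_lipschitz_le; last exact: theta_differentiable.
by move=> y; apply: hL; exact: circle_Omega.
Qed.

(** The integral form of Poisson's equation is differentiated along the orbit
    through [x]; the orbit starts one unit of time earlier because the
    equation holds for nonnegative times only and the derivative is two-sided. *)
Lemma poisson_diff (h : 'rV[R[i]%C]_K -> 'rV[R]_p) th :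
  continuous (fun x : 'rV[R]_K => h (circle (x 0))) ->
  poisson omega h (hh th) -> forall x : 'rV[R]_K,
  'd H (row_mx th x) (row_mx 0 om) = - h (circle (x 0)).
Proof.
move=> ch hpoi x.
pose line (t : R) : 'rV[R]_K := (x - om) + t *: om.
have dline t : is_derive t (1 : R) line om by exact: is_derive_line.
have cline : continuous line by move=> t; exact: is_derive_continuous (dline t).
have cg : continuous (fun t => h (circle (line t 0))).
  move=> t; exact: (@continuous_comp _ _ _ line (fun x : 'rV[R]_K => h (circle (x 0))) t (cline t) (ch _)).
have [P [P0 cP dP PE]] := mxint_primitive cg.
have PhiE t : Phi_from omega (circle ((x - om) 0)) t = circle (line t 0).
  rewrite Phi_from_circle; apply: eq_circle => k.
  by rewrite !mxE mulrC.
have l1 : line 1 = x by rewrite /line scale1r subrK.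
have d1 : is_derive (1 : R) (1 : R) (fun t => H (row_mx th (line t)))
    ('d H (row_mx th x) (row_mx 0 om)).
  apply: (is_derive_diff_comp_at (x := fun t => row_mx th (line t)) _
    (is_derive_row_mx (is_derive_const th _) (dline 1))).
    by rewrite l1.
  exact: angular_differentiable.
have d2 : is_derive (1 : R) (1 : R) (fun t => hh th (circle (line 0 0)) - P t)
    (- h (circle (x 0))).
  rewrite -[- h _]add0r -[in h _]l1; apply: is_derive_sub; exact: dP.
apply: is_derive_unique d1 _.
apply: is_derive_eq_gt d2; first exact: ltr01.
move=> t t0; rewrite angular_row -!PhiE.
rewrite (hpoi _ (circle_Omega _) 0 t (lexx 0) (ltW t0)).
have -> : (fun t => h (Phi_from omega (circle ((x - om) 0)) t)) = (fun t => h (circle (line t 0))).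
  by apply/funext => s; rewrite PhiE.
by rewrite PE ?(ltW t0)// P0 subr0 addrC addKr.
Qed.

(** The chain rule: the angular part of the derivative is known from Poisson's
    equation, and the rest comes from the motion of the parameter. *)
Lemma poisson_along (h : 'rV[R]_d -> 'rV[R[i]%C]_K -> 'rV[R]_p) (phi : 'I_K -> R)
    (Theta : R -> 'rV[R]_d) (v : 'rV[R]_d) (t : R) :
  (forall th, continuous (fun x : 'rV[R]_K => h th (circle (x 0)))) ->
  (forall th, poisson omega (h th) (hh th)) ->
  is_derive t (1 : R) Theta v ->
  is_derive t (1 : R) (fun s => hh (Theta s) (Phi omega phi s))
    (v *m 'J (fun th => hh th (Phi omega phi t)) (Theta t) - h (Theta t) (Phi omega phi t)).
Proof.
move=> ch hpoi dT.
pose line (t : R) : 'rV[R]_K := (\row_k phi k) + t *: om.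
have PhiE s : Phi omega phi s = circle (line s 0).
  by apply: eq_circle => k; rewrite !mxE addrC mulrC.
have dH := is_derive_diff_comp (is_derive_row_mx dT (is_derive_line (\row_k phi k) om t))
  (angular_differentiable _).
have -> : (fun s => hh (Theta s) (Phi omega phi s)) = (fun s => H (row_mx (Theta s) (line s))).
  by apply/funext => s; rewrite angular_row PhiE.
apply: (is_derive_eq dH).
rewrite PhiE -diff_theta -(poisson_diff (ch _) (hpoi _)) -linearD.
by rewrite add_row_mx addr0 add0r.
Qed.

End OneFunction.

Lemma orbit_recurrent p (u : 'rV[R]_K -> 'rV[R]_p) : continuous u -> periodic_row u ->
  forall e N : R, 0 < e -> exists2 T, N <= T &
  forall t, `|u ((t - T) *: om) - u (t *: om)| <= e.
Proof.
move=> cu pu e N e0; have [del del0 hdel] := periodic_uniform cu pu e0.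
have [T NT [n hn]] := @recurrence _ _ om del N del0.
exists T => // t.
have -> : t *: om = (t - T) *: om + T *: om by rewrite -scalerDl subrK.
rewrite -(pu (_ + _) n) -addrA distrC; exact: hdel.
Qed.

Section Symmetry.
Variables (m : nat) (G0 : 'rV[R]_K -> 'rV[R]_m).
Variables (f : 'rV[R]_d -> 'rV[R]_m -> 'rV[R]_d).
Variables (fhat fhathat Upsilonhat : 'rV[R]_d -> 'rV[R[i]%C]_K -> 'rV[R]_d).
Hypothesis cG0 : continuous G0.
Hypothesis hQSA2 : QSA2 f G0.
Hypothesis hQSA5 : QSA5 omega f G0 fhat fhathat Upsilonhat.

Lemma G_circle_continuous : continuous (fun x : 'rV[R]_K => G G0 (circle (x 0))).
Proof.
have -> : (fun x : 'rV[R]_K => G G0 (circle (x 0))) =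
    G0 \o (fun x => \row_k cos (2 * pi * x 0 k)).
  by apply/funext => x; rewrite G_circle.
move=> x; apply: continuous_comp; last exact: cG0.
apply/continuous_row => i.
have -> : (fun s : 'rV[R]_K => (\row_k cos (2 * pi * s 0 k)) 0 i) =
    (fun s : 'rV[R]_K => cos (2 * pi * s 0 i)) by apply/funext => s; rewrite mxE.
have cc : continuous (fun r : R => cos (2 * pi * r)).
  move=> r; apply: (@continuous_comp _ _ _ (fun r : R => 2 * pi * r) cos).
    by apply: cvgM; [exact: cvg_cst|exact: cvg_id].
  exact: continuous_cos.
exact: (@continuous_comp _ _ _ (fun s : 'rV[R]_K => s 0 i) _ x (@coord_continuous _ _ _ _ _ _) (cc _)).
Qed.

Lemma f_circle_continuous th : continuous (fun x : 'rV[R]_K => f th (G G0 (circle (x 0)))).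
Proof.
have [Lf [_ hf]] := hQSA2.
have cf : continuous (f th).
  apply: (@lipschitz_continuous _ _ _ _ Lf) => x y.
  by have := hf th th y x; rewrite !subrr normr0 !add0r.
move=> x; exact: (@continuous_comp _ _ _ (fun x : 'rV[R]_K => G G0 (circle (x 0))) (f th) x
  (@G_circle_continuous x) (cf _)).
Qed.

Lemma subr_continuous (b : 'rV[R]_d) : continuous (fun y : 'rV[R]_d => y - b).
Proof. by apply: (@lipschitz_continuous _ _ _ _ 1) => x y; rewrite mul1r opprB addrA subrK. Qed.

Lemma ftilde_circle_continuous th :
  continuous (fun x : 'rV[R]_K => f th (G G0 (circle (x 0))) - fbar f G0 th).
Proof.
move=> x; exact: (@continuous_comp _ _ _ (fun x : 'rV[R]_K => f th (G G0 (circle (x 0))))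
  (fun y : 'rV[R]_d => y - fbar f G0 th) x (@f_circle_continuous th x) (@subr_continuous _ _)).
Qed.

Lemma G_circle_even (x : 'rV[R]_K) : G G0 (circle ((- x) 0)) = G G0 (circle (x 0)).
Proof.
by rewrite !G_circle; congr G0; apply/rowP => k; rewrite !mxE mulrN cosN.
Qed.

Lemma orbit_continuous : continuous (fun t : R => t *: om).
Proof. by move=> t; apply: cvgZr_tmp; exact: cvg_id. Qed.

(** Ergodicity is used for the single orbit through the point [(1, ..., 1)],
    along which the time reversal [t -> - t] is complex conjugation. *)
Lemma orbit_mean (h : 'rV[R[i]%C]_K -> 'rV[R]_d) (kap : 'rV[R]_d) :
  continuous (fun x : 'rV[R]_K => h (circle (x 0))) -> ergodic omega h ->
  (forall t : R, h (circle ((- t *: om) 0)) = 2 *: kap - h (circle ((t *: om) 0))) ->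
  Omega_mean h = kap.
Proof.
move=> ch erg hs.
apply: (@mean_symmetric R d (fun t => h (circle ((t *: om) 0)))) => //.
- move=> t; exact: (@continuous_comp _ _ _ (fun t : R => t *: om)
    (fun x : 'rV[R]_K => h (circle (x 0))) t (@orbit_continuous t) (ch _)).
- by move=> e N e0; exact: (orbit_recurrent ch (periodic_circle h) N e0).
- have := erg _ (circle_Omega (fun=> 0)).
  have -> : (fun t => h (Phi_from omega (circle (fun=> 0)) t)) =
      (fun t => h (circle ((t *: om) 0))) => //.
  apply/funext => t; rewrite Phi_from_circle; congr h; apply: eq_circle => k.
  by rewrite !mxE add0r mulrC.
Qed.

(** The cosine is even, hence so is [f th (G G0 _)] along the orbit through
    [(1, ..., 1)], and a solution of Poisson's equation with an even
    right-hand side is odd up to a constant. The constant is the mean of [fhat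
    th], which is zero. *)
Lemma fhat_odd th (t : R) :
  fhat th (circle ((- t *: om) 0)) = - fhat th (circle ((t *: om) 0)).
Proof.
move: t; have C1f := QSA5_fhat_C1 hQSA5.
pose u (x : 'rV[R]_K) := fhat th (circle (x 0)).
have cu : continuous u by exact: circle_section_continuous.
pose F (t : R) := f th (G G0 (circle ((t *: om) 0))) - fbar f G0 th.
have du (t : R) : is_derive t (1 : R) (fun t => u (t *: om)) (- F t).
  have dl : is_derive t (1 : R) (fun s => s *: om) om.
    have := is_derive_line 0 om t.
    have -> : (fun s : R => 0 + s *: om) = (fun s => s *: om) => //.
    by apply/funext => s; rewrite add0r.
  have dd := is_derive_diff_comp (is_derive_row_mx (is_derive_const th t) dl)
     (angular_differentiable C1f _).
  have -> : (fun t => u (t *: om)) = (fun s => fhat (lsubmx (row_mx th (s *: om)))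
     (circle (rsubmx (row_mx th (s *: om)) 0))).
    by apply/funext => s; rewrite row_mxKl row_mxKr.
  apply: (is_derive_eq dd).
  exact: (@poisson_diff d fhat C1f (fun z => f th (G G0 z) - fbar f G0 th) th
    (@ftilde_circle_continuous th) (QSA5_fhat hQSA5 th) (t *: om)).
have Feven t : F (- t) = F t.
  by rewrite /F scaleNr G_circle_even.
have cst2 (t : R) : 0 <= t -> u (- t *: om) + u (t *: om) = 2 *: u 0.
  move=> t0.
  have := @norm_derive_le R d (fun s => u (- s *: om) + u (s *: om)) (fun=> 0) (fun=> 0) (fun=> 0) 0 t t0.
  have ds s : is_derive s (1 : R) (fun s => u (- s *: om) + u (s *: om)) 0.
    have dN : is_derive s (1 : R) (fun s : R => - s) (-1).
      by apply: is_derive_opp; exact: is_derive_id.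
    apply: (is_derive_eq (is_derive_add (is_derive_time_comp (du (- s)) dN) (du s))).
    by rewrite Feven scaleN1r opprK subrr.
  move=> H; have {}H : `|(u (- t *: om) + u (t *: om)) - (u (- 0 *: om) + u (0 *: om))| <= 0 - 0.
    apply: H.
    - by move=> s _; exact: is_derive_continuous (ds s).
    - by move=> s _; exact: cvg_cst.
    - by move=> s _; rewrite normr0.
  move: H; rewrite subrr normr_le0 subr_eq0 oppr0 scale0r => /eqP ->.
  by rewrite scaler_nat mulr2n.
have cst2' (s : R) : u (- s *: om) = 2 *: u 0 - u (s *: om).
  have [s0|s0] := leP 0 s.
    by rewrite -(cst2 s s0) addrK.
  have := cst2 (- s); rewrite opprK oppr_ge0 => /(_ (ltW s0)) <-.
  by rewrite [u (s *: om) + _]addrC addrK.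
have u0 : u 0 = 0.
  rewrite -(QSA5_fhat_mean hQSA5 th); apply/esym/orbit_mean => //.
  by have [[_ + _ _] _] := QSA5_ergodic hQSA5 th.
by move=> t; have := cst2' t; rewrite u0 scaler0 sub0r.
Qed.

Lemma oppr_rV_continuous : continuous (fun y : 'rV[R]_d => - y).
Proof. by apply: (@lipschitz_continuous _ _ _ _ 1) => x y; rewrite mul1r -opprD normrN. Qed.

Lemma Upsilon_circle_continuous th :
  continuous (fun x : 'rV[R]_K => Upsilon f G0 fhat th (circle (x 0))).
Proof.
have C1f := QSA5_fhat_C1 hQSA5.
move=> x; exact: (@continuous_comp _ _ _ _ (fun y : 'rV[R]_d => - y) x
  (@jacobian_theta_continuous d fhat C1f th _ (@f_circle_continuous th) x) (@oppr_rV_continuous _)).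
Qed.

(** Along the orbit through [(1, ..., 1)], [Ahat] is odd like [fhat] while [f]
    is even, so [Upsilon] is odd and its mean vanishes. *)
Lemma Upsilonbar0 th : Upsilonbar f G0 fhat th = 0.
Proof.
have C1f := QSA5_fhat_C1 hQSA5.
apply: orbit_mean.
- exact: Upsilon_circle_continuous.
- by have [[_ _ _ +] _] := QSA5_ergodic hQSA5 th.
- move=> t; rewrite scaler0 sub0r /Upsilon opprK.
  apply: oppr_inj; rewrite opprK.
  rewrite (_ : - t *: om = - (t *: om)) ?scaleNr// G_circle_even.
  have JN : Ahat fhat th (circle ((- (t *: om)) 0)) = - Ahat fhat th (circle ((t *: om) 0)).
    rewrite /Ahat; set g := fhat^~ (circle ((t *: om) 0)).
    have dg : differentiable g th by exact: theta_differentiable C1f (t *: om) th.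
    have -> : fhat^~ (circle ((- (t *: om)) 0)) = - g.
      by apply/funext => th'; rewrite /g -scaleNr fhat_odd.
    have dN (w : 'rV[R]_d) : 'd (- g) th w = - 'd g th w.
      exact: (congr1 (@^~ w) (diffN dg)).
    apply/matrixP => i j; rewrite [RHS]mxE.
    transitivity ('d (- g) th (delta_mx 0 i) 0 j); first by rewrite mxE.
    by rewrite dN mxE; congr (- _); rewrite mxE.
  by rewrite JN mulmxN.
Qed.

End Symmetry.

End Poisson.

(** * The gain and its clock *)

Section Gain.
Variables (R : realType) (rho : R).
Hypotheses (rho_gt0 : 0 < rho) (rho_lt1 : rho < 1).

Definition gain (t : R) := (1 + t) `^ (- rho).
(** [gain1] and [gain2] are the first two derivatives of [gain]. *)
Definition gain1 (t : R) := - rho * (1 + t) `^ (- rho - 1).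
Definition gain2 (t : R) := rho * (rho + 1) * (1 + t) `^ (- rho - 2).
(** The time scale of the mean flow: a primitive of the gain. *)
Definition clock (t : R) := (1 + t) `^ (1 - rho) / (1 - rho).

Lemma is_derive_powR_shift (p t : R) : -1 < t ->
  is_derive t (1 : R) (fun s => (1 + s) `^ p) (p * (1 + t) `^ (p - 1)).
Proof.
move=> t1; have t0 : 0 < 1 + t by lra.
have d1 := is_derive_time_comp (is_derive1_powR p t0)
  (is_derive_add (is_derive_const (1 : R) t) (is_derive_id t (1 : R))).
by apply: (is_derive_eq d1); rewrite add0r scale1r.
Qed.

Lemma is_derive_gain (t : R) : -1 < t -> is_derive t (1 : R) gain (gain1 t).
Proof. exact: is_derive_powR_shift. Qed.

Lemma is_derive_gain1 (t : R) : -1 < t -> is_derive t (1 : R) gain1 (gain2 t).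
Proof.
move=> t1; apply: (is_derive_eq (is_derive_cmul (- rho) (is_derive_powR_shift (- rho - 1) t1))).
rewrite /gain2 (_ : - rho - 1 - 1 = - rho - 2); last by ring.
by ring.
Qed.

Lemma is_derive_clock (t : R) : -1 < t -> is_derive t (1 : R) clock (gain t).
Proof.
have r1 := rho_lt1.
move=> t1.
have -> : clock = (fun s => (1 - rho)^-1 * (1 + s) `^ (1 - rho)).
  by apply/funext => s; rewrite /clock mulrC.
apply: (is_derive_eq (is_derive_cmul _ (is_derive_powR_shift (1 - rho) t1))).
have rho0 : 0 < 1 - rho by lra.
have rho1 : 1 - rho != 0 by exact: lt0r_neq0.
rewrite mulrA mulVf// mul1r.
by rewrite /gain; congr (_ `^ _); ring.
Qed.

Lemma gain_gt0 (t : R) : 0 <= t -> 0 < gain t.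
Proof. by move=> t0; rewrite powR_gt0// ltr_wpDr. Qed.

Lemma gain_le1 (t : R) : 0 <= t -> gain t <= 1.
Proof.
have r0 := rho_gt0.
move=> t0; rewrite /gain -[leRHS](powRr0 (1 + t)) ler_powR//; first by rewrite lerDl.
by rewrite oppr_le0; lra.
Qed.

Lemma gain_expr n (t : R) : 0 <= t -> gain t ^+ n = (1 + t) `^ (- rho * n%:R).
Proof. by move=> t0; rewrite -powR_mulrn ?powR_ge0// -powRrM. Qed.

Lemma gain_anti (s t : R) : 0 <= s -> s <= t -> gain t <= gain s.
Proof.
have r0 := rho_gt0.
move=> s0 st.
apply: (@le_derive_le R gain gain1 s t) => //.
- move=> r sr; apply: (is_derive_continuous1 (is_derive_gain _)); lra.
- move=> r sr; apply: is_derive_gain; lra.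
- by move=> r _; rewrite /gain1 mulNr oppr_le0 mulr_ge0 ?powR_ge0//; lra.
Qed.

Lemma norm_gain1_le (t : R) : 0 <= t -> `|gain1 t| <= gain t ^+ 2.
Proof.
have r0 := rho_gt0; have r1 := rho_lt1.
move=> t0; rewrite gain_expr// /gain1 normrM normrN (gtr0_norm (x := rho)); last by lra.
rewrite ger0_norm ?powR_ge0//.
apply: (@le_trans _ _ ((1 + t) `^ (- rho - 1))).
  by rewrite ler_piMl ?powR_ge0//; lra.
by rewrite ler_powR; lra.
Qed.

Lemma norm_gain2_le (t : R) : 0 <= t -> `|gain2 t| <= 2 * gain t ^+ 3.
Proof.
have r0 := rho_gt0; have r1 := rho_lt1.
move=> t0; rewrite gain_expr// /gain2.
have h : 0 <= rho * (rho + 1) <= 2 by apply/andP; split; nra.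
have p0 : 0 <= (1 + t) `^ (- rho - 2) by exact: powR_ge0.
rewrite ger0_norm; last by rewrite mulr_ge0//; lra.
apply: (@le_trans _ _ (2 * (1 + t) `^ (- rho - 2))); first by rewrite ler_wpM2r//; lra.
by rewrite ler_wpM2l// ler_powR; lra.
Qed.

Lemma powR_large (p c : R) : 0 < p -> exists2 M : R, 0 <= M & forall t, M <= t -> c <= (1 + t) `^ p.
Proof.
move=> p0; pose c' := Num.max c 1.
have c1 : 1 <= c' by rewrite le_max lexx orbT.
have c0 : 0 < c' by lra.
exists (c' `^ p^-1); first exact: powR_ge0.
move=> t ht; apply: (@le_trans _ _ c'); first by rewrite le_max lexx.
rewrite -[leLHS](powRr1 (ltW c0)) -[X in c' `^ X](mulVf (lt0r_neq0 p0)) powRrM.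
have := powR_ge0 c' p^-1 => h.
by rewrite ge0_ler_powR ?nnegrE ?(ltW p0)//; lra.
Qed.

Lemma gain_small (e : R) : 0 < e -> exists2 M : R, 0 <= M & forall t, M <= t -> gain t <= e.
Proof.
have r0 := rho_gt0.
move=> e0; have [M M0 hM] := powR_large e^-1 r0.
exists M => // t Mt; rewrite /gain powRN.
have h : 0 < (1 + t) `^ rho by rewrite powR_gt0; lra.
by rewrite -[leRHS]invrK lef_pV2 ?posrE ?invr_gt0//; exact: hM.
Qed.

(** [gain1] has order [t `^ (- rho - 1)] and [gain ^+ 2] has order [t `^ (- 2
    * rho)], so [rho < 1] makes the gain vary slowly with respect to its
    square. *)
Lemma gain1_small (e : R) : 0 < e -> exists2 M : R, 0 <= M &
  forall t, M <= t -> `|gain1 t| <= e * gain t ^+ 2.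
Proof.
have r0 := rho_gt0; have r1 := rho_lt1.
move=> e0; have rho0 : 0 < 1 - rho by lra.
have [M M0 hM] := powR_large e^-1 rho0.
exists M => // t Mt; have t0 : 0 <= t by lra.
rewrite gain_expr// /gain1 normrM normrN (gtr0_norm (x := rho)); last by lra.
rewrite ger0_norm ?powR_ge0//.
have E : (1 + t) `^ (- rho - 1) = (1 + t) `^ (- rho * 2) / (1 + t) `^ (1 - rho).
  rewrite -powRN -powRD; last by apply/implyP => _; rewrite gt_eqF//; lra.
  by congr (_ `^ _); ring.
have p0 : 0 <= (1 + t) `^ (- rho * 2) by exact: powR_ge0.
have h : 0 < (1 + t) `^ (1 - rho) by rewrite powR_gt0; lra.
have h2 : ((1 + t) `^ (1 - rho))^-1 <= e.
  by rewrite -[leRHS]invrK lef_pV2 ?posrE ?invr_gt0//; exact: hM.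
apply: (@le_trans _ _ ((1 + t) `^ (- rho - 1))).
  by rewrite ler_piMl ?powR_ge0//; lra.
by rewrite E mulrC ler_wpM2r.
Qed.

Lemma clock_mono (s t : R) : 0 <= s -> s <= t -> clock s <= clock t.
Proof.
have r1 := rho_lt1.
move=> s0 st; rewrite -lerN2.
apply: (@le_derive_le R (fun t => - clock t) (fun t => - gain t) s t) => //.
- move=> r sr; apply: continuousN.
  apply: (is_derive_continuous1 (is_derive_clock _)); lra.
- move=> r sr; apply: is_derive_opp; apply: is_derive_clock; lra.
- by move=> r sr; rewrite oppr_le0 powR_ge0.
Qed.

Lemma clock_lt (s t : R) : 0 <= s -> s < t -> clock s < clock t.
Proof.
have r0 := rho_gt0; have r1 := rho_lt1.
move=> s0 st.
(* The clock is concave: it stays below its tangent at t. *)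
have : gain t * t - clock t <= gain t * s - clock s.
  apply: (@le_derive_le R (fun r => gain t * r - clock r) (fun r => gain t * 1 - gain r) s t).
  - exact: ltW.
  - move=> r sr; apply: cvgB; first by apply: cvgM; [exact: cvg_cst|exact: cvg_id].
    apply: (is_derive_continuous1 (is_derive_clock _)); lra.
  - move=> r sr; apply: is_derive_sub; apply: is_derive_clock; lra.
  - by move=> r /andP[sr rt]; rewrite mulr1 subr_le0 gain_anti//; lra.
have t0 : 0 <= t by lra.
have := mulr_gt0 (gain_gt0 t0) (_ : 0 < t - s); rewrite subr_gt0 => /(_ st).
by lra.
Qed.

Lemma clock_onto (s u : R) : 0 <= s -> 0 <= u -> exists2 t, s <= t & clock t = clock s + u.
Proof.
have r1 := rho_lt1.
move=> s0 u0; have rho0 : 0 < 1 - rho by lra.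
pose y := (1 - rho) * (clock s + u).
have ys : y = (1 + s) `^ (1 - rho) + (1 - rho) * u.
  by rewrite /y mulrDr /clock mulrCA mulfV ?mulr1// gt_eqF.
have sle : (1 + s) `^ (1 - rho) <= y by rewrite ys lerDl mulr_ge0// ltW.
have y0 : 0 <= y by rewrite (le_trans _ sle)// powR_ge0.
exists (y `^ (1 - rho)^-1 - 1).
  rewrite lerBrDl -[leLHS](@powRr1 R); last by lra.
  rewrite -[X in (1 + s) `^ X](mulfV (lt0r_neq0 rho0)) powRrM.
  by rewrite ge0_ler_powR ?nnegrE ?invr_ge0 ?powR_ge0 ?(ltW rho0).
rewrite /clock addrCA subrr addr0 -powRrM mulVf ?gt_eqF// powRr1//.
by rewrite /y mulrAC mulfV ?mul1r// gt_eqF.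
Qed.

(** The clock runs to infinity, so that from late times one can look back by
    [T] units of it and still be after [s]. *)
Lemma clock_gap (s T : R) : 0 <= s -> 0 < T ->
  exists2 M : R, s <= M & forall t, M <= t -> exists2 t0, s <= t0 <= t & clock t = clock t0 + T.
Proof.
have r1 := rho_lt1.
move=> s0 T0; have [M sM cM] := clock_onto s0 (ltW T0).
exists M => // t Mt.
have h : clock s + T <= clock t by rewrite -cM clock_mono//; lra.
have u0 : 0 <= clock t - T - clock s by lra.
have [t0 st0 ct0] := clock_onto s0 u0.
exists t0; last by rewrite ct0; ring.
rewrite st0 leNgt; apply/negP => tt0.
have := clock_mono (le_trans s0 (le_trans sM Mt)) (ltW tt0).
rewrite ct0; lra.
Qed.

End Gain.

(** * Last crossing of a level *)

Section LastCrossing.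
Variable R : realType.

Lemma last_crossing (g : R -> R) (c s t : R) : continuous g -> s < t -> g s <= c -> c < g t ->
  exists2 r : R, s <= r < t & g r = c /\ forall u, r < u <= t -> c < g u.
Proof.
move=> cg st gs gt.
pose S := [set u : R | s <= u <= t /\ g u <= c].
have Ss : S s by split => //; rewrite lexx ltW.
have supS : has_sup S.
  by split; [exists s|exists t => u [/andP[_ ut] _]].
pose r := sup S.
have sr : s <= r by exact: (ub_le_sup supS.2 Ss).
have rt : r <= t by apply: ge_sup; [exists s|move=> u [/andP[]]].
have gru u : r < u <= t -> c < g u.
  move=> /andP[ru ut]; rewrite ltNge; apply/negP => guc.
  have : u <= r by apply: (ub_le_sup supS.2); split => //; rewrite ut andbT; lra.
  by lra.
have gr : g r <= c.
  rewrite leNgt; apply/negP => cgr.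
  have e0 : 0 < (g r - c) / 2 by lra.
  have [del del0 hdel] := near_dist_ex ((cvgrPdist_le _ _).1 (cg r) _ e0).
  have [u Su ru] := sup_adherent del0 supS.
  have ur : u <= r by exact: (ub_le_sup supS.2 Su).
  have := hdel u; rewrite ger0_norm ?subr_ge0// => H.
  have {}H : `|g r - g u| <= (g r - c) / 2 by apply: H; move: ru; rewrite -/r; lra.
  by move: H Su.2; rewrite ler_norml => /andP[_ h1] h2; lra.
have rt' : r < t by rewrite lt_neqAle rt andbT; apply/eqP => e; rewrite e in gr; lra.
exists r; first by rewrite sr.
split => //; apply/eqP; rewrite eq_le gr/= leNgt; apply/negP => grc.
have e0 : 0 < (c - g r) / 2 by lra.
have [del del0 hdel] := near_dist_ex ((cvgrPdist_le _ _).1 (cg r) _ e0).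
pose u := r + Num.min del (t - r).
have m0 : 0 < Num.min del (t - r) by rewrite lt_min del0 subr_gt0.
have m1 : Num.min del (t - r) <= del by rewrite ge_min lexx.
have m2 : Num.min del (t - r) <= t - r by rewrite ge_min lexx orbT.
have : c < g u by apply: gru; rewrite /u; apply/andP; split; lra.
have : `|g r - g u| <= (c - g r) / 2.
  apply: hdel; rewrite /u opprD addrA subrr sub0r normrN ger0_norm//; exact: ltW.
by rewrite ler_norml => /andP[h1 h2]; lra.
Qed.

End LastCrossing.

(** * Slowly varying trajectories: convergence and rate *)

(** The algorithm reduced to what its analysis uses.  [Th] is the trajectory and
    [F] its field along the signal; [fh] and [uh] are the solutions of Poisson's
    equations for the field and for Upsilon, evaluated along the trajectory, with
    [A1] and [U1] the effect on them of the motion of the parameter; [hs] and [hh]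
    are the first of these solutions and its own Poisson solution with the
    parameter frozen at the equilibrium [ths].  The single constant [B] dominates
    all the Lipschitz constants and bounds. *)
Section Dynamics.
Variables (R : realType) (d : nat) (rho : R).
Hypotheses (rho_gt0 : 0 < rho) (rho_lt1 : rho < 1).
Variables (fb : 'rV[R]_d -> 'rV[R]_d) (ths : 'rV[R]_d) (B : R).
Variables Th F A1 U1 fh uh hs hh : R -> 'rV[R]_d.
Hypothesis B_gt0 : 0 < B.
Hypothesis fbL : forall p q, `|fb p - fb q| <= B * `|p - q|.
Hypothesis fb_gas : globally_asymptotically_stable fb ths.
Hypothesis fb_returns : returns fb.
Hypothesis cTh : continuous Th.
Let b := gain rho.
Let b1 := gain1 rho.
Let b2 := gain2 rho.
Let tau := clock rho.
Hypothesis dTh : forall t : R, 0 < t -> is_derive t (1 : R) Th (b t *: F t).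
Hypothesis dfh : forall t : R, 0 < t ->
  is_derive t (1 : R) fh (b t *: A1 t - (F t - fb (Th t))).
Let e (t : R) := `|Th t - ths|.
Hypothesis A1_le : forall t : R, 0 <= t -> `|A1 t| <= B * (1 + e t).
Hypothesis hs_le : forall t : R, 0 <= t -> `|hs t| <= B.
Hypothesis fh_le : forall t : R, 0 <= t -> `|fh t - hs t| <= B * e t.

Let e_ge0 t : 0 <= e t. Proof. exact: normr_ge0. Qed.
Let b_gt0 (t : R) : 0 <= t -> 0 < b t. Proof. exact: gain_gt0. Qed.
Let b_le1 (t : R) : 0 <= t -> b t <= 1. Proof. exact: gain_le1. Qed.

Let norm_fh (t : R) : 0 <= t -> `|fh t| <= B * (1 + e t).
Proof.
move=> t0; rewrite -(subrK (hs t) (fh t)) (le_trans (ler_normD _ _))//.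
by rewrite addrC mulrDr mulr1 lerD// ?hs_le// fh_le.
Qed.

(** The part of the trajectory that does not oscillate at the order of the
    gain: the derivative of [b *: fh] cancels the oscillating part of [F]. *)
Let Y (t : R) := Th t + b t *: fh t.
Let y (t : R) := `|Y t - ths|.

Let dY (t : R) : 0 < t ->
  is_derive t (1 : R) Y (b t *: fb (Th t) + (b t ^+ 2) *: A1 t + b1 t *: fh t).
Proof.
move=> t0; have t1 : -1 < t by lra.
have db := is_derive_gain rho t1.
apply: (is_derive_eq (is_derive_add (dTh t0) (is_derive_scale db (dfh t0)))).
apply/rowP => i; rewrite !mxE -/b /b1; ring.
Qed.

Let YTh (t : R) : 0 <= t -> `|Y t - Th t| <= b t * (B * (1 + e t)).
Proof.
move=> t0; rewrite /Y addrAC subrr add0r normrZ (gtr0_norm (b_gt0 t0)).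
by apply: ler_wpM2l; [exact/ltW/b_gt0|exact: norm_fh].
Qed.

Let early : exists2 t1 : R, 0 < t1 & forall t, t1 <= t -> b t * B <= 2^-1.
Proof.
have B0 := B_gt0.
have B2 : 0 < (2 * B)^-1 by rewrite invr_gt0 mulr_gt0.
have [M M0 hM] := gain_small rho_gt0 B2.
exists (M + 1); first by lra.
move=> t Mt; have : b t <= (2 * B)^-1 by apply: hM; lra.
by rewrite invfM ler_pdivlMr.
Qed.

Let e_le_y (t : R) : 0 <= t -> b t * B <= 2^-1 -> 1 + e t <= 2 * (1 + y t).
Proof.
move=> t0 hb; have h := YTh t0.
have h1 : b t * (B * (1 + e t)) <= 2^-1 * (1 + e t).
  by rewrite mulrA ler_wpM2r// addr_ge0.
have : e t <= y t + `|Y t - Th t|.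
  rewrite /e /y -(subrKA (Y t)) (le_trans (ler_normD _ _))// addrC lerD//.
  by rewrite distrC.
by lra.
Qed.

Let flow_le (x : R -> 'rV[R]_d) (s T : R) : trajectory fb x -> 0 <= s -> s <= T ->
  `|x s - ths| <= d.+1%:R * `|x 0 - ths| * expR (d%:R * (2 * B + 1) * T).
Proof.
move=> tx s0 sT; have B0 := B_gt0.
have [fb0 _ _] := fb_gas.
have tc : trajectory fb (fun=> ths).
  by split; [move=> t; exact: cvg_cst|move=> t _; rewrite fb0; exact: is_derive_const].
apply: le_trans (trajectory_close (ltW B0) fbL tx tc s0) _.
rewrite ler_wpM2l ?mulr_ge0// ler_expR ler_wpM2l//.
by rewrite mulr_ge0// addr_ge0// mulr_ge0// ltW.
Qed.

(** In the clock [tau], [Y] follows the mean flow: the derivative of [Y]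
    differs from [b *: fb Y] by [O(b ^ 2)], times a factor that grows at most
    linearly in [Y]. Over a window of length [T] of the clock Gronwall's
    inequality keeps the error at the order of the gain at the beginning of
    the window. *)
Let tracking (T : R) : 0 <= T -> exists2 C : R, 0 < C &
  forall t0 : R, 0 < t0 -> (forall t, t0 <= t -> b t * B <= 2^-1) ->
  forall x, trajectory fb x -> x 0 = Y t0 ->
  forall t, t0 <= t -> tau t - tau t0 <= T ->
  `|Y t - x (tau t - tau t0)| <= C * b t0 * (1 + y t0).
Proof.
move=> T0; have B0 := B_gt0; have r0 := rho_gt0; have r1 := rho_lt1.
pose E := expR (d%:R * (2 * B + 1) * T).
pose M0 := d.+1%:R * E + 1.
have M1 : 1 <= M0 by rewrite lerDr mulr_ge0// expR_ge0.
pose C1 := 2 * (B * B + 2 * B).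
have C10 : 0 < C1 by rewrite mulr_gt0// addr_gt0// mulr_gt0.
pose C := d.+1%:R * (C1 * M0) * expR (d%:R * (2 * (B + C1) + 1) * T).
have C0 : 0 < C by rewrite mulr_gt0 ?expR_gt0// mulr_gt0// mulr_gt0//; lra.
exists C => // t0 t00 hb x tx x0 t t0t tT.
have t0' : 0 <= t0 by exact: ltW.
have [cx dx] := tx.
pose X s := x (tau s - tau t0).
have dtau (s : R) : t0 <= s -> is_derive s (1 : R) (fun s => tau s - tau t0) (b s).
  move=> ts; have s1 : -1 < s by lra.
  apply: (is_derive_eq (is_derive_sub (is_derive_clock r1 s1) (is_derive_const (tau t0) s))).
  by rewrite subr0.
pose eta := b t0 * (C1 * M0 * (1 + y t0)).
have y0 s : 0 <= y s by exact: normr_ge0.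
have eta0 : 0 <= eta.
  have bt0 := b_gt0 t0'; rewrite /eta; apply: mulr_ge0; first exact: ltW.
  apply: mulr_ge0; last by rewrite addr_ge0.
  by apply: mulr_ge0; lra.
have BC : 0 <= B + C1 by lra.
have := @gronwall_vec R d (fun s => Y s - X s)
  (fun s => b s *: fb (Th s) + (b s ^+ 2) *: A1 s + b1 s *: fh s - b s *: fb (X s))
  (fun s => tau s - tau t0) b (B + C1) eta t0 t t0t BC eta0.
rewrite subrr subr0 => H.
have {}H : `|Y t - X t| <= d.+1%:R * (`|Y t0 - X t0| + eta) *
    expR (d%:R * (2 * (B + C1) + 1) * (tau t - tau t0)).
  apply: H.
  - move=> s /andP[ts st]; have s0 : 0 < s by lra.
    apply: cvgB; first exact: (is_derive_continuous (dY s0)).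
    have c1 : {for s, continuous (fun s => tau s - tau t0)}.
      exact: (is_derive_continuous1 (dtau s ts)).
    exact: (continuous_comp c1 (cx _)).
  - by move=> s /andP[ts st]; exact: (is_derive_continuous1 (dtau s ts)).
  - move=> s /andP[ts st]; have s0 : 0 < s by lra.
    apply: is_derive_sub; first exact: dY.
    apply: is_derive_time_comp; last by apply: dtau; exact: ltW.
    by apply: dx; rewrite subr_gt0; exact: clock_lt.
  - by move=> s /andP[ts st]; apply: dtau; exact: ltW.
  - by move=> s /andP[ts st]; apply/ltW/b_gt0; lra.
  - move=> s /andP[ts st]; have s0 : 0 <= s by lra.
    have sT : tau s - tau t0 <= T.
      by apply: le_trans tT; rewrite lerD2r clock_mono//; lra.
    have s00 : 0 <= tau s - tau t0 by rewrite subr_ge0 clock_mono//; lra.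
    have hX : `|X s - ths| <= d.+1%:R * y t0 * E.
      by have := flow_le tx s00 sT; rewrite x0.
    have hYT := YTh s0; have hA := A1_le s0; have hf := norm_fh s0.
    have bs0 := b_gt0 s0; have bs1 := b_le1 s0.
    have bst : b s <= b t0 by apply: gain_anti => //; exact: ltW.
    have hb1 := norm_gain1_le r0 r1 s0; rewrite -/b1 -/b in hb1.
    have he := e_le_y s0 (hb s (ltW ts)).
    have es := e_ge0 s; have ys := y0 s; have yt0 := y0 t0.
    have hDX : y s <= `|Y s - X s| + d.+1%:R * y t0 * E.
      by rewrite /y -(subrKA (X s)) (le_trans (ler_normD _ _))// lerD2l.
    have h1 : `|b s *: (fb (Th s) - fb (X s))| <= b s * (B * (`|Y s - X s| + b s * (B * (1 + e s)))).
      rewrite normrZ gtr0_norm// ler_wpM2l ?(ltW bs0)// (le_trans (fbL _ _))//.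
      rewrite ler_wpM2l ?(ltW B0)// -(subrKA (Y s)) (le_trans (ler_normD _ _))// addrC lerD2l.
      by rewrite distrC.
    have h2 : `|(b s ^+ 2) *: A1 s| <= b s ^+ 2 * (B * (1 + e s)).
      by rewrite normrZ ger0_norm ?sqr_ge0// ler_wpM2l ?sqr_ge0.
    have h3 : `|b1 s *: fh s| <= b s ^+ 2 * (B * (1 + e s)).
      by rewrite normrZ ler_pM.
    have -> : b s *: fb (Th s) + (b s ^+ 2) *: A1 s + b1 s *: fh s - b s *: fb (X s) =
        b s *: (fb (Th s) - fb (X s)) + (b s ^+ 2) *: A1 s + b1 s *: fh s.
      by apply/rowP => i; rewrite !mxE; ring.
    rewrite (le_trans (ler_normD _ _))//.
    apply: le_trans (lerD (le_trans (ler_normD _ _) (lerD h1 h2)) h3) _.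
    have q1 : b s * (B * (1 + e s)) * B + 2 * (b s * (B * (1 + e s))) <= b s * (C1 * (1 + y s)).
      have -> : b s * (C1 * (1 + y s)) = (b s * (B * B + 2 * B)) * (2 * (1 + y s)).
        by rewrite /C1; ring.
      have -> : b s * (B * (1 + e s)) * B + 2 * (b s * (B * (1 + e s))) =
         (b s * (B * B + 2 * B)) * (1 + e s) by ring.
      by rewrite ler_wpM2l// mulr_ge0 ?(ltW bs0)// addr_ge0// mulr_ge0// ltW.
    have q2 : b s * (C1 * (1 + y s)) <= C1 * `|Y s - X s| + eta.
      have q3 : b s * (C1 * (1 + y s)) <= b s * (C1 * (`|Y s - X s| + M0 * (1 + y t0))).
        rewrite ler_wpM2l ?(ltW bs0)// ler_wpM2l ?(ltW C10)// addrC.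
        have p1 : 0 <= d.+1%:R * E by rewrite mulr_ge0// expR_ge0.
        by move: hDX; rewrite /M0; nra.
      apply: (le_trans q3).
      have q4 : b s * (C1 * `|Y s - X s|) <= C1 * `|Y s - X s|.
        by apply: ler_piMl => //; apply: mulr_ge0 => //; exact: ltW.
      have q5 : b s * (C1 * M0 * (1 + y t0)) <= eta.
        apply: ler_wpM2r => //; apply: mulr_ge0; last by rewrite addr_ge0.
        by apply: mulr_ge0; lra.
      by lra.
    apply: (@le_trans _ _ (b s * (B * `|Y s - X s| +
        (b s * (B * (1 + e s)) * B + 2 * (b s * (B * (1 + e s))))))).
      by rewrite le_eqVlt; apply/orP; left; apply/eqP; ring.
    by rewrite ler_wpM2l ?(ltW bs0)// mulrDl; lra.
have XY : X t0 = Y t0 by rewrite /X subrr x0.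
rewrite XY subrr normr0 add0r in H.
apply: le_trans H _.
rewrite (_ : C * b t0 * (1 + y t0) =
  d.+1%:R * eta * expR (d%:R * (2 * (B + C1) + 1) * T)); last by rewrite /C /eta; ring.
apply: ler_wpM2l; first exact: mulr_ge0 (ler0n R d.+1) eta0.
rewrite ler_expR; apply: ler_wpM2l => //.
by apply: mulr_ge0; [exact: ler0n|lra].
Qed.

(** If [Y] is large at [t], consider the last time [r] before [t] at which its
    norm is [c1]. The mean flow started there returns to a norm below [c1 / 4]
    within the window [T], and [Y], which follows it, comes back below [c1];
    as [Y] stays above [c1] between [r] and [t], the time [t] lies in this
    window, on which the flow is bounded. *)
Let Y_bounded : exists t2 C : R, [/\ 0 < t2, 0 < C, forall t, t2 <= t -> b t * B <= 2^-1 &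
  forall t, t2 <= t -> y t <= C].
Proof.
have B0 := B_gt0; have r0 := rho_gt0; have r1 := rho_lt1.
have [T [c0 [T0 c00 hret]]] := fb_returns.
have [C C0 track] := tracking (ltW T0).
have [t1 t10 h1] := early.
pose N := `|ths|; have N0 : 0 <= N by exact: normr_ge0.
have y_le t : y t <= `|Y t| + N by exact: ler_normB.
(* With this bound on the gain the tracking error is at most one eighth of 1 + |Y|. *)
have e0 : 0 < (8 * C * (1 + N))^-1 by rewrite invr_gt0 !mulr_gt0//; lra.
have [M M0 hM] := gain_small r0 e0.
pose t2 := t1 + M.
have t20 : 0 < t2 by rewrite /t2; lra.
have small t : t2 <= t -> C * b t * (1 + y t) <= 8^-1 * (1 + `|Y t|).
  move=> tt; have ht : b t <= (8 * C * (1 + N))^-1 by apply: hM; move: tt; rewrite /t2; lra.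
  have q : 1 + y t <= (1 + N) * (1 + `|Y t|).
    by have := y_le t; have := mulr_ge0 N0 (normr_ge0 (Y t)); lra.
  have q0 : 0 <= C * b t by rewrite mulr_ge0 ?(ltW C0)// ltW// b_gt0//; lra.
  apply: le_trans (ler_wpM2l q0 q) _; rewrite mulrA ler_wpM2r ?addr_ge0//.
  have CN : 0 < C * (1 + N) by rewrite mulr_gt0//; lra.
  have : b t * (C * (1 + N)) <= 8^-1.
    by rewrite -ler_pdivlMr// -invfM mulrA.
  by lra.
pose c1 := Num.max c0 (Num.max 1 `|Y t2|).
have c1c0 : c0 <= c1 by rewrite le_max lexx.
have c11 : 1 <= c1 by rewrite !le_max lexx orbT.
have c1Y : `|Y t2| <= c1 by rewrite !le_max lexx !orbT.
pose E := d.+1%:R * (c1 + N) * expR (d%:R * (2 * B + 1) * T).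
have E0 : 0 <= E by rewrite mulr_ge0 ?expR_ge0// mulr_ge0//; lra.
exists t2, (c1 + (2 * N + E + c1) + N); split => //.
- by lra.
- by move=> t tt; apply: h1; move: tt; rewrite /t2; lra.
move=> t t2t; apply: (le_trans (y_le t)); rewrite lerD2r.
have [|Yt] := leP `|Y t| c1; first lra.
have t2t' : t2 < t by rewrite lt_neqAle t2t andbT; apply/eqP => E1; move: Yt; rewrite -E1; lra.
pose g (s : R) := `|Y (Num.max s t2)|.
have cg : continuous g.
  move=> s; have cm : {for s, continuous (fun s : R => Num.max s t2)}.
    by apply: (@continuous_max _ _ id (fun=> t2)); [exact: cvg_id|exact: cvg_cst].
  have m0 : 0 < Num.max s t2 by rewrite lt_max t20 orbT.
  have cY := is_derive_continuous (dY m0).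
  have cYm : {for s, continuous (fun s => Y (Num.max s t2))} by exact: (continuous_comp cm cY).
  exact: (continuous_comp cYm (@norm_continuous _ _ _)).
have gE s : t2 <= s -> g s = `|Y s| by move=> h; rewrite /g max_l.
have gt2 : g t2 <= c1 by rewrite gE.
have gt : c1 < g t by rewrite gE.
have [r /andP[t2r rt] [gr hr]] := last_crossing cg t2t' gt2 gt.
rewrite gE// in gr.
have [x [x0 cx dx]] := picard B0 fbL (Y r).
have tx : trajectory fb x by [].
have [|s /andP[s0 sT] xs] := hret x tx; first by rewrite x0 gr.
have r00 : 0 < r by lra.
have hb u : r <= u -> b u * B <= 2^-1 by move=> ru; apply: h1; move: t2r; rewrite /t2; lra.
have [u ru cu] := clock_onto r1 (ltW r00) s0.
have sm := small r t2r; rewrite gr in sm.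
have Yu : `|Y u| < c1.
  have cus : tau u - tau r = s by rewrite /tau cu; ring.
  have := track r r00 hb x tx x0 u ru; rewrite cus => /(_ sT) h.
  have : `|Y u| <= `|Y u - x s| + `|x s| by rewrite -{1}(subrK (x s) (Y u)) ler_normD.
  by rewrite x0 gr in xs; lra.
have ur : r < u by rewrite lt_neqAle ru andbT; apply/eqP => E1; move: Yu; rewrite -E1 gr ltxx.
have tu : t < u.
  rewrite ltNge; apply/negP => ut; have : c1 < g u by apply: hr; rewrite ur ut.
  by rewrite gE; lra.
have tr : tau t - tau r <= s.
  have : tau t <= tau u by apply: clock_mono => //; lra.
  by rewrite {2}/tau cu -/tau; lra.
have tr0 : 0 <= tau t - tau r by rewrite subr_ge0 clock_mono//; lra.
have h := track r r00 hb x tx x0 t (ltW rt) (le_trans tr sT).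
have hx := flow_le tx tr0 (le_trans tr sT).
have hE : `|x (tau t - tau r) - ths| <= E.
  apply: le_trans hx _; rewrite /E x0 ler_wpM2r ?expR_ge0// ler_wpM2l//.
  by have := y_le r; rewrite gr.
have : `|Y t| <= `|Y t - x (tau t - tau r)| + (`|x (tau t - tau r) - ths| + N).
  rewrite -{1}(subrK (x (tau t - tau r)) (Y t)) (le_trans (ler_normD _ _))// lerD2l.
  by rewrite -{1}(subrK ths (x _)) ler_normD.
by lra.
Qed.

(** Looking back by a window long enough for the attraction to be effective,
    uniformly over the ball that contains [Y], [Y] is within the tracking
    error of a solution that has reached the equilibrium. *)
Lemma trajectory_converges (eps : R) : 0 < eps ->
  exists2 M : R, 0 < M & forall t, M <= t -> y t <= eps.
Proof.
move=> eps0; have B0 := B_gt0; have r0 := rho_gt0; have r1 := rho_lt1.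
have [t2 [C [t20 C0 hb hy]]] := Y_bounded.
have e2 : 0 < eps / 2 by lra.
have [T0 T00 hT] := uniform_attraction B0 fbL fb_gas (C + `|ths|) e2.
pose T := T0 + 1.
have Tgt : 0 < T by rewrite /T; lra.
have [C' C'0 track] := tracking (ltW Tgt).
have e3 : 0 < eps / 2 / (C' * (1 + C)) by rewrite divr_gt0// mulr_gt0//; lra.
have [M M0 hM] := gain_small r0 e3.
pose t3 := t2 + M.
have t30 : 0 <= t3 by rewrite /t3; lra.
have [M1 t3M1 hM1] := clock_gap r1 t30 Tgt.
exists (M1 + 1); first lra.
move=> t Mt; have Mt' : M1 <= t by lra.
have [t0 /andP[t3t0 t0t] ct] := hM1 t Mt'.
have t0gt : 0 < t0 by move: t3t0; rewrite /t3; lra.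
have hb0 u : t0 <= u -> b u * B <= 2^-1 by move=> tu; apply: hb; move: t3t0; rewrite /t3; lra.
have [x [x0 cx dx]] := picard B0 fbL (Y t0).
have tx : trajectory fb x by [].
have cT : tau t - tau t0 = T by rewrite /tau ct; ring.
have h := track t0 t0gt hb0 x tx x0 t t0t; rewrite cT in h.
have yt0 : y t0 <= C by apply: hy; move: t3t0; rewrite /t3; lra.
have hx : `|x T - ths| < eps / 2.
  apply: hT => //; last by rewrite /T; lra.
  rewrite x0 -(subrK ths (Y t0)) (le_trans (ler_normD _ _))// lerD2r.
  exact: yt0.
have bt0 : b t0 <= eps / 2 / (C' * (1 + C)) by apply: hM; move: t3t0; rewrite /t3; lra.
have h' : C' * b t0 * (1 + y t0) <= eps / 2.
  have b00 : 0 <= b t0 by apply/ltW/b_gt0; lra.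
  apply: (@le_trans _ _ (C' * b t0 * (1 + C))).
    by rewrite ler_wpM2l// ?mulr_ge0 ?(ltW C'0)// lerD2l.
  by rewrite mulrAC mulrC -ler_pdivlMr// mulr_gt0//; lra.
have : y t <= `|Y t - x T| + `|x T - ths|.
  by rewrite /y -(subrKA (x T)) ler_normD.
by have := h (lexx _); lra.
Qed.

Variables (A : 'M[R]_d).
Hypothesis fb_lin : forall th, `|fb th - (th - ths) *m A| <= B * `|th - ths| ^+ 2.
Hypothesis A_le : forall v : 'rV[R]_d, `|v *m A| <= B * `|v|.
Hypothesis A_hurwitz : Hurwitz A.
Hypothesis duh : forall t : R, 0 < t -> is_derive t (1 : R) uh (b t *: U1 t + A1 t).
Hypothesis dhh : forall t : R, 0 < t -> is_derive t (1 : R) hh (- hs t).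
Hypothesis U1_le : forall t : R, 0 <= t -> `|U1 t| <= B * (1 + e t).
Hypothesis uh_le : forall t : R, 0 <= t -> `|uh t| <= B * (1 + e t).
Hypothesis hh_le : forall t : R, 0 <= t -> `|hh t| <= B.

(** A second change of variables, which removes the oscillations of order [b
    ^+ 2]: the three corrections cancel [b ^+ 2 *: A1], [b1 *: hs] and [- b ^+
    2 *: (hs *m A)] in the derivative of [Y]. *)
Let Z (t : R) := (Y t - ths) - (b t ^+ 2) *: uh t + b1 t *: hh t - (b t ^+ 2) *: (hh t *m A).

(** What remains of the derivative of [Z] besides [b *: (Z *m A)]. *)
Let Rm (t : R) := b t *: (fb (Th t) - (Th t - ths) *m A) + b1 t *: (fh t - hs t)
  - (b t ^+ 2) *: ((fh t - hs t) *m A) - (b t ^+ 3) *: U1 t - (2 * b t * b1 t) *: uh t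
  + b2 t *: hh t - (2 * b t * b1 t) *: (hh t *m A) + (b t ^+ 3) *: (uh t *m A)
  - (b t * b1 t) *: (hh t *m A) + (b t ^+ 3) *: (hh t *m A *m A).

Let db2 (t : R) : 0 < t -> is_derive t (1 : R) (fun s => b s ^+ 2) (2 * b t * b1 t).
Proof.
move=> t0; have t1 : -1 < t by lra.
have db := is_derive_gain rho t1.
have -> : (fun s => b s ^+ 2) = (fun s => b s * b s) by apply/funext => s; rewrite expr2.
by apply: (is_derive_eq (is_derive_mul db db)); rewrite -/b -/b1; ring.
Qed.

Let dZ (t : R) : 0 < t -> is_derive t (1 : R) Z (b t *: (Z t *m A) + Rm t).
Proof.
move=> t0; have t1 : -1 < t by lra.
have db1 := is_derive_gain1 rho t1.
have d1 := is_derive_sub (dY t0) (is_derive_const ths t).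
have d2 := is_derive_scale (db2 t0) (duh t0).
have d3 := is_derive_scale db1 (dhh t0).
have d4 := is_derive_scale (db2 t0) (is_derive_mulmx A (dhh t0)).
apply: (is_derive_eq (is_derive_sub (is_derive_add (is_derive_sub d1 d2) d3) d4)).
rewrite /Z /Rm /Y !(mulmxBl, mulmxDl, mulNmx, =^~ scalemxAl).
by apply/rowP => i; rewrite !mxE -/b -/b1 -/b2; ring.
Qed.

Let late : exists2 t3 : R, 0 < t3 & forall t, t3 <= t -> e t <= 3.
Proof.
have [t1 t10 hb] := early.
have [M M0 hM] := trajectory_converges ltr01.
exists (t1 + M); first lra.
move=> t tt; have h := hM t; have h2 := hb t.
have {}h : y t <= 1 by apply: h; lra.
have {}h2 : b t * B <= 2^-1 by apply: h2; lra.
have t0 : 0 <= t by lra.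
by have := e_le_y t0 h2; lra.
Qed.

(** [K2], [K3], [K] and [K4] collect the constants of the estimates of [e] and
    [Rm] in terms of [Z]. *)
Let K2 := 9 * B + B ^+ 2.

Let ThE (t : R) : Th t - ths + b t *: hs t =
  Z t - b t *: (fh t - hs t) + (b t ^+ 2) *: uh t - b1 t *: hh t + (b t ^+ 2) *: (hh t *m A).
Proof. by apply/rowP => i; rewrite /Z /Y !mxE; ring. Qed.

Let e_le_Z (t : R) : 0 <= t -> e t <= 3 -> e t <= `|Z t| + K2 * b t.
Proof.
move=> t0 e3; have B0 := B_gt0; have bt0 := b_gt0 t0; have bt1 := b_le1 t0.
have hb1 := norm_gain1_le rho_gt0 rho_lt1 t0; rewrite -/b1 -/b in hb1.
have -> : e t = `|Z t - b t *: fh t + (b t ^+ 2) *: uh t - b1 t *: hh t + (b t ^+ 2) *: (hh t *m A)|.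
  congr (`|_|); apply/rowP => i; rewrite /Z /Y !mxE; ring.
have bb : b t ^+ 2 <= b t by rewrite expr2 ler_piMl// ltW.
have b20 : 0 <= b t ^+ 2 by rewrite sqr_ge0.
have f4 : `|fh t| <= 4 * B by apply: le_trans (norm_fh t0) _; nra.
have u4 : `|uh t| <= 4 * B by apply: le_trans (uh_le t0) _; nra.
have n1 : `|b t *: fh t| <= b t * (4 * B) by rewrite normrZ gtr0_norm// ler_wpM2l// ltW.
have n2 : `|(b t ^+ 2) *: uh t| <= b t * (4 * B) by rewrite normrZ ger0_norm// ler_pM.
have n3 : `|b1 t *: hh t| <= b t * B.
  by rewrite normrZ ler_pM// ?hh_le//; exact: le_trans hb1 bb.
have n4 : `|(b t ^+ 2) *: (hh t *m A)| <= b t * (B * B).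
  rewrite normrZ ger0_norm// ler_pM// (le_trans (A_le _))// ler_wpM2l ?hh_le//; exact: ltW.
rewrite (le_trans (ler_normD _ _))// /K2.
have := ler_normB (Z t - b t *: fh t + (b t ^+ 2) *: uh t) (b1 t *: hh t).
have := ler_normD (Z t - b t *: fh t) ((b t ^+ 2) *: uh t).
have := ler_normB (Z t) (b t *: fh t).
by lra.
Qed.

Let K3 := 2 * K2 ^+ 2 + K2 + 3.
Let K := 16 * B + 8 * B ^+ 2 + B ^+ 3.
Let K4 := K * K3.

Let K2_gt0 : 0 < K2.
Proof. by have B0 := B_gt0; rewrite /K2 addr_gt0 ?mulr_gt0 ?exprn_gt0. Qed.

(** After division by [b], every term of [Rm] is quadratic in the pair formed
    by the error [e] and the gain. A term of order [b ^+ 2] alone would be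
    left if the mean of Upsilon were not zero. *)
Let Rm_le (t : R) : 0 <= t -> e t <= 3 -> `|Rm t| <= b t * (K4 * (`|Z t| ^+ 2 + b t ^+ 2)).
Proof.
move=> t0 e3; have B0 := B_gt0; have bt0 := b_gt0 t0; have bt1 := b_le1 t0.
have hb1 := norm_gain1_le rho_gt0 rho_lt1 t0; rewrite -/b1 -/b in hb1.
have hb2 := norm_gain2_le rho_gt0 rho_lt1 t0; rewrite -/b2 -/b in hb2.
have e0 := e_ge0 t.
have b20 : 0 <= b t ^+ 2 by rewrite sqr_ge0.
have b30 : 0 <= b t ^+ 3 by rewrite exprn_ge0// ltW.
have u4 : `|uh t| <= 4 * B by apply: le_trans (uh_le t0) _; nra.
have U4 : `|U1 t| <= 4 * B by apply: le_trans (U1_le t0) _; nra.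
have bb1 : `|b t * b1 t| <= b t ^+ 3.
  by rewrite normrM gtr0_norm// exprS ler_wpM2l// ltW.
have bb2 : `|2 * b t * b1 t| <= 2 * b t ^+ 3 by rewrite -mulrA normrM ger0_norm// ler_wpM2l.
have hhA : `|hh t *m A| <= B * B by rewrite (le_trans (A_le _))// ler_wpM2l ?hh_le// ltW.
have n1 : `|b t *: (fb (Th t) - (Th t - ths) *m A)| <= b t * (B * e t ^+ 2).
  by rewrite normrZ gtr0_norm// ler_wpM2l ?(ltW bt0)// fb_lin.
have n2 : `|b1 t *: (fh t - hs t)| <= b t ^+ 2 * (B * e t) by rewrite normrZ ler_pM// fh_le.
have n3 : `|(b t ^+ 2) *: ((fh t - hs t) *m A)| <= b t ^+ 2 * (B * (B * e t)).
  rewrite normrZ ger0_norm// ler_wpM2l// (le_trans (A_le _))// ler_wpM2l ?fh_le//; exact: ltW.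
have n4 : `|(b t ^+ 3) *: U1 t| <= b t ^+ 3 * (4 * B) by rewrite normrZ ger0_norm// ler_wpM2l.
have n5 : `|(2 * b t * b1 t) *: uh t| <= 2 * b t ^+ 3 * (4 * B) by rewrite normrZ ler_pM.
have n6 : `|b2 t *: hh t| <= 2 * b t ^+ 3 * B by rewrite normrZ ler_pM// hh_le.
have n7 : `|(2 * b t * b1 t) *: (hh t *m A)| <= 2 * b t ^+ 3 * (B * B) by rewrite normrZ ler_pM.
have n8 : `|(b t ^+ 3) *: (uh t *m A)| <= b t ^+ 3 * (B * (4 * B)).
  by rewrite normrZ ger0_norm// ler_wpM2l// (le_trans (A_le _))// ler_wpM2l// ltW.
have n9 : `|(b t * b1 t) *: (hh t *m A)| <= b t ^+ 3 * (B * B) by rewrite normrZ ler_pM.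
have n10 : `|(b t ^+ 3) *: (hh t *m A *m A)| <= b t ^+ 3 * (B * (B * B)).
  by rewrite normrZ ger0_norm// ler_wpM2l// (le_trans (A_le _))// ler_wpM2l// ltW.
have tot : `|Rm t| <= b t * (K * (e t ^+ 2 + b t * e t + b t ^+ 2)).
  have L1 : `|Rm t| <= b t * (B * e t ^+ 2) + b t ^+ 2 * (B * e t) + b t ^+ 2 * (B * (B * e t))
     + b t ^+ 3 * (4 * B) + 2 * b t ^+ 3 * (4 * B) + 2 * b t ^+ 3 * B + 2 * b t ^+ 3 * (B * B)
     + b t ^+ 3 * (B * (4 * B)) + b t ^+ 3 * (B * B) + b t ^+ 3 * (B * (B * B)).
    rewrite /Rm.
    do 4 (rewrite (le_trans (ler_normD _ _))// lerD// ?normrN//).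
    do 5 (rewrite (le_trans (ler_normD _ _))// lerD// ?normrN//).
  apply: (le_trans L1).
  have p1 : 0 <= b t * e t by rewrite mulr_ge0// ltW.
  have p2 : 0 <= e t ^+ 2 by exact: sqr_ge0.
  have k1 : B <= K by rewrite /K; have := exprn_gt0 2 B0; have := exprn_gt0 3 B0; lra.
  have k2 : B + B ^+ 2 <= K by rewrite /K; have := exprn_gt0 2 B0; have := exprn_gt0 3 B0; lra.
  have k3 : 14 * B + 7 * B ^+ 2 + B ^+ 3 <= K by rewrite /K; have := exprn_gt0 2 B0; lra.
  have m1 := ler_wpM2r p2 k1; have m2 := ler_wpM2r p1 k2; have m3 := ler_wpM2r b20 k3.
  apply: (@le_trans _ _ (b t * (B * e t ^+ 2 + (B + B ^+ 2) * (b t * e t)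
     + (14 * B + 7 * B ^+ 2 + B ^+ 3) * b t ^+ 2))).
    by rewrite le_eqVlt; apply/orP; left; apply/eqP; ring.
  by rewrite ler_wpM2l ?(ltW bt0)// !mulrDr !lerD.
apply: (le_trans tot); rewrite ler_wpM2l ?(ltW bt0)// /K4 -mulrA ler_wpM2l//.
  by rewrite /K !addr_ge0 ?mulr_ge0 ?exprn_ge0 ?(ltW B0).
have eZ := e_le_Z t0 e3; have K20 := K2_gt0.
move: eZ e0 (normr_ge0 (Z t)); move: (e t) (`|Z t|) (b t) bt0 => u z q q0 uz u0 z0.
have s1 : u ^+ 2 <= (z + K2 * q) ^+ 2.
  by rewrite lerXn2r// nnegrE// addr_ge0// mulr_ge0// ltW.
have s2 : q * u <= q * (z + K2 * q) by rewrite ler_wpM2l// ltW.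
have s3 : 0 <= (z - K2 * q) ^+ 2 by exact: sqr_ge0.
have s4 : 0 <= (z - q) ^+ 2 by exact: sqr_ge0.
have s5 : 0 <= K2 * z ^+ 2 by rewrite mulr_ge0 ?sqr_ge0// ltW.
have s6 : 0 <= K2 ^+ 2 * z ^+ 2 by rewrite mulr_ge0 ?sqr_ge0.
by rewrite /K3; nra.
Qed.

Let Z_small (eps : R) : 0 < eps -> exists2 M : R, 0 < M & forall t, M <= t -> `|Z t| <= eps.
Proof.
move=> eps0; have [t3 t30 ht3] := late.
have e2 : 0 < eps / 2 by lra.
have [M1 M10 hM1] := trajectory_converges e2.
have K0 : 0 < eps / 2 / K2 by rewrite divr_gt0// K2_gt0.
have [M2 M20 hM2] := gain_small rho_gt0 K0.
exists (t3 + M1 + M2); first lra.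
move=> t tt; have t0 : 0 <= t by lra.
have B0 := B_gt0; have bt0 := b_gt0 t0; have bt1 := b_le1 t0.
have hb1 := norm_gain1_le rho_gt0 rho_lt1 t0; rewrite -/b1 -/b in hb1.
have e3 : e t <= 3 by apply: ht3; lra.
have b20 : 0 <= b t ^+ 2 by rewrite sqr_ge0.
have bb : b t ^+ 2 <= b t by rewrite expr2 ler_piMl// ltW.
have u4 : `|uh t| <= 4 * B by apply: le_trans (uh_le t0) _; nra.
have n2 : `|(b t ^+ 2) *: uh t| <= b t * (4 * B) by rewrite normrZ ger0_norm// ler_pM.
have n3 : `|b1 t *: hh t| <= b t * B.
  by rewrite normrZ ler_pM// ?hh_le//; exact: le_trans hb1 bb.
have n4 : `|(b t ^+ 2) *: (hh t *m A)| <= b t * (B * B).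
  rewrite normrZ ger0_norm// ler_pM// (le_trans (A_le _))// ler_wpM2l ?hh_le//; exact: ltW.
have hy : y t <= eps / 2 by apply: hM1; lra.
have hbt : b t * K2 <= eps / 2.
  by rewrite -ler_pdivlMr ?K2_gt0//; apply: hM2; lra.
have := ler_normB (Y t - ths - (b t ^+ 2) *: uh t + b1 t *: hh t) ((b t ^+ 2) *: (hh t *m A)).
have := ler_normD (Y t - ths - (b t ^+ 2) *: uh t) (b1 t *: hh t).
have := ler_normB (Y t - ths) ((b t ^+ 2) *: uh t).
rewrite -/(Z t) -/(y t) => l1 l2 l3.
have p0 : 0 <= b t * B by rewrite mulr_ge0// ltW.
by move: hbt; rewrite /K2; lra.
Qed.

(** In the Lyapunov form of the Hurwitz matrix [A], the derivative of [W] is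
    at most [b * (- mu * W + K7 * b ^+ 4)] once [Z] is small enough to absorb
    its quadratic part. Since the relative decrease of [b ^+ 4] is slower than
    the rate [mu * b], a multiple of [b ^+ 4] is a barrier for [W]. *)
Let Z_rate : exists t4 C : R, [/\ 0 < t4, forall t, t4 <= t -> e t <= 3 &
  forall t, t4 <= t -> `|Z t| <= C * b t ^+ 2].
Proof.
have B0 := B_gt0; have r0 := rho_gt0; have r1 := rho_lt1.
have [N [N' [mu [NN' mu0 hN]]]] := hurwitz_lyapunov A_hurwitz.
pose q t := Z t *m N.
pose W t := dot (q t) (q t).
pose c1 : R := (d + d)%:R * `|N'| + 1.
have c10 : 0 < c1 by rewrite ltr_wpDl// mulr_ge0.
have Zq t : `|Z t| <= c1 * `|q t|.
  rewrite -{1}[Z t]mulmx1 -NN' mulmxA -/(q t) (le_trans (norm_mulmx_le _ _))//.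
  by rewrite mulrAC ler_wpM2r// lerDl.
pose K5 : R := 2 * (d + d)%:R * (d%:R * `|N|) + 1.
have K50 : 0 < K5 by rewrite ltr_wpDl// !mulr_ge0.
have K30 : 0 < K3 by rewrite /K3; have k0 := K2_gt0; have := exprn_gt0 2 k0; lra.
have Kp : 0 < K by rewrite /K; have := exprn_gt0 2 B0; have := exprn_gt0 3 B0; lra.
have K40 : 0 < K4 by exact: mulr_gt0.
pose K6 := K5 * K4.
have K60 : 0 < K6 by exact: mulr_gt0.
pose K7 := K6 ^+ 2 / (2 * mu).
have K70 : 0 < K7 by rewrite divr_gt0 ?exprn_gt0// mulr_gt0.
have [t3 t30 ht3] := late.
have eps0 : 0 < mu / 2 / (K6 * c1) by rewrite divr_gt0 ?mulr_gt0// divr_gt0.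
have [M1 M10 hM1] := Z_small eps0.
have mu8 : 0 < mu / 8 by lra.
have [M2 M20 hM2] := gain1_small r0 r1 mu8.
pose t4 := t3 + M1 + M2.
have t40 : 0 < t4 by rewrite /t4; lra.
have e3 t : t4 <= t -> e t <= 3 by move=> tt; apply: ht3; move: tt; rewrite /t4; lra.
pose dW t := 2 * dot ((b t *: (Z t *m A) + Rm t) *m N) (q t).
have dWP (t : R) : 0 < t -> is_derive t (1 : R) W (dW t).
  move=> t0; have dq := is_derive_mulmx N (dZ t0).
  apply: (is_derive_eq (@is_derive_dot R (d + d) q q
    (fun t => (b t *: (Z t *m A) + Rm t) *m N) (fun t => (b t *: (Z t *m A) + Rm t) *m N) t dq dq)).
  by rewrite /dW [dot (q t) _]dotC mulr_natl mulr2n.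
have W_le t : t4 <= t -> dW t <= b t * (- mu * W t + K7 * b t ^+ 4).
  move=> tt; have t0 : 0 <= t by lra.
  have bt0 := b_gt0 t0.
  have hR := Rm_le t0 (e3 t tt).
  have hZ : `|Z t| <= mu / 2 / (K6 * c1) by apply: hM1; move: tt; rewrite /t4; lra.
  have qW := sqr_norm_le_dot (q t); rewrite -/(W t) in qW.
  have h1 : dW t = b t * (2 * dot (Z t *m A *m N) (q t)) + 2 * dot (Rm t *m N) (q t).
    by rewrite /dW mulmxDl dotC dotDr -scalemxAl dotZr dotC [dot (q t) (Rm t *m N)]dotC; ring.
  have h2 : 2 * dot (Rm t *m N) (q t) <= K5 * (`|Rm t| * `|q t|).
    have s1 := dot_le (Rm t *m N) (q t); have s2 := ler_norm (dot (Rm t *m N) (q t)).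
    have s3 := norm_mulmx_le (Rm t) N.
    have s4 : (d + d)%:R * (`|Rm t *m N| * `|q t|) <= (d + d)%:R * (d%:R * `|Rm t| * `|N| * `|q t|).
      by rewrite ler_wpM2l// ler_wpM2r.
    have s5 : 0 <= `|Rm t| * `|q t| by rewrite mulr_ge0.
    have -> : K5 * (`|Rm t| * `|q t|) =
       2 * ((d + d)%:R * (d%:R * `|Rm t| * `|N| * `|q t|)) + `|Rm t| * `|q t|.
      by rewrite /K5; ring.
    by lra.
  have h3 : `|Rm t| * `|q t| <= b t * (K4 * (`|Z t| ^+ 2 + b t ^+ 2)) * `|q t|.
    by rewrite ler_wpM2r.
  have h4 : K5 * (`|Rm t| * `|q t|) <= b t * (K6 * (`|Z t| ^+ 2 * `|q t|) + K6 * (b t ^+ 2 * `|q t|)).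
    apply: le_trans (ler_wpM2l (ltW K50) h3) _.
    by rewrite le_eqVlt; apply/orP; left; apply/eqP; rewrite /K6; ring.
  have h5 : K6 * (`|Z t| ^+ 2 * `|q t|) <= mu / 2 * W t.
    have s1 : `|Z t| ^+ 2 * `|q t| <= mu / 2 / (K6 * c1) * (c1 * `|q t| ^+ 2).
      rewrite expr2 -mulrA; apply: ler_pM => //.
      by rewrite [X in _ <= c1 * X]expr2 mulrA ler_wpM2r.
    apply: le_trans (ler_wpM2l (ltW K60) s1) _.
    have -> : K6 * (mu / 2 / (K6 * c1) * (c1 * `|q t| ^+ 2)) = mu / 2 * `|q t| ^+ 2.
      by field; rewrite !gt_eqF.
    by rewrite ler_wpM2l// divr_ge0// ltW.
  have h6 : K6 * (b t ^+ 2 * `|q t|) <= mu / 2 * W t + K7 * b t ^+ 4.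
    have s1 : 0 <= (mu * `|q t| - K6 * b t ^+ 2) ^+ 2 / (2 * mu).
      by rewrite divr_ge0 ?sqr_ge0// mulr_ge0// ltW.
    have s2 : (mu * `|q t| - K6 * b t ^+ 2) ^+ 2 / (2 * mu) =
       mu / 2 * `|q t| ^+ 2 - K6 * (b t ^+ 2 * `|q t|) + K7 * b t ^+ 4.
      by rewrite /K7; field; rewrite gt_eqF.
    have s3 : mu / 2 * `|q t| ^+ 2 <= mu / 2 * W t by rewrite ler_wpM2l// divr_ge0// ltW.
    by rewrite s2 in s1; lra.
  have h7 : b t * (2 * dot (Z t *m A *m N) (q t)) <= b t * (2 * (- mu * W t)).
    by rewrite ler_wpM2l ?(ltW bt0)// ler_wpM2l// hN.
  have h8 : b t * (K6 * (`|Z t| ^+ 2 * `|q t|) + K6 * (b t ^+ 2 * `|q t|)) <=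
      b t * (mu / 2 * W t + (mu / 2 * W t + K7 * b t ^+ 4)).
    by rewrite ler_wpM2l ?(ltW bt0)// lerD.
  rewrite h1; apply: le_trans (lerD h7 (le_trans h2 (le_trans h4 h8))) _.
  by rewrite le_eqVlt; apply/orP; left; apply/eqP; field.
(* The first term makes M * b ^+ 4 absorb the forcing K7 * b ^+ 4, the second one
   places W under the barrier at the time t4. *)
pose M := 2 * K7 / mu + W t4 / b t4 ^+ 4.
have W0 t : 0 <= W t by exact: dot_ge0.
have bt4 := b_gt0 (ltW t40).
have M0 : 0 < M.
  by rewrite ltr_wpDr ?divr_ge0 ?exprn_ge0 ?(ltW bt4)// divr_gt0// mulr_gt0.
have MK : K7 + M * (mu / 2) <= M * mu.
  have : 2 * K7 / mu <= M by rewrite lerDl divr_ge0 ?exprn_ge0 ?(ltW bt4).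
  by rewrite ler_pdivrMr//; lra.
pose g t := W t - M * b t ^+ 4.
have db4 (t : R) : 0 < t -> is_derive t (1 : R) (fun s => b s ^+ 4) (4 * b t ^+ 3 * b1 t).
  move=> t0; have -> : (fun s => b s ^+ 4) = (fun s => b s ^+ 2 * b s ^+ 2).
    by apply/funext => s; rewrite -exprD.
  by apply: (is_derive_eq (is_derive_mul (db2 t0) (db2 t0))); ring.
have dg (t : R) : 0 < t -> is_derive t (1 : R) g (dW t - M * (4 * b t ^+ 3 * b1 t)).
  by move=> t0; apply: is_derive_sub; [exact: dWP|apply: is_derive_cmul; exact: db4].
have g_le t : t4 <= t -> g t <= 0.
  move=> tt.
  have := @gronwall R g (fun t => dW t - M * (4 * b t ^+ 3 * b1 t)) tau b (- mu) t4 t tt.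
  have g4 : g t4 <= 0.
    rewrite /g subr_le0 /M mulrDl mulfVK ?expf_neq0 ?gt_eqF// lerDr.
    apply: mulr_ge0; last by apply/exprn_ge0/ltW.
    by apply: divr_ge0; [exact: mulr_ge0 (ler0n R 2) (ltW K70)|exact: ltW].
  move=> H; have {}H : g t <= g t4 * expR (- mu * (tau t - tau t4)).
    apply: H.
    - move=> s /andP[s4 st]; have s0 : 0 < s by lra.
      exact: (is_derive_continuous1 (dg s s0)).
    - move=> s /andP[s4 st]; have s0 : -1 < s by lra.
      exact: (is_derive_continuous1 (is_derive_clock r1 s0)).
    - move=> s /andP[s4 st]; have s0 : 0 < s by lra.
      exact: dg.
    - move=> s /andP[s4 st]; have s0 : -1 < s by lra.
      exact: is_derive_clock.
    - move=> s /andP[s4 st]; have s0 : 0 <= s by lra.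
      have bs0 := b_gt0 s0.
      have hW := W_le s (ltW s4).
      have hb1 : `|b1 s| <= mu / 8 * b s ^+ 2 by apply: hM2; move: s4; rewrite /t4; lra.
      have hb1' : - b1 s <= mu / 8 * b s ^+ 2.
        by apply: le_trans hb1; rewrite -normrN ler_norm.
      have Mb : 0 <= 4 * M * b s ^+ 3 by rewrite !mulr_ge0 ?exprn_ge0 ?(ltW bs0) ?(ltW M0).
      have s1 := ler_wpM2l Mb hb1'.
      have b5 : 0 <= b s ^+ 5 by rewrite exprn_ge0// ltW.
      have s2 := ler_wpM2r b5 MK.
      have -> : - mu * b s * g s = - mu * (b s * W s) + M * mu * b s ^+ 5 by rewrite /g; ring.
      have E1 : b s * (- mu * W s + K7 * b s ^+ 4) = - mu * (b s * W s) + K7 * b s ^+ 5 by ring.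
      rewrite E1 in hW.
      have E2 : 4 * M * b s ^+ 3 * (mu / 8 * b s ^+ 2) = M * (mu / 2) * b s ^+ 5 by field.
      rewrite E2 in s1; rewrite mulrDl in s2.
      have E3 : 4 * M * b s ^+ 3 * - b1 s = - (M * (4 * b s ^+ 3 * b1 s)) by ring.
      by rewrite E3 in s1; lra.
  by apply: (le_trans H); rewrite mulr_le0_ge0// expR_ge0.
exists t4, (c1 * Num.sqrt M); split => // t tt.
have t0 : 0 <= t by lra.
have bt0 := b_gt0 t0.
apply: (le_trans (Zq t)); rewrite -mulrA ler_wpM2l ?(ltW c10)//.
have sq0 : 0 <= Num.sqrt M * b t ^+ 2 by rewrite mulr_ge0 ?sqrtr_ge0 ?sqr_ge0.
rewrite -ler_sqr ?nnegrE// exprMn sqr_sqrtr ?(ltW M0)// -exprM.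
have := g_le t tt; rewrite /g subr_le0 => h; apply: le_trans h.
exact: sqr_norm_le_dot.
Qed.

(** Late times are covered by the rate of [Z]; on the remaining compact
    interval of times the error is bounded and the gain is bounded below. *)
Theorem trajectory_expansion : exists C : R, forall t : R, 0 <= t ->
  `|Th t - ths + b t *: hs t| <= C * b t ^+ 2.
Proof.
have B0 := B_gt0.
have [t4 [C [t40 e3 hZ]]] := Z_rate.
have C0 : 0 <= C.
  have := hZ t4 (lexx _); have := exprn_gt0 2 (b_gt0 (ltW t40)).
  by move=> h1 h2; rewrite -(pmulr_lge0 _ h1) (le_trans _ h2).
have ctn : {within `[0, t4], continuous (fun t => `|Th t - ths|)}.
  apply: continuous_subspaceT => t.
  have c1 : {for t, continuous (fun s => Th s - ths)} by apply: cvgB; [exact: cTh|exact: cvg_cst].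
  exact: (continuous_comp c1 (@norm_continuous _ _ _)).
have [tm _ htm] := EVT_max (ltW t40) ctn.
pose S := (`|Th tm - ths| + B) / b t4 ^+ 2.
have bt4 := b_gt0 (ltW t40).
exists (C + B * (C + K2) + (4 * B + B + B ^+ 2) + S) => t t0.
have bt0 := b_gt0 t0; have bt1 := b_le1 t0.
have b20 : 0 <= b t ^+ 2 by rewrite sqr_ge0.
have bb : b t ^+ 2 <= b t by rewrite expr2 ler_piMl// ltW.
have S0 : 0 <= S by rewrite divr_ge0 ?sqr_ge0// addr_ge0// ltW.
have K20 := K2_gt0.
have P0 : 0 <= C + B * (C + K2) + (4 * B + B + B ^+ 2).
  have p1 : 0 <= B * (C + K2) by apply: mulr_ge0; [exact: ltW|lra].
  by have := exprn_gt0 2 B0; lra.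
have [tt4|t4t] := leP t t4.
  apply: (@le_trans _ _ (S * b t ^+ 2)); last by rewrite ler_wpM2r// lerDr.
  apply: (@le_trans _ _ (`|Th tm - ths| + B)).
    rewrite (le_trans (ler_normD _ _))// lerD//.
      by apply: htm; rewrite in_itv/= t0.
    rewrite normrZ gtr0_norm//; apply: (@le_trans _ _ (1 * B)); last by rewrite mul1r.
    by rewrite ler_pM ?hs_le// ltW.
  rewrite /S mulrAC ler_pdivlMr ?exprn_gt0// ler_wpM2l ?addr_ge0 ?(ltW B0)//.
  rewrite lerXn2r ?nnegrE ?(ltW bt4) ?(ltW bt0)//; exact: gain_anti.
have e3' := e3 t (ltW t4t); have hZt := hZ t (ltW t4t).
have hb1 := norm_gain1_le rho_gt0 rho_lt1 t0; rewrite -/b1 -/b in hb1.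
have u4 : `|uh t| <= 4 * B by apply: le_trans (uh_le t0) _; nra.
have eZ := e_le_Z t0 e3'.
have e' : e t <= (C + K2) * b t.
  apply: (le_trans eZ); rewrite [(C + K2) * b t]mulrDl; apply: lerD; last exact: lexx.
  apply: (le_trans hZt).
  by rewrite ler_wpM2l.
have n1 : `|b t *: (fh t - hs t)| <= b t ^+ 2 * (B * (C + K2)).
  rewrite normrZ gtr0_norm// expr2 -mulrA ler_wpM2l ?(ltW bt0)// (le_trans (fh_le t0))//.
  rewrite mulrCA [b t * _]mulrC ler_wpM2l ?(ltW B0)//.
have n2 : `|(b t ^+ 2) *: uh t| <= b t ^+ 2 * (4 * B) by rewrite normrZ ger0_norm// ler_wpM2l.
have n3 : `|b1 t *: hh t| <= b t ^+ 2 * B by rewrite normrZ ler_pM// hh_le.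
have n4 : `|(b t ^+ 2) *: (hh t *m A)| <= b t ^+ 2 * (B * B).
  rewrite normrZ ger0_norm// ler_pM// (le_trans (A_le _))// ler_wpM2l ?hh_le//; exact: ltW.
rewrite ThE.
have l1 := ler_normD (Z t - b t *: (fh t - hs t) + (b t ^+ 2) *: uh t - b1 t *: hh t) ((b t ^+ 2) *: (hh t *m A)).
have l2 := ler_normB (Z t - b t *: (fh t - hs t) + (b t ^+ 2) *: uh t) (b1 t *: hh t).
have l3 := ler_normD (Z t - b t *: (fh t - hs t)) ((b t ^+ 2) *: uh t).
have l4 := ler_normB (Z t) (b t *: (fh t - hs t)).
have l5 : 0 <= S * b t ^+ 2 by rewrite mulr_ge0.
by rewrite !mulrDl; lra.
Qed.

End Dynamics.

(** * Expansion of the algorithm *)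

Section Assembly.
Variable R : realType.

(** The derivative of [F] is integrated along the segment from [p] to [x]. *)
Lemma quadratic_remainder n (F : 'rV[R]_n -> 'rV[R]_n) (L : R) (p : 'rV[R]_n) :
  (forall x, differentiable F x) ->
  (forall x y, `|'J F x - 'J F y| <= L * `|x - y|) -> F p = 0 ->
  forall x, `|F x - (x - p) *m 'J F p| <= n%:R * `|L| * `|x - p| ^+ 2.
Proof.
move=> dF JL Fp x; pose v := x - p.
have := @norm_derive_le R n (fun s => F (p + s *: v) - s *: (v *m 'J F p))
  (fun s => v *m ('J F (p + s *: v) - 'J F p))
  (fun s => n%:R * `|L| * `|v| ^+ 2 * s) (fun=> n%:R * `|L| * `|v| ^+ 2 * 1) 0 1 ler01.
have dD (s : R) : is_derive s (1 : R) (fun s => F (p + s *: v) - s *: (v *m 'J F p))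
    (v *m ('J F (p + s *: v) - 'J F p)).
  have d1 := is_derive_diff_comp (is_derive_line p v s) (dF (p + s *: v)).
  have d2 := is_derive_scale (is_derive_id s (1 : R)) (is_derive_const (v *m 'J F p) s).
  apply: (is_derive_eq (is_derive_sub d1 d2)).
  by rewrite -deriveE// deriveEjacobian// scaler0 addr0 scale1r mulmxBr.
move=> H; have {}H : `|F (p + 1 *: v) - 1 *: (v *m 'J F p) - (F (p + 0 *: v) - 0 *: (v *m 'J F p))|
    <= n%:R * `|L| * `|v| ^+ 2 * 1 - n%:R * `|L| * `|v| ^+ 2 * 0.
  apply: H.
  - by move=> s _; exact: (is_derive_continuous (dD s)).
  - by move=> s _; apply: cvgM; [exact: cvg_cst|exact: cvg_id].
  - move=> s /andP[s0 s1]; rewrite mulr1 (le_trans (norm_mulmx_le _ _))//.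
    have h : `|'J F (p + s *: v) - 'J F p| <= `|L| * `|v|.
      apply: (le_trans (JL _ _)); rewrite addrAC subrr add0r normrZ (gtr0_norm s0).
      apply: (@le_trans _ _ (`|L| * (s * `|v|))).
        by rewrite ler_wpM2r ?mulr_ge0 ?(ltW s0)// ler_norm.
      by rewrite ler_wpM2l// ler_piMl// ltW.
    apply: (@le_trans _ _ (n%:R * `|v| * (`|L| * `|v|))).
      by rewrite ler_wpM2l// mulr_ge0.
    by rewrite le_eqVlt; apply/orP; left; apply/eqP; ring.
move: H; rewrite !scale1r !scale0r addr0 Fp !subr0 mulr0 mulr1 subr0.
by rewrite [p + v]addrC subrK.
Qed.

Variables (d m K : nat) (omega phi : 'I_K -> R).
Variables (G0 : 'rV[R]_K -> 'rV[R]_m) (f : 'rV[R]_d -> 'rV[R]_m -> 'rV[R]_d).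
Variables (thetas : 'rV[R]_d) (fhat fhathat Upsilonhat : 'rV[R]_d -> 'rV[R[i]%C]_K -> 'rV[R]_d).
Hypothesis hG0 : analytic_on_CK G0.
Hypothesis hQSA2 : QSA2 f G0.
Hypothesis hQSA3 : QSA3 (fbar f G0) thetas.
Hypothesis hQSA4 : QSA4 (fbar f G0) thetas.
Hypothesis hQSA5 : QSA5 omega f G0 fhat fhathat Upsilonhat.
Variable rho : R.
Hypotheses (rho_gt0 : 0 < rho) (rho_lt1 : rho < 1).

Lemma xi_G t : xi G0 omega phi t = G G0 (Phi omega phi t).
Proof. by rewrite /xi /Phi G_circle. Qed.

Lemma along_bounded (w : 'rV[R[i]%C]_K -> 'rV[R]_d) :
  continuous (fun x : 'rV[R]_K => w (circle (x 0))) ->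
  exists2 M : R, 0 <= M & forall t, `|w (Phi omega phi t)| <= M.
Proof.
move=> cw; have [M hM] := periodic_bounded cw (periodic_circle w).
exists `|M| => // t.
have -> : Phi omega phi t = circle ((\row_k (omega k * t + phi k)) 0).
  by apply: eq_circle => k; rewrite mxE.
exact: le_trans (hM _) (ler_norm M).
Qed.

(** The hypotheses of [trajectory_expansion] are the Poisson equations read
    along the trajectory; the one for [Upsilonhat] has no constant term by
    [Upsilonbar0]. *)
Theorem qsa_expansion (Theta : R -> 'rV[R]_d) : continuous Theta ->
  (forall t : R, 0 < t ->
     is_derive t (1 : R) Theta (gain rho t *: f (Theta t) (xi G0 omega phi t))) ->
  exists C : R, forall t : R, 0 <= t ->
  `|Theta t - thetas + gain rho t *: fhat thetas (Phi omega phi t)| <= C * gain rho t ^+ 2.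
Proof.
move=> cT dT.
have cG0 := analytic_continuous hG0.
have [Lf0 [hfb0 hf0]] := hQSA2.
pose Lf := `|Lf0|; have Lf_ge0 : 0 <= Lf by exact: normr_ge0.
have hfb p q : `|fbar f G0 p - fbar f G0 q| <= Lf * `|p - q|.
  by rewrite (le_trans (hfb0 _ _))// ler_wpM2r// ler_norm.
have hf p q x : `|f p x - f q x| <= Lf * `|p - q|.
  have := hf0 q p x x; rewrite !subrr !normr0 !addr0 => /le_trans; apply.
  by rewrite ler_wpM2r// ler_norm.
have C1f := QSA5_fhat_C1 hQSA5; have C1ff := QSA5_fhathat_C1 hQSA5.
have C1u := QSA5_Upsilonhat_C1 hQSA5.
have [L10 hL10] := QSA5_fhat_lip hQSA5; have [L20 hL20] := QSA5_Upsilonhat_lip hQSA5.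
pose L1 := `|L10|; have L1_ge0 : 0 <= L1 by exact: normr_ge0.
pose L2 := `|L20|; have L2_ge0 : 0 <= L2 by exact: normr_ge0.
have hL1 th th' z : Omega z -> `|fhat th' z - fhat th z| <= L1 * `|th' - th|.
  by move=> Oz; rewrite (le_trans (hL10 _ _ _ Oz))// ler_wpM2r// ler_norm.
have hL2 th th' z : Omega z -> `|Upsilonhat th' z - Upsilonhat th z| <= L2 * `|th' - th|.
  by move=> Oz; rewrite (le_trans (hL20 _ _ _ Oz))// ler_wpM2r// ler_norm.
have [Mf Mf0 hMf] := along_bounded (w := fun z => f thetas (G G0 z))
  (@f_circle_continuous _ _ _ _ _ _ cG0 hQSA2 thetas).
have [Ms Ms0 hMs] := along_bounded (w := fhat thetas)
  (@circle_section_continuous _ _ _ _ _ C1f thetas).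
have [Mh Mh0 hMh] := along_bounded (w := fhathat thetas)
  (@circle_section_continuous _ _ _ _ _ C1ff thetas).
have [Mu Mu0 hMu] := along_bounded (w := Upsilonhat thetas)
  (@circle_section_continuous _ _ _ _ _ C1u thetas).
have [[dfb _] _ [LJ hLJ] hur] := hQSA4.
have [gas _ lyap] := hQSA3.
have [fb0 _ _] := gas.
pose A := 'J (fbar f G0) thetas.
pose Q := d%:R * `|LJ| + d%:R * `|A|; have Q0 : 0 <= Q by rewrite addr_ge0 ?mulr_ge0.
pose B : R := 1 + Lf + L1 + L2 + Ms + Mh + Mu + (L1 + L2) * (Mf + Lf) + Q.
have LM0 : 0 <= (L1 + L2) * (Mf + Lf) by apply: mulr_ge0; apply: addr_ge0.
have LMf : (L1 + L2) * (Mf + Lf) = L1 * Mf + L1 * Lf + L2 * Mf + L2 * Lf by ring.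
have p1 : 0 <= L1 * Mf by exact: mulr_ge0.
have p2 : 0 <= L1 * Lf by exact: mulr_ge0.
have p3 : 0 <= L2 * Mf by exact: mulr_ge0.
have p4 : 0 <= L2 * Lf by exact: mulr_ge0.
have B_gt0 : 0 < B by rewrite /B; lra.
have Lf1 : 0 < Lf + 1 by lra.
have fbL p q : `|fbar f G0 p - fbar f G0 q| <= B * `|p - q|.
  by rewrite (le_trans (hfb p q))// ler_wpM2r// /B; lra.
have fbL' p q : `|fbar f G0 p - fbar f G0 q| <= (Lf + 1) * `|p - q|.
  by rewrite (le_trans (hfb p q))// ler_wpM2r//; lra.
have ret : returns (fbar f G0).
  by case: lyap => [/QSA3a_returns|/(QSA3b_returns Lf1 fbL')].
pose F t := f (Theta t) (xi G0 omega phi t).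
have OP t : Omega (Phi omega phi t) by exact: circle_Omega.
have F_le t : `|F t| <= Mf + Lf * `|Theta t - thetas|.
  rewrite /F -(subrK (f thetas (xi G0 omega phi t)) (f (Theta t) _)).
  rewrite [leRHS]addrC (le_trans (ler_normD _ _))// lerD//.
  by rewrite xi_G; exact: hMf.
have J1 t : `|F t *m Ahat fhat (Theta t) (Phi omega phi t)| <= L1 * `|F t|.
  exact: (lipschitz_jacobian_le C1f hL1).
have J2 t : `|F t *m Ahat Upsilonhat (Theta t) (Phi omega phi t)| <= L2 * `|F t|.
  exact: (lipschitz_jacobian_le C1u hL2).
have e0 t : 0 <= `|Theta t - thetas| by exact: normr_ge0.
pose A1 t := F t *m Ahat fhat (Theta t) (Phi omega phi t).
pose U1 t := F t *m Ahat Upsilonhat (Theta t) (Phi omega phi t).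
have dfh (t : R) : 0 < t -> is_derive t (1 : R) (fun t => fhat (Theta t) (Phi omega phi t))
    (gain rho t *: A1 t - (F t - fbar f G0 (Theta t))).
  move=> t0; have := poisson_along C1f phi
    (@ftilde_circle_continuous _ _ _ _ _ _ cG0 hQSA2) (QSA5_fhat hQSA5) (dT t t0).
  by rewrite -scalemxAl /A1 /F xi_G.
have duh (t : R) : 0 < t -> is_derive t (1 : R) (fun t => Upsilonhat (Theta t) (Phi omega phi t))
    (gain rho t *: U1 t + A1 t).
  move=> t0; have pu th : poisson omega (Upsilon f G0 fhat th) (Upsilonhat th).
    have := QSA5_Upsilonhat hQSA5 th; rewrite (Upsilonbar0 cG0 hQSA2 hQSA5).
    by under eq_fun do rewrite subr0.
  have := poisson_along C1u phi
    (@Upsilon_circle_continuous _ _ _ _ _ _ _ _ _ _ cG0 hQSA2 hQSA5) pu (dT t t0).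
  by rewrite -scalemxAl /Upsilon opprK /A1 /U1 /F xi_G.
have dhh (t : R) : 0 < t -> is_derive t (1 : R) (fun t => fhathat thetas (Phi omega phi t))
    (- fhat thetas (Phi omega phi t)).
  move=> t0.
  have := @poisson_along _ _ _ _ _ _ C1ff fhat phi (fun=> thetas) 0 t
    (@circle_section_continuous _ _ _ _ _ C1f) (QSA5_fhathat hQSA5) (is_derive_const _ _).
  by rewrite mul0mx sub0r.
have A1B (t : R) : 0 <= t -> `|A1 t| <= B * (1 + `|Theta t - thetas|).
  move=> t0; apply: (le_trans (J1 t)).
  have := ler_wpM2l L1_ge0 (F_le t); have := mulr_ge0 Lf_ge0 (e0 t).
  have q1 : (L1 * Mf + L1 * Lf) * (1 + `|Theta t - thetas|) <= B * (1 + `|Theta t - thetas|).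
    by rewrite ler_wpM2r ?addr_ge0// /B LMf; lra.
  have := mulr_ge0 p1 (e0 t).
  by lra.
have U1B (t : R) : 0 <= t -> `|U1 t| <= B * (1 + `|Theta t - thetas|).
  move=> t0; apply: (le_trans (J2 t)).
  have := ler_wpM2l L2_ge0 (F_le t); have := mulr_ge0 Lf_ge0 (e0 t).
  have q1 : (L2 * Mf + L2 * Lf) * (1 + `|Theta t - thetas|) <= B * (1 + `|Theta t - thetas|).
    by rewrite ler_wpM2r ?addr_ge0// /B LMf; lra.
  have := mulr_ge0 p3 (e0 t).
  by lra.
have hsB (t : R) : 0 <= t -> `|fhat thetas (Phi omega phi t)| <= B.
  by move=> _; rewrite (le_trans (hMs t))// /B; lra.
have hhB (t : R) : 0 <= t -> `|fhathat thetas (Phi omega phi t)| <= B.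
  by move=> _; rewrite (le_trans (hMh t))// /B; lra.
have fhB (t : R) : 0 <= t -> `|fhat (Theta t) (Phi omega phi t) - fhat thetas (Phi omega phi t)|
    <= B * `|Theta t - thetas|.
  by move=> _; rewrite (le_trans (hL1 _ _ _ (OP t)))// ler_wpM2r// /B; lra.
have uhB (t : R) : 0 <= t -> `|Upsilonhat (Theta t) (Phi omega phi t)| <= B * (1 + `|Theta t - thetas|).
  move=> t0.
  rewrite -(subrK (Upsilonhat thetas (Phi omega phi t)) (Upsilonhat (Theta t) _)).
  apply: (le_trans (ler_normD _ _)).
  have := hL2 thetas (Theta t) _ (OP t); have := hMu t.
  have q1 : (Mu + L2) * (1 + `|Theta t - thetas|) <= B * (1 + `|Theta t - thetas|).
    by rewrite ler_wpM2r ?addr_ge0// /B; lra.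
  have := mulr_ge0 Mu0 (e0 t).
  by lra.
have quad (th : 'rV[R]_d) : `|fbar f G0 th - (th - thetas) *m A| <= B * `|th - thetas| ^+ 2.
  apply: le_trans (quadratic_remainder dfb (fun x y => hLJ y x) fb0 th) _.
  rewrite ler_wpM2r ?sqr_ge0// /B /Q; have : 0 <= d%:R * `|A| by rewrite mulr_ge0.
  by lra.
have mulA (v : 'rV[R]_d) : `|v *m A| <= B * `|v|.
  rewrite (le_trans (norm_mulmx_le _ _))// mulrAC ler_wpM2r// /B /Q.
  have : 0 <= d%:R * `|LJ| by rewrite mulr_ge0.
  by lra.
exact: (trajectory_expansion rho_gt0 rho_lt1 B_gt0 fbL gas ret cT dT dfh A1B hsB fhB
  quad mulA hur duh dhh U1B uhB hhB).
Qed.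

End Assembly.

(** * Polyak-Ruppert averages *)

Section Averaging.
Variable R : realType.

Lemma ThetaPR_eq n (x y : R -> 'rV[R]_n) (kappa T : R) : 1 < kappa -> 0 < T ->
  (forall t, 0 <= t -> y t = x t) -> ThetaPR x kappa T = ThetaPR y kappa T.
Proof.
move=> k1 T0 yx; congr (_ *: _); apply/matrixP => i j; rewrite !mxE.
apply: eq_Rintegral => t; rewrite inE/= in_itv/= => /andP[Tt _].
rewrite yx// (le_trans _ Tt)// mulr_ge0 ?(ltW T0)//.
by rewrite subr_ge0 invf_le1// ?(ltW k1)// (lt_trans _ k1).
Qed.

(** The oscillating term is integrated by parts: the integral of [gain *: hs]
    is a boundary term [- gain *: hh] up to an integral of [gain1 *: hh], so
    its average over a window of length proportional to [T] is [O(gain / T)],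
    which is [O(T `^ (- 2 * rho))] because [rho < 1]. The window starts at a
    fixed fraction [S] of [T], so that the gain on it is [O(T `^ (- rho))]. *)
Lemma averaged_expansion n (rho kappa C B : R) (p : 'rV[R]_n) (x hs hh : R -> 'rV[R]_n) :
  0 < rho -> rho < 1 -> 1 < kappa -> 0 <= C -> 0 <= B ->
  continuous x -> (forall t : R, is_derive t (1 : R) hh (- hs t)) ->
  (forall t, `|hs t| <= B) -> (forall t, `|hh t| <= B) ->
  (forall t, 0 <= t -> `|x t - p + gain rho t *: hs t| <= C * gain rho t ^+ 2) ->
  exists C' : R, forall T : R, 0 < T ->
    `|ThetaPR x kappa T - p| <= C' * T `^ (- (2 * rho)).
Proof.
move=> r0 r1 k1 C0 B0 cx dhh hsB hhB xC.
have [P [_ _ dP PE]] := mxint_primitive cx.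
have k0 : 0 < kappa by lra.
pose c := 1 - kappa^-1.
have ki0 : 0 < kappa^-1 by rewrite invr_gt0.
have c0 : 0 < c by rewrite /c subr_gt0 invf_lt1.
pose c2 := c `^ (- rho).
have c2_ge0 : 0 <= c2 by exact: powR_ge0.
have CB : 0 <= C + B by exact: addr_ge0.
have Q0 : 0 <= 2 * B * kappa * c2 by do 3?apply: mulr_ge0 => //; exact: ltW.
exists (C + B + ((C + B) * c2 ^+ 2 + 2 * B * kappa * c2)) => T T0.
pose S := c * T; have S0 : 0 < S by exact: mulr_gt0.
pose l := T - S; have lE : l = kappa^-1 * T by rewrite /l /S /c; ring.
have l0 : 0 < l by rewrite lE mulr_gt0.
have ST : S <= T by rewrite -subr_ge0 ltW.
have gb t : 0 <= t -> gain rho t ^+ 2 <= gain rho t.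
  by move=> t0; rewrite expr2 ler_piMl ?gain_le1// ltW// gain_gt0.
have -> : ThetaPR x kappa T - p = l^-1 *: (P T - P S - l *: p).
  rewrite /ThetaPR -/c -/S -/l PE ?(ltW S0)//.
  by rewrite [RHS]scalerBr scalerA mulVf ?scale1r// gt_eqF.
have pw0 : 0 <= T `^ (- (2 * rho)) by exact: powR_ge0.
(* For T < 1 the right-hand side is at least C', and crude bounds suffice. *)
have [T1|T1] := ltP T 1.
  have : `|P T - T *: p - (P S - S *: p)| <= (C + B) * T - (C + B) * S.
    apply: (@norm_derive_le R n (fun t => P t - t *: p) (fun t => x t - p)
      (fun t => (C + B) * t) (fun=> (C + B) * 1)) => //.
    - move=> t /andP[St _]; have t0 : 0 < t by lra.
      exact: is_derive_continuous (is_derive_sub (dP t t0)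
        (is_derive_scale (is_derive_id t (1 : R)) (is_derive_const p t))).
    - by move=> t _; exact: is_derive_continuous1 (is_derive_cmul _ (is_derive_id t (1 : R))).
    - move=> t /andP[St _]; have t0 : 0 < t by lra.
      apply: (is_derive_eq (is_derive_sub (dP t t0)
        (is_derive_scale (is_derive_id t (1 : R)) (is_derive_const p t)))).
      by rewrite scaler0 addr0 scale1r.
    - move=> t /andP[St _]; have t0 : 0 <= t by lra.
      rewrite mulr1 -(addrK (gain rho t *: hs t) (x t - p)).
      rewrite (le_trans (ler_normB _ _))// lerD//.
        rewrite (le_trans (xC t t0))// ler_piMr// (le_trans (gb t t0))//.
        exact: gain_le1.
      rewrite normrZ (gtr0_norm (gain_gt0 _ t0)) (le_trans _ (hsB t))//.
      by rewrite ler_piMl// gain_le1.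
  have -> : P T - T *: p - (P S - S *: p) = P T - P S - l *: p.
    by rewrite /l scalerBl !opprD !opprK; apply/rowP => i; rewrite !mxE; ring.
  rewrite -mulrBr -/l => h.
  rewrite normrZ gtr0_norm ?invr_gt0// ler_pdivrMl//.
  apply: (le_trans h); rewrite mulrC ler_wpM2l ?(ltW l0)//.
  apply: (@le_trans _ _ ((C + B) * T `^ (- (2 * rho)))).
    rewrite ler_peMr//.
    rewrite -[leLHS](powRr0 T) /powR gt_eqF//= ler_expR mul0r.
    by rewrite mulNr -mulrN mulr_ge0//; [lra|rewrite oppr_ge0 ln_le0// ltW].
  by rewrite ler_wpM2r// lerDl addr_ge0// mulr_ge0// sqr_ge0.
pose b := gain rho S.
have b0 : 0 < b by rewrite gain_gt0// ltW.
have dD (t : R) : 0 < t -> is_derive t (1 : R)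
    (fun t => P t - t *: p - gain rho t *: hh t)
    (x t - p + gain rho t *: hs t - gain1 rho t *: hh t).
  move=> t0; have t1 : -1 < t by lra.
  have d1 := is_derive_sub (dP t t0) (is_derive_scale (is_derive_id t (1 : R)) (is_derive_const p t)).
  have d2 := is_derive_scale (is_derive_gain rho t1) (dhh t).
  apply: (is_derive_eq (is_derive_sub d1 d2)).
  by rewrite scaler0 addr0 scale1r scalerN opprB addrA.
have : `|P T - T *: p - gain rho T *: hh T - (P S - S *: p - gain rho S *: hh S)|
    <= (C + B) * b ^+ 2 * T - (C + B) * b ^+ 2 * S.
  apply: (@norm_derive_le R n (fun t => P t - t *: p - gain rho t *: hh t) _
      (fun t => (C + B) * b ^+ 2 * t) (fun=> (C + B) * b ^+ 2 * 1) _ _ ST).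
  - move=> t /andP[St _]; have t0 : 0 < t by lra.
    exact: is_derive_continuous (dD t t0).
  - by move=> t _; exact: is_derive_continuous1 (is_derive_cmul _ (is_derive_id t (1 : R))).
  - by move=> t /andP[St _]; apply: dD; lra.
  - move=> t /andP[St _]; have t0 : 0 <= t by lra.
    have gt2 : gain rho t ^+ 2 <= b ^+ 2.
      rewrite ler_sqr ?nnegrE ?(ltW b0) ?(ltW (gain_gt0 rho t0))//.
      by apply: gain_anti => //; exact: ltW.
    rewrite mulr1 (le_trans (ler_normB _ _))// mulrDl lerD//.
      by rewrite (le_trans (xC t t0))// ler_wpM2l.
    rewrite normrZ mulrC ler_pM//.
    by rewrite (le_trans _ gt2)// norm_gain1_le.
rewrite -mulrBr -/l => h.
have bE : b <= c2 * T `^ (- rho).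
  rewrite /b /gain /c2 -powRM ?(ltW c0) ?(ltW T0)// -/S.
  rewrite !powRN lef_pV2 ?posrE ?powR_gt0//; last by lra.
  by rewrite ge0_ler_powR ?nnegrE//; lra.
have gT : gain rho T <= b by apply: gain_anti => //; exact: ltW.
have h2 : `|P T - P S - l *: p| <= (C + B) * b ^+ 2 * l + 2 * B * b.
  have -> : P T - P S - l *: p = (P T - T *: p - gain rho T *: hh T -
      (P S - S *: p - gain rho S *: hh S)) + (gain rho T *: hh T - gain rho S *: hh S).
    by rewrite /l scalerBl !opprD !opprK; apply/rowP => i; rewrite !mxE; ring.
  rewrite (le_trans (ler_normD _ _))// lerD//.
  rewrite (le_trans (ler_normB _ _))// !normrZ.
  rewrite (gtr0_norm (gain_gt0 _ (ltW T0))) (gtr0_norm (gain_gt0 _ (ltW S0))) -/b.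
  have q1 : gain rho T * `|hh T| <= b * B by rewrite ler_pM// ltW// gain_gt0// ltW.
  have q2 : b * `|hh S| <= b * B by rewrite ler_wpM2l// ltW.
  by lra.
rewrite normrZ gtr0_norm ?invr_gt0// ler_pdivrMl//.
apply: (le_trans h2).
pose u := T `^ (- rho); have u0 : 0 <= u by exact: powR_ge0.
have uu : T `^ (- (2 * rho)) = u * u.
  by rewrite /u -powRD; [congr (_ `^ _); ring|rewrite (gt_eqF T0) implybT].
have Tu : 1 <= u * T.
  rewrite /u -[X in _ * X]powRr1 ?(ltW T0)// -powRD; last by rewrite (gt_eqF T0) implybT.
  by rewrite -[leLHS](powRr0 T) ler_powR//; lra.
rewrite uu; have b2 : b ^+ 2 <= c2 ^+ 2 * (u * u).
  rewrite -expr2 -exprMn ler_sqr ?nnegrE ?(ltW b0)//.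
  exact: mulr_ge0.
have t1 : (C + B) * b ^+ 2 * l <= (C + B) * (c2 ^+ 2 * (u * u)) * l.
  by rewrite ler_wpM2r ?(ltW l0)// ler_wpM2l.
have t2 : 2 * B * b <= 2 * B * kappa * c2 * (u * u) * l.
  have -> : 2 * B * kappa * c2 * (u * u) * l = 2 * B * (c2 * u * (u * T)).
    by rewrite lE; field; rewrite gt_eqF.
  rewrite ler_wpM2l ?mulr_ge0// (le_trans bE)// ler_peMr//.
  exact: mulr_ge0.
have t3 : 0 <= (C + B) * (u * u) * l.
  by apply: mulr_ge0; [apply: mulr_ge0 => //; exact: mulr_ge0|exact: ltW].
by lra.
Qed.

End Averaging.

Theorem theorem2p2 (R : realType) (d m K : nat)
    (hd : (0 < d)%N) (hm : (0 < m)%N) (hK : (0 < K)%N)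
    (omega phi : 'I_K -> R) (homega : injective omega)
    (G0 : 'rV[R]_K -> 'rV[R]_m) (hG0 : analytic_on_CK G0)
    (f : 'rV[R]_d -> 'rV[R]_m -> 'rV[R]_d)
    (a : R -> R) (thetas : 'rV[R]_d)
    (fhat fhathat Upsilonhat : 'rV[R]_d -> 'rV[R[i]%C]_K -> 'rV[R]_d)
    (hQSA1 : QSA1 a)
    (hQSA2 : QSA2 f G0)
    (hQSA3 : QSA3 (fbar f G0) thetas)
    (hQSA4 : QSA4 (fbar f G0) thetas)
    (hQSA5 : QSA5 omega f G0 fhat fhathat Upsilonhat)
    (rho kappa : R) (hrho : 2^-1 < rho < 1) (hkappa : 1 < kappa)
    (ha : forall t, 0 <= t -> a t = (1 + t) `^ (- rho))
    (Theta : R -> 'rV[R]_d)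
    (hTheta : ode_solution
       (fun t theta => a t *: f theta (xi G0 omega phi t)) Theta) :
  (fun t => Theta t -
     (thetas + a t *: (Ybar f G0 fhat thetas - fhat thetas (Phi omega phi t))))
    =o_ (at_pinfty R) a /\
  exists (eps : R -> R) (C : R),
    eps T @[T --> +oo] --> (0 : R) /\
    forall T : R, 0 < T ->
      `|ThetaPR Theta kappa T -
          (thetas + (a T * (cPR kappa rho + eps T)) *: Ybar f G0 fhat thetas)|
      <= C * T `^ (- (2 * rho)).
Proof.
have /andP[rho_half rho1] := hrho.
have rho0 : 0 < rho by rewrite (lt_trans _ rho_half)// invr_gt0.
have cG0 := analytic_continuous hG0.
have Y0 : Ybar f G0 fhat thetas = 0.
  by rewrite /Ybar (Upsilonbar0 cG0 hQSA2 hQSA5) mul0mx.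
have aE (t : R) : 0 <= t -> a t = gain rho t by exact: ha.
have [x [cx dx xTheta]] := ode_solution_extend hTheta.
have dx' (t : R) : 0 < t ->
    is_derive t (1 : R) x (gain rho t *: f (x t) (xi G0 omega phi t)).
  by move=> t0; rewrite -aE ?(ltW t0)//; exact: dx.
have [C0 xC0] := qsa_expansion hG0 hQSA2 hQSA3 hQSA4 hQSA5 rho0 rho1 cx dx'.
pose C := `|C0|; have Cge0 : 0 <= C by exact: normr_ge0.
have xC (t : R) : 0 <= t ->
    `|x t - thetas + gain rho t *: fhat thetas (Phi omega phi t)| <= C * gain rho t ^+ 2.
  by move=> t0; rewrite (le_trans (xC0 t t0))// ler_wpM2r ?sqr_ge0// ler_norm.
split.
  apply/eqoP => e e0.
  have [M M0 hM] := gain_small rho0 (divr_gt0 e0 (ltr_pwDr ltr01 Cge0)).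
  apply: filterS (nbhs_pinfty_ge (num_real M)) => t /= Mt.
  have t0 : 0 <= t by exact: le_trans Mt.
  have b0 := gain_gt0 rho t0.
  rewrite Y0 sub0r scalerN opprD opprK addrA -xTheta// aE//.
  rewrite (le_trans (xC t t0))// (gtr0_norm b0) expr2 mulrA ler_wpM2r ?(ltW b0)//.
  have := hM t Mt; rewrite ler_pdivlMr; last by rewrite ltr_pwDr.
  by apply: le_trans; rewrite mulrC ler_wpM2l ?(ltW b0)// lerDl.
have [B1 B10 hs_le] := along_bounded (w := fhat thetas) omega phi
  (@circle_section_continuous _ _ _ _ _ (QSA5_fhat_C1 hQSA5) thetas).
have [B2 B20 hh_le] := along_bounded (w := fhathat thetas) omega phi
  (@circle_section_continuous _ _ _ _ _ (QSA5_fhathat_C1 hQSA5) thetas).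
have dhh (t : R) : is_derive t (1 : R) (fun t => fhathat thetas (Phi omega phi t))
    (- fhat thetas (Phi omega phi t)).
  have := @poisson_along _ _ _ _ _ _ (QSA5_fhathat_C1 hQSA5) fhat phi (fun=> thetas) 0 t
    (@circle_section_continuous _ _ _ _ _ (QSA5_fhat_C1 hQSA5)) (QSA5_fhathat hQSA5)
    (is_derive_const _ _).
  by rewrite mul0mx sub0r.
have [C' hC'] := @averaged_expansion R d rho kappa C (B1 + B2) thetas x
  (fun t => fhat thetas (Phi omega phi t)) (fun t => fhathat thetas (Phi omega phi t))
  rho0 rho1 hkappa Cge0 (addr_ge0 B10 B20) cx dhh
  (fun t => le_trans (hs_le t) (ler_wpDr B20 (lexx B1)))
  (fun t => le_trans (hh_le t) (ler_wpDl B10 (lexx B2))) xC.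
(* Any eps tending to 0 is a witness, since Ybar vanishes. *)
exists (fun=> 0), C'; split; first exact: cvg_cst.
by move=> T T0; rewrite Y0 scaler0 addr0 (ThetaPR_eq hkappa T0 xTheta); exact: hC'.
Qed.
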